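(* Suppose that $s\geq \tfrac12$ and $2\leq p<4s+1$. Then the equation $$\mathcal{L}u=\lambda u+|u|^{p},\qquad x\in\mathbb{T},$$ admits at least one non-constant even solution for every $\lambda\in(\mathfrak{m}(1),2^{2s}\mathfrak{m}(2))$. Moreover, if $p=2$, the equation admits one non-constant even solution for every $$\lambda\in(-2^{2s}\mathfrak{m}(2),-\mathfrak{m}(1))\cup(\mathfrak{m}(1),2^{2s}\mathfrak{m}(2)).$$
   Context: $\mathbb{T}=\mathbb{R}/2\pi\mathbb{Z}$, $\mathbb{N}=\{1,2,\dots\}$. Functions are real-valued, with Fourier series $u(x)=\sum_{n\in\mathbb{Z}}\widehat u(n)e^{inx}$. For $r>0$, $H^{r}(\mathbb{T})$ is the space of $u\in L^2(\mathbb{T})$ with $\sum_n|n|^{2r}|\widehat u(n)|^2<\infty$, and $H^{r}_+(\mathbb{T})$ is its closed subspace of even functions. The operator $\mathcal{L}$ is the Fourier multiplier $\mathcal{L}u=\sum_{n\in\mathbb{Z}}|n|^{2s}\mathfrak{m}(n)\widehat u(n)e^{inx}$, where $\mathfrak{m}:\mathbb{Z}\to\mathbb{R}_{\ge0}$ satisfies: (M1) $\mathfrak{m}(-n)=\mathfrak{m}(n)$ for all $n\in\mathbb{Z}$; (M2) $\mathfrak{m}:\mathbb{N}\to\mathbb{R}_{\ge0}$ is non-decreasing; (M3) there exist $m_0,m_1>0$ with $m_0<\mathfrak{m}(n)<m_1$ for all $n\in\mathbb{Z}\setminus\{0\}$. An even solution is a function $u\in H^{2s}_+(\mathbb{T})$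 satisfying the equation pointwise almost everywhere. *)

(* Defs.v *)
From mathcomp Require Import all_boot all_order all_algebra.
From mathcomp Require Import all_classical all_reals all_analysis.
From mathcomp Require Import complex.

Set Implicit Arguments.
Unset Strict Implicit.
Unset Printing Implicit Defensive.

Import Order.TTheory GRing.Theory Num.Theory.
Import numFieldNormedType.Exports.

Local Open Scope classical_set_scope.
Local Open Scope complex_scope.
Local Open Scope ring_scope.

(* A function on the torus R/2piZ is represented by a 2pi-periodic function
   on the real line, and integrals over the torus by integrals over
   `[-pi, pi]. *)

Section Torus.
Context {R : realType}.
Implicit Types (u v : R -> R) (c : int -> R[i]).

Definition cis (t : R) : R[i] := cos t +i* sin t.

Definition torus_cintegral (f : R -> R[i]) : R[i] :=
  Rintegral lebesgue_measure `[- pi, pi] (fun x => complex.Re (f x)) +i*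
  Rintegral lebesgue_measure `[- pi, pi] (fun x => complex.Im (f x)).

(* The elements of L^2(T) are genuine functions here, not classes modulo
   almost everywhere equality. *)
Definition L2_torus u : Prop :=
  [/\ periodic u (pi *+ 2), measurable_fun setT u &
      (\int[lebesgue_measure]_(x in `[(- pi)%R, pi]) ((u x) ^+ 2)%:E < +oo)%E].

Definition fourier_coef u (n : int) : R[i] :=
  ((pi *+ 2)^-1)%:C *
  torus_cintegral (fun x => (u x)%:C * cis (- (n%:~R * x))).

Definition sobolev (r : R) u : Prop :=
  L2_torus u /\
  (\esum_(n in [set: int])
     (`|n%:~R| `^ (2 * r) * Normc.normc (fourier_coef u n) ^+ 2)%:E < +oo)%E.

Definition even_sobolev (r : R) u : Prop :=
  sobolev r u /\ forall x, u (- x) = u x.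

(* \sum_(- N <= n <= N) c n * exp (i n x) *)
Definition fourier_partial_sum c (N : nat) (x : R) : R[i] :=
  \sum_(0 <= k < N.*2.+1)
    c (k%:Z - N%:Z) * cis ((k%:Z - N%:Z)%:~R * x).

(* v = \sum_(n in Z) c n * exp (i n x), the series converging in L^2(T). *)
Definition fourier_series_sum c v : Prop :=
  L2_torus v /\
  ((fun N : nat => \int[lebesgue_measure]_(x in `[(- pi)%R, pi])
     (Normc.normc ((v x)%:C - fourier_partial_sum c N x) ^+ 2)%:E)
   @ \oo --> 0)%E.

(* v is (a representative of) L u. *)
Definition is_calL (s : R) (m : int -> R) u v : Prop :=
  fourier_series_sum
    (fun n => (`|n%:~R| `^ (2 * s) * m n)%:C * fourier_coef u n) v.

Definition even_solution (s p : R) (m : int -> R) (lambda : R) u : Prop :=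
  even_sobolev (2 * s) u /\
  exists2 v, is_calL s m u v &
    {ae lebesgue_measure, forall x : R, v x = lambda * u x + `|u x| `^ p}.

(* Since functions are not quotiented, being constant is an almost everywhere
   statement. *)
Definition nonconstant u : Prop :=
  ~ exists k : R, {ae lebesgue_measure, forall x : R, u x = k}.

End Torus.

(* Main.v *)
Require Import Defs.
From mathcomp Require Import all_boot all_order all_algebra.
From mathcomp Require Import all_classical all_reals all_analysis.
From mathcomp Require Import measurable_realfun complex ring lra zify.

Set Implicit Arguments.
Unset Strict Implicit.
Unset Printing Implicit Defensive.

Import Order.TTheory GRing.Theory Num.Theory.
Import numFieldNormedType.Exports.

Local Open Scope classical_set_scope.
Local Open Scope ring_scope.

(** The problem is normalized by an affine substitution [u = kappa w + d]
    ([even_solution_pos], [even_solution_neg]): it is enough to solve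
    [L w = lam (w + |w|^p)] for [lam > m(1)].  For [lambda > 0] this is a
    dilation; for [p = 2] and [lambda < 0] one also translates by the constant
    solution [- lambda], which reverses the sign of the linear term.

    The normalized equation is the Euler-Lagrange equation of
    [E(w) = <L w, w>/2 - lam * int (w^2/2 + |w|^p w/(p+1))], whose only constant
    critical points are [-1] and [0].  The constant [-1] is a strict local
    minimum in [H^(1/2)], surrounded by a ridge of positive height
    ([energy_barrier]), while the constant [1] has lower energy.  As
    [lam > m(1)], the second variation of [E] at [0] is negative in the
    direction [cos x], so a path from [-1] to [1] can avoid [0] and stay below a
    negative level ([energy_path]).  The mountain-pass level therefore lies
    strictly between [E(-1)] and [E(0) = 0], and a critical point at that level
    is not constant.

    Critical points are produced by finite-dimensional approximation.  On cosine
    polynomials of bounded degree, steepest descent deforms the path, and an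
    intermediate value argument yields a trajectory trapped at the level of the
    ridge, along which the gradient becomes arbitrarily small ([mountain_pass]).
    Bounds independent of the dimension come from coercivity: testing the
    equation with the constant [1] controls [|w|^p] in mean, since the
    nonlinearity is positive for large [|w|], and interpolation does the rest
    ([energy_coercive]).

    The only embedding used is that of [H^(1/2)] into every [L^q], compactly.
    Decomposing into dyadic blocks, each block is bounded in the sup-norm and
    exponentially small in [L^2], so the blocks are exponentially small in
    [L^q] ([tint_block_sum_le]).  Consequently partial sums converge almost
    everywhere with a common majorant in [L^q] ([cosine_series_dct]), truncation
    errors are uniform ([plip_tail]), and the nonlinear terms pass to the limit
    ([weak_solution]).

    The limit satisfies the equation on the level of Fourier coefficients.  The
    right-hand side is square integrable, so Bessel's inequality gives the
    Sobolev regularity, and the Fourier series of the right-hand side converges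
    to it in mean square ([cosine_expansion_cvg]); hence the equation holds
    pointwise almost everywhere ([even_solution_of_normalized]). *)

(** * Inequalities for real powers *)

Section Powers.
Context {R : realType}.
Implicit Types (x y z r : R).

(** Bernoulli's inequality, obtained as Young's inequality for the product
    [z * 1]. *)
Lemma powR_ge_tangent1 z r : 0 <= z -> 1 < r -> 1 + r * (z - 1) <= z `^ r.
Proof.
move=> z0 r1; have r0 : 0 < r by lra.
have q0 : 0 < (1 - r^-1)^-1.
  by rewrite invr_gt0 subr_gt0 invf_lt1.
have := @conjugate_powR R z 1 r _ z0 ler01 r0 q0.
rewrite invrK subrKC => /(_ erefl); rewrite mulr1 powR1 mul1r.
by rewrite -(ler_pM2r r0) mulrDl mulrBl mul1r mulVf ?gt_eqF// divfK ?gt_eqF//; lra.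
Qed.

Lemma powR_ge_tangent x y r : 0 <= x -> 0 <= y -> 1 < r ->
  x `^ r + r * x `^ (r - 1) * (y - x) <= y `^ r.
Proof.
move=> x0 y0 r1; have r0 : 0 < r by lra.
move: x0; rewrite le_eqVlt => /predU1P[<-|x0].
  by rewrite !powR0 ?mulr0 ?mul0r ?addr0 ?powR_ge0//; rewrite ?gt_eqF// subr_gt0.
have -> : y = x * (y / x) by rewrite mulrCA divff ?mulr1// gt_eqF.
have x0' := ltW x0; rewrite powRM ?divr_ge0//.
have h := powR_ge_tangent1 (divr_ge0 y0 x0') r1.
apply: le_trans (ler_wpM2l (powR_ge0 x r) h).
rewrite -(mulr_powRB1 (ltW x0) r0) le_eqVlt; apply/orP; left; apply/eqP.
ring.
Qed.

Lemma powR_lipschitz x y m r : 0 <= x <= m -> 0 <= y <= m -> 1 < r ->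
  `|x `^ r - y `^ r| <= r * m `^ (r - 1) * `|x - y|.
Proof.
have aux a b : 0 <= a <= b -> b <= m -> 1 < r ->
    0 <= b `^ r - a `^ r <= r * m `^ (r - 1) * (b - a).
  move=> /andP[a0 ab] bm r1; have b0 := le_trans a0 ab.
  apply/andP; split.
    by rewrite subr_ge0 ge0_ler_powR ?nnegrE//; lra.
  have := powR_ge_tangent b0 a0 r1.
  have : b `^ (r - 1) <= m `^ (r - 1).
    by rewrite ge0_ler_powR ?nnegrE//; [lra|apply: le_trans bm].
  move=> h1 h2; have r0 : 0 <= r * (b - a) by apply: mulr_ge0; lra.
  have := ler_wpM2l r0 h1; lra.
move=> /andP[x0 xm] /andP[y0 ym] r1.
have [xy|/ltW yx] := leP x y.
- have /andP[h1 h2] := aux x y (introT andP (conj x0 xy)) ym r1.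
  by rewrite distrC (distrC x) !ger0_norm ?subr_ge0// -subr_ge0.
- have /andP[h1 h2] := aux y x (introT andP (conj y0 yx)) xm r1.
  by rewrite !ger0_norm ?subr_ge0// -subr_ge0.
Qed.

Lemma powR_le1X x r n : 0 <= x -> 0 <= r <= n%:R -> x `^ r <= 1 + x ^+ n.
Proof.
move=> x0 /andP[r0 rn]; have [x1|/ltW x1] := leP x 1.
  apply: (@le_trans _ _ (1 `^ r)); first by rewrite ge0_ler_powR ?nnegrE.
  by rewrite powR1 lerDl exprn_ge0.
by rewrite (le_trans (ler_powR x1 rn))// powR_mulrn// lerDr.
Qed.

(** Second-order Taylor bound for the odd power [|x|^p x]; convexity on each
    half-line replaces differentiation, and when [x] and [x + t] have opposite
    signs both powers are at most [|t|^(p+1)]. *)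
Lemma odd_powR_taylor (p x t : R) : 1 < p ->
  `| `|x + t| `^ p * (x + t) - `|x| `^ p * x - (p + 1) * `|x| `^ p * t|
   <= (p + 1) * p * (`|x| + `|t|) `^ (p - 1) * t ^+ 2.
Proof.
move=> p1.
have p0 : 0 < p by lra.
have E a : 0 <= a -> a `^ p * a = a `^ (p + 1).
  by move=> a0; rewrite mulrC -[in RHS](mulr_powRB1 a0) ?addrK//; lra.
wlog x0 : x t / 0 <= x => [hw|].
  have [x0|/ltW x0] := leP 0 x; first exact: hw.
  have := hw (- x) (- t); rewrite oppr_ge0 => /(_ x0).
  have -> : `|x + t| `^ p * (x + t) - `|x| `^ p * x - (p + 1) * `|x| `^ p * t
    = - (`|- x - t| `^ p * (- x - t) - `|- x| `^ p * - x - (p + 1) * `|- x| `^ p * - t).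
    by rewrite -opprD !normrN; ring.
  by rewrite !normrN sqrrN.
rewrite (ger0_norm x0).
have [y0|y0] := leP 0 (x + t).
  rewrite (ger0_norm y0) (E _ x0) (E _ y0).
  have p11 : 1 < p + 1 by lra.
  have h1 := powR_ge_tangent x0 y0 p11.
  have h2 := powR_ge_tangent y0 x0 p11.
  rewrite !addrK in h1 h2.
  have xt : 0 <= x <= x + `|t| by rewrite x0 lerDl normr_ge0.
  have yt : 0 <= x + t <= x + `|t| by rewrite y0 lerD2l ler_norm.
  have h3 := powR_lipschitz yt xt p1.
  rewrite (_ : x + t - x = t) in h1 h3; last by ring.
  rewrite (_ : x - (x + t) = - t) in h2; last by ring.
  set m := (x + `|t|) `^ (p - 1) in h3 *.
  have h4 : `|(x + t) `^ p - x `^ p| * `|t| <= p * m * `|t| * `|t|.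
    by rewrite ler_wpM2r.
  have tt : `|t| * `|t| = t ^+ 2 by rewrite -normrM ger0_norm ?sqr_ge0 ?expr2// -expr2 sqr_ge0.
  rewrite -mulrA tt -normrM in h4.
  have h5 := ler_norm (((x + t) `^ p - x `^ p) * t).
  rewrite ger0_norm; last by lra.
  have p10 : 0 <= p + 1 by lra.
  have := ler_wpM2l p10 (le_trans h5 h4); lra.
have t0 : t < 0 by lra.
rewrite (ltr0_norm y0) (ltr0_norm t0).
set z := - (x + t).
have z0 : 0 <= z by rewrite /z; lra.
set s := x - t.
have -> : z `^ p * (x + t) - x `^ p * x - (p + 1) * x `^ p * t =
   (p + 1) * x `^ p * (- t) - x `^ (p + 1) - z `^ (p + 1).
  by rewrite -!E// /z; ring.
have tx : 0 <= - t by lra.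
have xs : x <= - t by lra.
have zs : z <= - t by rewrite /z; lra.
have pp : 0 <= p by lra.
have hx : x `^ p <= (- t) `^ p by rewrite ge0_ler_powR ?nnegrE.
have hx1 : x `^ (p + 1) <= (- t) `^ (p + 1) by rewrite ge0_ler_powR ?nnegrE//; lra.
have hz1 : z `^ (p + 1) <= (- t) `^ (p + 1) by rewrite ge0_ler_powR ?nnegrE//; lra.
have hs : (- t) `^ (p - 1) <= s `^ (p - 1).
  by rewrite ge0_ler_powR ?nnegrE//; rewrite ?/s; lra.
have ht : (- t) `^ (p + 1) = (- t) `^ (p - 1) * t ^+ 2.
  by rewrite -E// -(mulr_powRB1 tx p0); ring.
have h1 : x `^ p * (- t) <= (- t) `^ (p + 1) by rewrite -E// ler_wpM2r.
have h2 : (- t) `^ (p + 1) <= s `^ (p - 1) * t ^+ 2.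
  by rewrite ht ler_wpM2r ?sqr_ge0.
have x1 := powR_ge0 x (p + 1); have z1 := powR_ge0 z (p + 1).
have xp := powR_ge0 x p.
set S := s `^ (p - 1) * t ^+ 2 in h2 *.
have S0 : 0 <= S by rewrite mulr_ge0 ?powR_ge0 ?sqr_ge0.
have -> : (p + 1) * p * s `^ (p - 1) * t ^+ 2 = (p + 1) * p * S by rewrite /S; ring.
have pS : (p + 1) * S <= (p + 1) * p * S by rewrite ler_wpM2r// ler_peMr; lra.
have pS2 : 2 * S <= (p + 1) * p * S.
  rewrite ler_wpM2r//; have : 0 <= (p - 1) * (p + 2) by rewrite mulr_ge0; lra.
  by rewrite (_ : (p - 1) * (p + 2) = (p + 1) * p - 2); [lra|ring].
have h3 : (p + 1) * (x `^ p * (- t)) <= (p + 1) * S.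
  by rewrite ler_wpM2l; lra.
have h4 : 0 <= (p + 1) * (x `^ p * (- t)) by rewrite mulr_ge0 ?mulr_ge0//; lra.
rewrite ler_norml; apply/andP; split; lra.
Qed.

Definition nonlin (p t : R) : R := t + `|t| `^ p.

(** The primitive of [nonlin p] vanishing at [0]. *)
Definition potential (p t : R) : R := t ^+ 2 / 2 + `|t| `^ p * t / (p + 1).

(** The constant [-1] is a strict maximum, with a quadratic gap, of the
    potential [t^2/2 + |t|^p t/(p+1)] on the negative half-line; the term in
    [w^q] absorbs the growth on the positive one. *)
Lemma potential_barrier (p w : R) (q : nat) : 2 <= p -> p + 1 <= q%:R ->
  potential p (w - 1) - potential p (- 1) <= - (w ^+ 2 / 6) + `|w| ^+ q.
Proof.
move=> p2 pq.
have p0 : 0 < p + 1 by lra.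
have E a : 0 <= a -> a `^ p * a = a `^ (p + 1).
  by move=> a0; rewrite mulrC -[in RHS](mulr_powRB1 a0) ?addrK//; lra.
have i0 : 0 < (p + 1)^-1 by rewrite invr_gt0.
have i3 : (p + 1)^-1 <= 3^-1 by rewrite lef_pV2 ?posrE; lra.
have PhiN1 : potential p (- 1) = 2^-1 - (p + 1)^-1.
  by rewrite /potential normrN1 powR1; field; lra.
rewrite PhiN1 /potential; have [w1|w1] := leP w 1.
  set y := 1 - w; have y0 : 0 <= y by rewrite subr_ge0.
  have -> : w - 1 = - y by rewrite /y; ring.
  rewrite normrN (ger0_norm y0) mulrN (E _ y0).
  (* As p >= 2, Bernoulli's inequality reduces the exponent p + 1 to 3, where
     the difference is an explicit cubic. *)
  have yy : y `^ (p + 1) = (y ^+ 3) `^ ((p + 1) / 3).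
    by rewrite -powR_mulrn// -powRrM mulrCA divff ?mulr1.
  have hh : 1 + (p + 1) / 3 * (y ^+ 3 - 1) <= y `^ (p + 1).
    have [p3|p3] := eqVneq p 2.
      rewrite p3 (_ : (2 + 1) / 3 = 1); last by field.
      by rewrite mul1r subrKC (_ : 2 + 1 = 3%:R) ?powR_mulrn//; ring.
    rewrite yy powR_ge_tangent1 ?exprn_ge0//.
    move: p2; rewrite le_eqVlt eq_sym (negbTE p3)/=; lra.
  have h2 : (y ^+ 3 - 1) / 3 <= (y `^ (p + 1) - 1) / (p + 1).
    rewrite ler_pdivlMr//.
    have -> : (y ^+ 3 - 1) / 3 * (p + 1) = (p + 1) / 3 * (y ^+ 3 - 1) by ring.
    lra.
  have h3 : 0 <= `|w| ^+ q by rewrite exprn_ge0.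
  rewrite (_ : w ^+ 2 = (1 - y) ^+ 2); last by rewrite /y; ring.
  have h4 : 0 <= (1 - y) ^+ 2 * y by rewrite mulr_ge0 ?sqr_ge0.
  rewrite mulNr sqrrN mulrBl mul1r in h2 *.
  have e2 : (1 - y) ^+ 2 / 6 = 6^-1 - y ^+ 2 / 2 + y ^+ 3 / 3 - (1 - y) ^+ 2 * y / 3.
    by field.
  rewrite mulrBl mul1r in h2; rewrite e2.
  lra.
have w0 : 0 <= w by lra.
have w10 : 0 <= w - 1 by lra.
rewrite (ger0_norm w10) (ger0_norm w0) E//.
have h1 : (w - 1) `^ (p + 1) <= w ^+ q.
  apply: (@le_trans _ _ (w `^ (p + 1))); first by rewrite ge0_ler_powR ?nnegrE//; lra.
  by rewrite -powR_mulrn// ler_powR//; lra.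
have q2 : (2 <= q)%N by rewrite -(ler_nat R); lra.
have h2 : w ^+ 2 <= w ^+ q by rewrite ler_weXn2l//; lra.
have h3 : (w - 1) `^ (p + 1) / (p + 1) <= w ^+ q / 3.
  apply: ler_pM => //; first exact: powR_ge0.
  exact: ltW.
have h4 : (w - 1) ^+ 2 <= w ^+ 2 by rewrite ler_sqr ?nnegrE//; lra.
lra.
Qed.

End Powers.

(** * Integration over a period *)

Section TorusIntegral.
Context {R : realType}.
Notation mu := (@lebesgue_measure R).
Implicit Types (f g : R -> R).

Definition tint f : R := Rintegral mu `[- pi, pi] f.

Definition tintegrable f := mu.-integrable `[- pi, pi] (EFin \o f).

Lemma pi_itv : - pi < pi :> R.
Proof. by have := @pi_gt0 R; lra. Qed.

Lemma pi2_gt0 : 0 < pi *+ 2 :> R.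
Proof. by have := @pi_gt0 R; rewrite mulr2n; lra. Qed.

Lemma pi2_ge0 : 0 <= pi *+ 2 :> R.
Proof. exact: ltW pi2_gt0. Qed.

Lemma measurable_torus : measurable (`[- pi, pi]%classic : set (measurableTypeR R)).
Proof. exact: measurable_itv. Qed.

Lemma mu_torus : mu `[- pi, pi] = (pi *+ 2)%:E.
Proof.
rewrite lebesgue_measure_itv/= lte_fin pi_itv -EFinD; congr EFin.
by rewrite opprK mulr2n.
Qed.

Lemma continuous_tintegrable f : continuous f -> tintegrable f.
Proof.
move=> cf; apply: continuous_compact_integrable; first exact: segment_compact.
exact: continuous_subspaceT.
Qed.

Lemma eq_tint f g : f =1 g -> tint f = tint g.
Proof. by move=> fg; congr tint; apply/funext. Qed.

Lemma tintD f g : tintegrable f -> tintegrable g ->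
  tint (fun x => f x + g x) = tint f + tint g.
Proof. by move=> *; apply: RintegralD => //; exact: measurable_torus. Qed.

Lemma tintB f g : tintegrable f -> tintegrable g ->
  tint (fun x => f x - g x) = tint f - tint g.
Proof. by move=> *; apply: RintegralB => //; exact: measurable_torus. Qed.

Lemma tintZ k f : tintegrable f -> tint (fun x => k * f x) = k * tint f.
Proof. by move=> *; apply: RintegralZl => //; exact: measurable_torus. Qed.

Lemma tint_cst k : tint (fun=> k) = k * (pi *+ 2).
Proof.
rewrite /tint; apply: etrans (Rintegral_cst mu measurable_torus k) _.
by rewrite -[pi *+ 2]/(fine (pi *+ 2)%:E) -mu_torus.
Qed.

Lemma le_tint f g : tintegrable f -> tintegrable g ->
  (forall x, f x <= g x) -> tint f <= tint g.
Proof. by move=> fi gi fg; rewrite /tint; apply: (le_Rintegral measurable_torus fi gi) => x _; exact: fg. Qed.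

Lemma tint_ge0 f : (forall x, 0 <= f x) -> 0 <= tint f.
Proof. by move=> f0; rewrite /tint; apply: Rintegral_ge0 => x _; exact: f0. Qed.

Lemma tintegrableD f g : tintegrable f -> tintegrable g ->
  tintegrable (fun x => f x + g x).
Proof. by move=> fi gi; exact: (integrableD measurable_torus fi gi). Qed.

Lemma tintegrableB f g : tintegrable f -> tintegrable g ->
  tintegrable (fun x => f x - g x).
Proof. by move=> fi gi; exact: (integrableB measurable_torus fi gi). Qed.

Lemma tintegrableZ k f : tintegrable f -> tintegrable (fun x => k * f x).
Proof. by move=> fi; exact: (integrableZl measurable_torus k fi). Qed.

Lemma tintegrable_cst k : tintegrable (fun=> k).
Proof. by apply: continuous_tintegrable => x; exact: cvg_cst. Qed.

Lemma tintegrable_le f g : measurable_fun setT f -> tintegrable g ->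
  (forall x, `|f x| <= g x) -> tintegrable f.
Proof.
move=> mf ig fg; apply: (le_integrable measurable_torus _ _ ig).
  by apply/measurable_EFinP; exact: measurable_funTS.
by move=> x _ /=; rewrite lee_fin (le_trans (fg x))// ler_norm.
Qed.

Lemma tintegrable_norm f : tintegrable f -> tintegrable (fun x => `|f x|).
Proof. by move=> h; apply: (integrable_norm h); exact: measurable_torus. Qed.

Lemma ler_norm_tint f g : tintegrable f -> tintegrable g ->
  (forall x, `|f x| <= g x) -> `|tint f| <= tint g.
Proof.
move=> fi gi fg; apply: (@le_trans _ _ (tint (fun x => `|f x|))).
  exact: (le_normr_Rintegral measurable_torus fi).
by apply: le_tint => //; exact: tintegrable_norm.
Qed.

Lemma tintegrable_sum (I : Type) (s : seq I) (F : I -> R -> R) :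
  (forall i, tintegrable (F i)) -> tintegrable (fun x => \sum_(i <- s) F i x).
Proof.
move=> iF; elim: s => [|i s IH].
  by under eq_fun do rewrite big_nil; exact: tintegrable_cst.
by under eq_fun do rewrite big_cons; apply: tintegrableD.
Qed.

Lemma tint_sum (I : Type) (s : seq I) (F : I -> R -> R) :
  (forall i, tintegrable (F i)) ->
  tint (fun x => \sum_(i <- s) F i x) = \sum_(i <- s) tint (F i).
Proof.
move=> iF; elim: s => [|i s IH].
  rewrite big_nil -[RHS](mul0r (pi *+ 2)) -tint_cst.
  by apply: eq_tint => x; rewrite big_nil.
rewrite big_cons -IH -tintD//; last exact: tintegrable_sum.
by apply: eq_tint => x; rewrite big_cons.
Qed.

Lemma continuous_cosM (k : R) : continuous (fun x => cos (k * x)).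
Proof.
move=> x; apply: continuous_comp; last exact: continuous_cos.
by apply: cvgMr; exact: cvg_id.
Qed.

Lemma continuous_sinM (k : R) : continuous (fun x => sin (k * x)).
Proof.
move=> x; apply: continuous_comp; last exact: continuous_sin.
by apply: cvgMr; exact: cvg_id.
Qed.

Lemma tint_deriv (f F : R -> R) : continuous f ->
  (forall x : R, is_derive x 1 F (f x)) -> tint f = F pi - F (- pi).
Proof.
move=> cf dF; rewrite /tint /Rintegral (@continuous_FTC2 _ _ F)//.
- exact: pi_itv.
- exact: continuous_subspaceT.
- have dF' x : derivable F x 1 by have [] := dF x.
  have cF : continuous F by move=> x; apply: differentiable_continuous; apply/derivable1_diffP.
  split => //.
  + by apply: cvg_at_right_filter; exact: cF.
  + by apply: cvg_at_left_filter; exact: cF.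
- by move=> x _; rewrite derive1E; have [_ ->] := dF x.
Qed.

Lemma sin_natMpi (k : nat) : sin (k%:R * pi) = 0 :> R.
Proof.
elim: k => [|k IH]; first by rewrite mul0r sin0.
by rewrite -natr1 mulrDl mul1r sinDpi IH oppr0.
Qed.

Lemma is_derive_scaled (F : R -> R) (dF : R -> R) (c x : R) : c != 0 ->
  (forall y : R, is_derive y 1 F (dF y)) ->
  is_derive x 1 (fun x => c^-1 * F (c * x)) (dF (c * x)).
Proof.
move=> c0 hF.
have h1 : is_derive x (1 : R) (fun x : R => c * x) c.
  have h := is_deriveZ c (is_derive_id x (1 : R)).
  by rewrite (_ : c%:A = c) ?/(_ *: _)/= ?mulr1// in h.
have h2 := is_derive1_comp (hF (c * x)) h1.
have h := is_deriveZ c^-1 h2.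
by rewrite (_ : c^-1 *: _ = dF (c * x)) in h; last by rewrite /(_ *: _)/= mulrCA mulVf ?mulr1.
Qed.

Lemma tint_cos (k : nat) :
  tint (fun x => cos (k%:R * x)) = if k == 0%N then pi *+ 2 else 0.
Proof.
case: k => [|k] /=.
  by under eq_tint do rewrite mul0r cos0; rewrite tint_cst mul1r.
have c0 : k.+1%:R != 0 :> R by rewrite pnatr_eq0.
have dF := fun x => is_derive_scaled x c0 (@is_derive_sin R).
rewrite (tint_deriv (@continuous_cosM k.+1%:R) dF).
by rewrite mulrN sinN sin_natMpi oppr0 mulr0 subrr.
Qed.

Lemma tint_sin (k : R) : tint (fun x => sin (k * x)) = 0.
Proof.
have [->|k0] := eqVneq k 0.
  by under eq_tint do rewrite mul0r sin0; rewrite tint_cst mul0r.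
have dcos (y : R) : is_derive y (1 : R) (fun x : R => - cos x) (sin y).
  by have h := is_deriveN (is_derive_cos y); rewrite opprK in h.
have dF := fun x => is_derive_scaled x k0 dcos.
by rewrite (tint_deriv (@continuous_sinM k) dF) !(mulrN k) cosN subrr.
Qed.

Lemma natrB_cos (k l : nat) (x : R) :
  cos (k%:R * x - l%:R * x) = cos ((k - l + (l - k))%N%:R * x).
Proof.
have [kl|/ltnW kl] := leqP k l.
  by rewrite -cosN opprB -mulrBl -natrB// (eqP kl) add0n.
by rewrite -mulrBl -natrB// (eqP kl) addn0.
Qed.

Lemma cosM_cos (k l : nat) (x : R) : cos (k%:R * x) * cos (l%:R * x) =
  2^-1 * (cos ((k + l)%:R * x) + cos ((k - l + (l - k))%N%:R * x)).
Proof. by rewrite -natrB_cos natrD mulrDl cosD cosB; field. Qed.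

(** The squared norm of [cos (k x)] over a period. *)
Definition cos_weight (k : nat) : R := if k == 0%N then pi *+ 2 else pi.

Lemma cos_weight_ge (k : nat) : pi <= cos_weight k.
Proof. by rewrite /cos_weight; case: ifP => // _; rewrite mulr2n lerDl pi_ge0. Qed.

Lemma cos_weight_gt0 (k : nat) : 0 < cos_weight k.
Proof. by apply: lt_le_trans (cos_weight_ge k); exact: pi_gt0. Qed.

Lemma cos_weight_le (k : nat) : cos_weight k <= pi *+ 2.
Proof. by rewrite /cos_weight; case: ifP => // _; rewrite mulr2n lerDl pi_ge0. Qed.

Lemma tint_cosM (k l : nat) :
  tint (fun x => cos (k%:R * x) * cos (l%:R * x)) =
  if k == l then cos_weight k else 0.
Proof.
under eq_tint do rewrite cosM_cos.
rewrite tintZ; last by apply: tintegrableD; apply: continuous_tintegrable; exact: continuous_cosM.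
rewrite tintD; try by apply: continuous_tintegrable; exact: continuous_cosM.
rewrite !tint_cos !addn_eq0 !subn_eq0 -eqn_leq /cos_weight.
case: (eqVneq k l) => [->|kl]; first by rewrite andbb; case: (l == 0%N); field.
rewrite (_ : (k == 0%N) && (l == 0%N) = false) ?addr0 ?mulr0//.
by apply/negP => /andP[/eqP k0 /eqP l0]; rewrite k0 l0 eqxx in kl.
Qed.

Lemma tint_cosM_sin (k l : R) : tint (fun x => cos (k * x) * sin (l * x)) = 0.
Proof.
transitivity (tint (fun x => 2^-1 * (sin ((l + k) * x) + sin ((l - k) * x)))).
  by apply: eq_tint => x; rewrite mulrDl mulrBl sinD sinB; field.
rewrite tintZ; last by apply: tintegrableD; apply: continuous_tintegrable; exact: continuous_sinM.
by rewrite tintD ?tint_sin ?addr0 ?mulr0//; apply: continuous_tintegrable; exact: continuous_sinM.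
Qed.

End TorusIntegral.

(** * Cosine polynomials and the dyadic Sobolev embedding *)

Section CosinePolynomials.
Context {R : realType}.
Implicit Types (a : nat -> R) (x : R).

Definition cospoly (m n : nat) a x : R :=
  \sum_(m <= k < n) a k * cos (k%:R * x).

Lemma continuous_sum (I : Type) (s : seq I) (F : I -> R -> R) :
  (forall i, continuous (F i)) -> continuous (fun x => \sum_(i <- s) F i x).
Proof.
move=> cF; elim: s => [|i s IH] x.
  rewrite (_ : (fun _ => _) = cst 0); first exact: cvg_cst.
  by apply/funext => y; rewrite big_nil.
rewrite (_ : (fun _ => _) = (fun y => F i y + \sum_(j <- s) F j y)).
  by apply: cvgD; [exact: cF|exact: IH].
by apply/funext => y; rewrite big_cons.
Qed.

Lemma continuous_cospoly m n a : continuous (cospoly m n a).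
Proof.
apply: continuous_sum => k x.
by apply: cvgMr; exact: continuous_cosM.
Qed.

Lemma continuous_exprn (f : R -> R) (n : nat) :
  continuous f -> continuous (fun x => f x ^+ n).
Proof.
move=> cf x.
exact: (@continuous_comp _ _ _ f (fun y : R => y ^+ n) x (cf x) (@exprn_continuous _ n (f x))).
Qed.

Lemma continuous_normf (f : R -> R) :
  continuous f -> continuous (fun x => `|f x|).
Proof. by move=> cf x; apply: cvg_norm; exact: cf. Qed.

Lemma cospoly_split m n p a x : (m <= n)%N -> (n <= p)%N ->
  cospoly m p a x = cospoly m n a x + cospoly n p a x.
Proof. by move=> mn np; rewrite /cospoly (big_cat_nat mn np). Qed.

Lemma norm_cospoly_le m n a x :
  `|cospoly m n a x| <= \sum_(m <= k < n) `|a k|.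
Proof.
apply: le_trans (ler_norm_sum _ _ _) _; apply: ler_sum => k _.
by rewrite normrM ler_piMr// cos_max.
Qed.

Lemma tint_cospolyM_cos m n a (l : nat) :
  tint (fun x => cospoly m n a x * cos (l%:R * x)) =
  if (m <= l < n)%N then cos_weight l * a l else 0.
Proof.
transitivity (\sum_(m <= k < n) a k * (if k == l then cos_weight k else 0)).
  transitivity (tint (fun x => \sum_(m <= k < n)
      a k * (cos (k%:R * x) * cos (l%:R * x)))).
    by apply: eq_tint => x; rewrite mulr_suml; apply: eq_bigr => k _; rewrite mulrA.
  have cc k : continuous (fun x : R => cos (k%:R * x) * cos (l%:R * x)).
    by move=> x; apply: cvgM; exact: continuous_cosM.
  rewrite tint_sum => [|k]; last by apply: tintegrableZ; exact: continuous_tintegrable.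
  apply: eq_bigr => k _; rewrite tintZ ?tint_cosM//; exact: continuous_tintegrable.
have [lmn|lmn] := boolP (m <= l < n)%N.
  rewrite (bigD1_seq l) ?mem_index_iota ?iota_uniq//= eqxx big1 ?addr0 1?mulrC//.
  by move=> k /negbTE ->; rewrite mulr0.
rewrite big_nat big1// => k kmn; case: eqVneq => [kl|]; last by rewrite mulr0.
by move: lmn; rewrite -kl kmn.
Qed.

Lemma tint_cospolyM m n a b :
  tint (fun x => cospoly m n a x * cospoly m n b x) =
  \sum_(m <= k < n) cos_weight k * (a k * b k).
Proof.
transitivity (tint (fun x => \sum_(m <= k < n)
    b k * (cospoly m n a x * cos (k%:R * x)))).
  by apply: eq_tint => x; rewrite mulr_sumr; apply: eq_bigr => k _; rewrite mulrCA.
have cc k : continuous (fun x : R => cospoly m n a x * cos (k%:R * x)).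
  by move=> x; apply: cvgM; [exact: continuous_cospoly|exact: continuous_cosM].
rewrite tint_sum => [|k]; last by apply: tintegrableZ; exact: continuous_tintegrable.
apply: eq_big_nat => k kmn.
rewrite tintZ ?tint_cospolyM_cos ?kmn; [by ring|exact: continuous_tintegrable].
Qed.

Lemma tint_sqr_cospoly m n a :
  tint (fun x => cospoly m n a x ^+ 2) =
  \sum_(m <= k < n) cos_weight k * a k ^+ 2.
Proof. by under eq_tint do rewrite expr2; rewrite tint_cospolyM. Qed.

Lemma sqr_sum_le (I : Type) (s : seq I) (F : I -> R) :
  (\sum_(i <- s) F i) ^+ 2 <= (size s)%:R * \sum_(i <- s) F i ^+ 2.
Proof.
elim: s => [|i s IH]; first by rewrite !big_nil expr0n/= mul0r.
rewrite !big_cons /= -natr1; set S := \sum_(j <- s) F j in IH *.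
set Q := \sum_(j <- s) F j ^+ 2 in IH *; set n : R := (size s)%:R in IH *.
have n0 : 0 <= n by rewrite ler0n.
have Q0 : 0 <= Q by apply: sumr_ge0 => j _; exact: sqr_ge0.
move: n0; rewrite le_eqVlt => /predU1P[n0|n0].
  move: IH; rewrite -n0 mul0r => S0.
  have /eqP -> : S == 0 by rewrite -sqrf_eq0 eq_le S0 sqr_ge0.
  by rewrite addr0 add0r mul1r lerDl.
have h : 0 <= (S - n * F i) ^+ 2 / n by rewrite divr_ge0 ?sqr_ge0// ltW.
have h2 : S ^+ 2 / n <= Q by rewrite ler_pdivrMr// mulrC.
have e : (S - n * F i) ^+ 2 / n = S ^+ 2 / n - 2 * S * F i + n * F i ^+ 2.
  by field; rewrite gt_eqF.
rewrite e in h.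
have -> : (F i + S) ^+ 2 = F i ^+ 2 + 2 * S * F i + S ^+ 2 by ring.
have -> : (n + 1) * (F i ^+ 2 + Q) = n * F i ^+ 2 + n * Q + F i ^+ 2 + Q by ring.
lra.
Qed.

(** The squared [H^(1/2)] norm, up to constants; the weight [k + 1] rather than
    [k] keeps the mean value under control. *)
Definition half_norm (m n : nat) a : R :=
  \sum_(m <= k < n) k.+1%:R * a k ^+ 2.

Lemma half_norm_ge0 m n a : 0 <= half_norm m n a.
Proof. by apply: sumr_ge0 => k _; rewrite mulr_ge0 ?sqr_ge0. Qed.

Lemma half_norm_le m n m' n' a : (m' <= m)%N -> (n <= n')%N ->
  half_norm m n a <= half_norm m' n' a.
Proof.
move=> mm nn; have [mn|nm] := leqP m n; last first.
  by rewrite /half_norm big_geq ?half_norm_ge0// ltnW.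
rewrite [leRHS]/half_norm (big_cat_nat mm (leq_trans mn nn))/=.
rewrite (big_cat_nat mn nn)/= addrCA lerDl.
by rewrite addr_ge0//; exact: half_norm_ge0.
Qed.

(** Frequency [k] lies in the [j]-th dyadic block when [2^j <= k + 1 < 2^(j+1)]. *)
Definition dyad (j : nat) : nat := (2 ^ j).-1.

Lemma leq_dyad i j : (i <= j)%N -> (dyad i <= dyad j)%N.
Proof.
by move=> ij; rewrite /dyad -!subn1 leq_sub2r// leq_pexp2l.
Qed.

Lemma leq_id_dyad j : (j <= dyad j)%N.
Proof. by rewrite /dyad -ltnS prednK ?expn_gt0// ltn_expl. Qed.

Definition block (j : nat) a x : R := cospoly (dyad j) (dyad j.+1) a x.

Lemma sum_block J M a x : (J <= M)%N ->
  \sum_(J <= j < M) block j a x = cospoly (dyad J) (dyad M) a x.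
Proof.
elim: M => [|M IH]; first by rewrite leqn0 => /eqP ->; rewrite /cospoly !big_geq.
rewrite leq_eqVlt => /predU1P[->|]; first by rewrite /cospoly !big_geq.
rewrite ltnS => JM.
by rewrite big_nat_recr//= IH// -cospoly_split// leq_dyad.
Qed.

Lemma dyad_mass_le j a :
  2 ^+ j * \sum_(dyad j <= k < dyad j.+1) a k ^+ 2 <=
  half_norm (dyad j) (dyad j.+1) a.
Proof.
rewrite mulr_sumr /half_norm big_nat [leRHS]big_nat; apply: ler_sum => k /andP[jk _].
rewrite ler_wpM2r ?sqr_ge0// -natrX ler_nat.
by move: jk; rewrite /dyad; have := expn_gt0 2 j; lia.
Qed.

(** The [j]-th block has [2^j] terms and [L^2] mass at most [2^-j] times its
    [H^(1/2)] mass, so by Cauchy-Schwarz its sup-norm does not grow with [j]. *)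
Lemma sqr_block_le j a x : block j a x ^+ 2 <= half_norm (dyad j) (dyad j.+1) a.
Proof.
apply: le_trans (dyad_mass_le j a).
apply: le_trans (sqr_sum_le _ _) _; rewrite size_iota.
have -> : (dyad j.+1 - dyad j)%N = (2 ^ j)%N.
  by rewrite /dyad expnS; have := expn_gt0 2 j; lia.
rewrite natrX ler_wpM2l ?exprn_ge0//; apply: ler_sum => k _.
by rewrite exprMn ler_piMr ?sqr_ge0.
Qed.

Lemma tint_sqr_block_le j a :
  tint (fun x => block j a x ^+ 2) <=
  pi *+ 2 * 2^-1 ^+ j * half_norm (dyad j) (dyad j.+1) a.
Proof.
rewrite tint_sqr_cospoly.
apply: (@le_trans _ _ (pi *+ 2 * \sum_(dyad j <= k < dyad j.+1) a k ^+ 2)).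
  by rewrite mulr_sumr; apply: ler_sum => k _; rewrite ler_wpM2r ?sqr_ge0// cos_weight_le.
rewrite -mulrA ler_wpM2l ?pi2_ge0//.
by rewrite exprVn mulrC ler_pdivlMr ?exprn_gt0// mulrC dyad_mass_le.
Qed.

(** The second coefficient has to stay below [3/2] for the recursion in
    [tint_block_sum_le] to close; the first one is free. *)
Lemma powD_le (q : nat) : (0 < q)%N -> exists2 C : R, 0 <= C &
  forall x y : R, 0 <= x -> 0 <= y ->
    (x + y) ^+ q <= C * x ^+ q + 4 / 3 * y ^+ q.
Proof.
move=> q0.
pose d : R := (4 / 3) `^ (q%:R^-1) - 1.
have d1 : 0 < d.
  rewrite subr_gt0 -[ltLHS](powRr0 (4 / 3)) /powR.
  have h43 : (4 / 3 : R) == 0 = false by apply/eqP; lra.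
  rewrite h43 ltr_expR mul0r mulr_gt0 ?invr_gt0 ?ltr0n//.
  by rewrite ln_gt0//; lra.
have dq : (1 + d) ^+ q = 4 / 3.
  rewrite /d addrC subrK -powR_mulrn ?powR_ge0// -powRrM mulVf ?pnatr_eq0 -?lt0n//.
  by rewrite powRr1//; lra.
exists ((1 + d^-1) ^+ q).
  by rewrite exprn_ge0// addr_ge0// invr_ge0 ltW.
move=> x y x0 y0; have [xy|yx] := leP x (d * y).
  apply: (@le_trans _ _ (4 / 3 * y ^+ q)).
    rewrite -dq -exprMn lerXn2r ?nnegrE ?addr_ge0//; last by rewrite mulrDl mul1r addrC lerD2l.
    by rewrite mulr_ge0// addr_ge0// ltW.
  by rewrite lerDr mulr_ge0 ?exprn_ge0// addr_ge0// invr_ge0 ltW.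
apply: (@le_trans _ _ ((1 + d^-1) ^+ q * x ^+ q)).
  rewrite -exprMn lerXn2r ?nnegrE ?addr_ge0//.
    by rewrite mulr_ge0// addr_ge0// invr_ge0 ltW.
  by rewrite mulrDl mul1r lerD2l mulrC ler_pdivlMr// mulrC ltW.
by rewrite lerDl mulr_ge0 ?exprn_ge0//; lra.
Qed.

(** A majorant of all dyadic partial sums at once, increasing in [M]. *)
Definition block_sum (J M : nat) a x : R := \sum_(J <= j < M) `|block j a x|.

Lemma block_sum_ge0 J M a x : 0 <= block_sum J M a x.
Proof. exact: sumr_ge0. Qed.

Lemma continuous_block_sum J M a : continuous (block_sum J M a).
Proof.
by apply: continuous_sum => j; apply: continuous_normf; exact: continuous_cospoly.
Qed.

Lemma norm_cospoly_block_sum J M a x : (J <= M)%N ->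
  `|cospoly (dyad J) (dyad M) a x| <= block_sum J M a x.
Proof. by move=> JM; rewrite -sum_block//; exact: ler_norm_sum. Qed.

(** A block has sup-norm at most [Z^(1/2)] and [L^2] norm at most a multiple of
    [(2^-j Z)^(1/2)], [Z] being the [half_norm]; hence its [L^(2r)] norm decays
    geometrically in [j] and the blocks are summable in [L^(2r)].  In the
    induction from the top block downwards, adding one more block costs a
    factor [4/3], which the decay absorbs as [4/3 * 2/3 < 1]. *)
Lemma tint_block_sum_le (r : nat) : (0 < r)%N -> exists2 K : R, 0 <= K &
  forall a J M (Z : R), (J <= M)%N -> half_norm 0 (dyad M) a <= Z ->
  tint (fun x => block_sum J M a x ^+ (2 * r)) <= K * (2 / 3) ^+ J * Z ^+ r.
Proof.
move=> r0; have [|C C0 hC] := @powD_le (2 * r); first by rewrite muln_gt0.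
(* The recursion S_J <= (K/9 + 8K/9) * (2/3)^J * Z^r dictates the factor 9. *)
pose K : R := 9 * (pi *+ 2 * C).
have pi2 := @pi2_ge0 R.
have K0 : 0 <= K by rewrite !mulr_ge0//; lra.
have hK : K = 9 * (C * (pi *+ 2)) by rewrite /K; ring.
clearbody K; exists K => // a J M Z JM hZ.
have Z0 : 0 <= Z by apply: le_trans hZ; exact: half_norm_ge0.
have cpow J' M' n : tintegrable (fun x => block_sum J' M' a x ^+ n).
  by apply/continuous_tintegrable/continuous_exprn/continuous_block_sum.
have [d] := ubnP (M - J)%N; elim: d J JM => [//|d IH] J JM dJ.
move: JM; rewrite leq_eqVlt => /predU1P[JM|JM].
  under eq_tint do rewrite /block_sum JM big_geq// expr0n muln_eq0 (gtn_eqF r0)/=.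
  by rewrite tint_cst mul0r !mulr_ge0 ?exprn_ge0//; lra.
have {}IH := IH J.+1 JM ltac:(lia).
have cb n : tintegrable (fun x => `|block J a x| ^+ n).
  by apply/continuous_tintegrable/continuous_exprn/continuous_normf/continuous_cospoly.
have hJ : half_norm (dyad J) (dyad J.+1) a <= Z.
  by apply: le_trans hZ; apply: half_norm_le => //; exact: leq_dyad.
have hb : tint (fun x => `|block J a x| ^+ (2 * r)) <=
    pi *+ 2 * 2^-1 ^+ J * Z ^+ r.
  apply: (@le_trans _ _ (tint (fun x => Z ^+ r.-1 * `|block J a x| ^+ 2))).
    apply: le_tint => // [|x]; first exact: tintegrableZ.
    have -> : (2 * r = 2 * r.-1 + 2)%N by lia.
    rewrite exprD ler_wpM2r ?exprn_ge0//.
    rewrite exprM lerXn2r ?nnegrE ?sqr_ge0//.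
    by rewrite (real_normK (num_real _)) (le_trans (sqr_block_le J a x)).
  have -> : Z ^+ r = Z ^+ r.-1 * Z by rewrite -exprSr prednK.
  rewrite tintZ// [leRHS]mulrCA ler_wpM2l ?exprn_ge0//.
  under eq_tint do rewrite (real_normK (num_real _)).
  apply: le_trans (tint_sqr_block_le J a) _.
  by rewrite ler_wpM2l// mulr_ge0// exprn_ge0// invr_ge0.
apply: (@le_trans _ _ (tint (fun x => C * `|block J a x| ^+ (2 * r)
     + 4 / 3 * block_sum J.+1 M a x ^+ (2 * r)))).
  apply: le_tint => // [|x].
    by apply: tintegrableD; apply: tintegrableZ.
  rewrite /block_sum big_ltn//; apply: hC => //; exact: block_sum_ge0.
rewrite tintD; [|exact: tintegrableZ|exact: tintegrableZ].
rewrite !tintZ//.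
have h1 := ler_wpM2l C0 hb.
have h43 : 0 <= 4 / 3 :> R by lra.
have h2 := ler_wpM2l h43 IH.
apply: le_trans (lerD h1 h2) _.
have h3 : (2^-1 : R) ^+ J <= (2 / 3) ^+ J by rewrite lerXn2r ?nnegrE//; lra.
rewrite !mulrA -mulrDl ler_wpM2r ?exprn_ge0// exprS.
have h4 : C * (pi *+ 2 * 2^-1 ^+ J) <= C * (pi *+ 2) * (2 / 3) ^+ J.
  by rewrite -!mulrA !ler_wpM2l.
set P := (2 / 3) ^+ J in h4 *.
rewrite hK; rewrite mulrA in h4; set D := C * (pi *+ 2) in h4 *.
lra.
Qed.

End CosinePolynomials.

(** * A mountain pass by steepest descent *)

Section Descent.
Context {R : realType}.
Implicit Types (a b t : nat -> R) (f : (nat -> R) -> R).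

(** [f] is continuous as a function of the first [n] coordinates only.  All
    filters are allowed, so that the notion serves both continuous paths of
    sequences and limits along an ultrafilter. *)
Definition fincont (n : nat) f : Prop :=
  forall (T : Type) (F : set_system T) (FF : Filter F) (c : T -> nat -> R) a,
    (forall k, (k < n)%N -> c x k @[x --> F] --> a k) ->
    f (c x) @[x --> F] --> f a.

Lemma fincont_coord n k : (k < n)%N -> fincont n (fun a => a k).
Proof. by move=> kn T F FF c a ca; exact: ca. Qed.

Lemma fincont_cst n (r : R) : fincont n (fun=> r).
Proof. by move=> *; exact: cvg_cst. Qed.

Lemma fincontD n f g : fincont n f -> fincont n g ->
  fincont n (fun a => f a + g a).
Proof. by move=> cf cg T F FF c a ca; apply: cvgD; [exact: cf|exact: cg]. Qed.

Lemma fincontN n f : fincont n f -> fincont n (fun a => - f a).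
Proof. by move=> cf T F FF c a ca; apply: cvgN; exact: cf. Qed.

Lemma fincontB n f g : fincont n f -> fincont n g ->
  fincont n (fun a => f a - g a).
Proof. by move=> cf cg; apply: fincontD => //; exact: fincontN. Qed.

Lemma fincontM n f g : fincont n f -> fincont n g ->
  fincont n (fun a => f a * g a).
Proof. by move=> cf cg T F FF c a ca; apply: cvgM; [exact: cf|exact: cg]. Qed.

Lemma fincontX n f m : fincont n f -> fincont n (fun a => f a ^+ m).
Proof.
move=> cf; elim: m => [|m IH]; first exact: fincont_cst.
by under eq_fun do rewrite exprS; exact: fincontM.
Qed.

Lemma fincontV n f : (forall a, f a != 0) -> fincont n f ->
  fincont n (fun a => (f a)^-1).
Proof. by move=> f0 cf T F FF c a ca; apply: cvgV => //; exact: cf. Qed.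

Lemma fincont_sum n (h : nat -> (nat -> R) -> R) i j :
  (forall k, (i <= k < j)%N -> fincont n (h k)) ->
  fincont n (fun a => \sum_(i <= k < j) h k a).
Proof.
move=> ch; have [ij|ji] := leqP i j; last first.
  by under eq_fun do rewrite big_geq ?(ltnW ji)//; exact: fincont_cst.
elim: j ij ch => [|j IH].
  by move=> _ _; under eq_fun do rewrite big_geq//; exact: fincont_cst.
rewrite leq_eqVlt => /predU1P[->|].
  by move=> _; under eq_fun do rewrite big_geq//; exact: fincont_cst.
rewrite ltnS => ij ch; under eq_fun do rewrite big_nat_recr//=.
apply: fincontD; last by apply: ch; rewrite ij/=.
by apply: IH => // k /andP[ik kj]; apply: ch; rewrite ik ltnS ltnW.
Qed.

Variables (n : nat) (E Lf D : (nat -> R) -> R) (g : nat -> (nat -> R) -> R).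
Hypotheses (cE : fincont n E) (cLf : fincont n Lf) (cD : fincont n D)
  (cg : forall k, (k < n)%N -> fincont n (g k)) (Lf1 : forall a, 1 <= Lf a).
Hypothesis taylor : forall a t, \sum_(0 <= k < n) t k ^+ 2 <= 1 ->
  E (fun k => a k + t k) <=
  E a + \sum_(0 <= k < n) g k a * t k + Lf a * \sum_(0 <= k < n) t k ^+ 2.

Let G a := \sum_(0 <= k < n) g k a ^+ 2.

Let G_ge0 a : 0 <= G a.
Proof. by apply: sumr_ge0 => k _; exact: sqr_ge0. Qed.

(* The displacement of a descent step has squared length step^2 * G <= 1, as
   the Taylor bound requires, and step * Lf <= 1/2 keeps half of the first-order
   decrease. *)
Let step a := (2 * Lf a + G a)^-1.

Let step_gt0 a : 0 < step a.
Proof. by rewrite invr_gt0; have := Lf1 a; have := G_ge0 a; lra. Qed.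

Let descent a k := if (k < n)%N then a k - step a * g k a else a k.

Let cG : fincont n G.
Proof.
by apply: fincont_sum => k /andP[_ kn]; apply: fincontX; exact: cg.
Qed.

Let cstep : fincont n step.
Proof.
apply: fincontV; first by move=> a; rewrite gt_eqF// -invr_gt0; exact: step_gt0.
by apply: fincontD => //; apply: fincontM => //; exact: fincont_cst.
Qed.

Let descent_le a : E (descent a) <= E a - step a * G a / 2.
Proof.
pose t k := if (k < n)%N then - (step a * g k a) else 0.
have -> : descent a = (fun k => a k + t k).
  by apply/funext => k; rewrite /descent /t; case: ifP; rewrite ?addr0.
have tt : \sum_(0 <= k < n) t k ^+ 2 = step a ^+ 2 * G a.
  rewrite /G mulr_sumr; apply: eq_big_nat => k /andP[_ kn].
  by rewrite /t kn sqrrN exprMn.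
have gt : \sum_(0 <= k < n) g k a * t k = - (step a * G a).
  rewrite /G mulr_sumr -sumrN; apply: eq_big_nat => k /andP[_ kn].
  by rewrite /t kn; ring.
have G0 := G_ge0 a; have L1 := Lf1 a; have s0 := step_gt0 a.
have sL : step a * (2 * Lf a + G a) = 1.
  by rewrite mulVf// gt_eqF//; lra.
have sG0 : 0 <= step a * G a by rewrite mulr_ge0// ltW.
have sL2 : step a * Lf a <= 2^-1 by rewrite mulrDr in sL; lra.
have := @taylor a t; rewrite tt gt.
have s1 : step a <= 1.
  have : step a * 1 <= step a * Lf a by rewrite ler_wpM2l// ltW.
  lra.
have sG1 : step a * G a <= 1.
  have : 0 <= step a * Lf a by rewrite mulr_ge0; lra.
  by rewrite mulrDr in sL; lra.
rewrite expr2 -!mulrA.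
have -> : step a * (step a * G a) <= 1 by rewrite mulr_ile1// ltW.
move=> /(_ isT) h; apply: (le_trans h).
have : (step a * Lf a) * (step a * G a) <= 2^-1 * (step a * G a).
  by rewrite ler_wpM2r.
have -> : step a * Lf a * (step a * G a) = Lf a * (step a * (step a * G a)) by ring.
lra.
Qed.

Variables (c : R -> nat -> R) (alpha rho : R).
Hypotheses (cc : forall k, continuous (c ^~ k))
  (g0 : forall k, (k < n)%N -> g k (c 0) = 0)
  (D0 : D (c 0) <= rho)
  (D_le : forall a, D a <= rho -> E (c 0) <= E a)
  (D_eq : forall a, D a = rho -> alpha <= E a)
  (E1 : E (c 1) < E (c 0)).

Let orbit (j : nat) x := iter j descent (c x).

Let continuous_orbit j k : continuous (fun x => orbit j x k).
Proof.
elim: j k => [|j IH] k; first exact: cc.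
have [kn|nk] := ltnP k n; last first.
  rewrite (_ : (fun x => _) = (fun x => orbit j x k)); first exact: IH.
  by apply/funext => x; rewrite /orbit iterS /descent ltnNge nk.
rewrite (_ : (fun x => _) =
    (fun x => orbit j x k - step (orbit j x) * g k (orbit j x))); last first.
  by apply/funext => x; rewrite /orbit iterS /descent kn.
move=> x; apply: cvgB; first exact: IH.
by apply: cvgM; [apply: cstep|apply: cg kn _ _ _ _ _ _] => i _; exact: IH.
Qed.

Let continuous_along f j : fincont n f -> continuous (fun x => f (orbit j x)).
Proof. by move=> cf x; apply: cf => k _; exact: continuous_orbit. Qed.

Let E_orbitS j x : E (orbit j.+1 x) <= E (orbit j x).
Proof.
rewrite /orbit iterS; apply: le_trans (descent_le _) _.
by rewrite gerBl divr_ge0// mulr_ge0// ltW.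
Qed.

Let E_orbit_le i j x : (i <= j)%N -> E (orbit j x) <= E (orbit i x).
Proof.
elim: j => [|j IH]; first by rewrite leqn0 => /eqP ->.
rewrite leq_eqVlt => /predU1P[->//|ij].
exact: le_trans (E_orbitS j x) (IH ij).
Qed.

(** Every deformed path still joins the valley around [c 0], where the descent
    does not move, to a point lying below it, so it crosses the ridge
    [D = rho]. *)
Let orbit_crosses j : exists2 x, 0 <= x <= 1 & alpha <= E (orbit j x).
Proof.
have o0 : orbit j 0 = c 0.
  rewrite /orbit; elim: j => [//|j IH]; rewrite iterS IH.
  by apply/funext => k; rewrite /descent; case: ifP => // kn; rewrite g0// mulr0 subr0.
have o1 : rho <= D (orbit j 1).
  rewrite leNgt; apply/negP => /ltW /D_le h.
  have h2 : E (orbit j 1) <= E (c 1) by exact: (@E_orbit_le 0).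
  by have := lt_le_trans E1 h; rewrite ltNge h2.
have [] := @IVT R (fun x => D (orbit j x)) 0 1 rho ler01.
- by apply: continuous_subspaceT; exact: continuous_along.
- by rewrite o0 ge_min D0 le_max o1 orbT.
- by move=> x; rewrite in_itv/= => x01 /D_eq h; exists x.
Qed.

(** The energy decreases along trajectories, so a cluster point of crossing
    parameters [xs j] keeps its energy above [alpha] forever. *)
Let trapped : exists2 x, 0 <= x <= 1 & forall j, alpha <= E (orbit j x).
Proof.
have /choice[xs hxs] : forall j, exists x, 0 <= x <= 1 /\ alpha <= E (orbit j x).
  by move=> j; have [x] := orbit_crosses j; exists x.
have [x [x01 clx]] := @segment_compact R 0 1 (xs @ \oo) _
  (filterE _ (fun j => (hxs j).1)).
exists x => [|i]; first by move: x01; rewrite /= in_itv.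
rewrite leNgt; apply/negP => Ex.
have nE : nbhs x [set y | E (orbit i y) < alpha].
  exact: (@continuous_along E i cE x _ (lt_nbhsl Ex)).
have [y [[j ij <-]] /=] := clx [set xs j | j in [set j | (i <= j)%N]] _
    (ex_intro2 _ _ i I (fun j ij => ex_intro2 _ _ j ij erefl)) nE.
move=> /(le_lt_trans (E_orbit_le (xs j) ij)).
by rewrite ltNge (hxs j).2.
Qed.

(** Along a trajectory whose energy stays above [alpha] the total decrease is
    finite.  Were the gradient bounded below, the trajectory would have finite
    length, hence a limit, where the decrease per step could not vanish. *)
Lemma mountain_pass (eps : R) : 0 < eps ->
  exists a, [/\ exists2 x, 0 <= x <= 1 & E a <= E (c x),
    alpha <= E a & \sum_(0 <= k < n) g k a ^+ 2 <= eps].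
Proof.
move=> eps0; have [x x01 hx] := trapped.
apply: contrapT => hno.
have Gbig j : eps < G (orbit j x).
  rewrite ltNge; apply/negP => hj; apply: hno; exists (orbit j x); split => //.
  by exists x => //; exact: (@E_orbit_le 0).
pose d j := step (orbit j x) * G (orbit j x).
have d0 j : 0 <= d j by rewrite mulr_ge0// ltW.
have dE j : d j / 2 <= E (orbit j x) - E (orbit j.+1 x).
  by rewrite /d /orbit iterS; have := descent_le (iter j descent (c x)); lra.
have sd m : series d m <= 2 * (E (c x) - alpha).
  have : series d m / 2 <= E (c x) - E (orbit m x).
    elim: m => [|m IH]; first by rewrite /series/= big_geq// mul0r subrr.
    rewrite seriesSr mulrDl; have := dE m; lra.
  by have := hx m; lra.
have cd : cvgn (series d).
  apply: nondecreasing_is_cvgn.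
    by apply: nondecreasing_series => i _ _; exact: d0.
  by exists (2 * (E (c x) - alpha)) => _ [m _ <-].
have co k : (k < n)%N -> cvgn (fun j => orbit j x k).
  move=> kn; pose u j := orbit j.+1 x k - orbit j x k.
  have ub j : `|u j| <= (eps^-1 + 1) * d j.
    have -> : u j = - (step (orbit j x) * g k (orbit j x)).
      by rewrite /u /orbit iterS {1}/descent kn; ring.
    rewrite normrN normrM (gtr0_norm (step_gt0 _)) /d mulrCA ler_wpM2l ?(ltW (step_gt0 _))//.
    have h1 : `|g k (orbit j x)| ^+ 2 <= G (orbit j x).
      rewrite (real_normK (num_real _)) /G (bigD1_seq k) ?mem_index_iota ?iota_uniq//=.
      by rewrite lerDl sumr_ge0// => i _; exact: sqr_ge0.
    have h2 : 1 <= eps^-1 * G (orbit j x).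
      by rewrite -(mulVf (lt0r_neq0 eps0)) ler_wpM2l ?invr_ge0 ?ltW.
    have h3 : 0 <= (`|g k (orbit j x)| - 1) ^+ 2 by exact: sqr_ge0.
    have h4 := normr_ge0 (g k (orbit j x)).
    rewrite mulrDl mul1r.
    have : `|g k (orbit j x)| <= 1 + `|g k (orbit j x)| ^+ 2.
      move: h3; rewrite sqrrB1; lra.
    lra.
  have cu : cvgn (series u).
    apply: normed_cvg; apply: (@series_le_cvg _ _ (fun j => (eps^-1 + 1) * d j)).
    - by move=> j; exact: normr_ge0.
    - by move=> j; rewrite mulr_ge0// addr_ge0// invr_ge0 ltW.
    - exact: ub.
    rewrite (_ : series _ = (fun m => (eps^-1 + 1) * series d m)).
      by apply: is_cvgMr; exact: cd.
    by apply/funext => m; rewrite /series/= mulr_sumr.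
  rewrite (_ : (fun j => _) = (fun j => c x k + series u j)).
    by apply: is_cvgD => //; exact: is_cvg_cst.
  apply/funext => j; elim: j => [|j IH]; first by rewrite /series/= big_geq// addr0.
  by rewrite seriesSr addrA -IH /u addrC subrK.
pose a k := lim (orbit j x k @[j --> \oo]).
have oa k : (k < n)%N -> orbit j x k @[j --> \oo] --> a k by move=> /co.
have Ga : eps <= G a.
  have cGo : G (orbit j x) @[j --> \oo] --> G a by exact: cG.
  apply: (cvgr_to_ge cGo).
  by apply: nearW => j; exact: ltW.
have da : d j @[j --> \oo] --> step a * G a.
  by apply: cvgM; [exact: cstep|exact: cG].
have /(cvg_unique _ da) h0 : d j @[j --> \oo] --> (0 : R).
  exact: cvg_series_cvg_0.
have : 0 < step a * G a by rewrite mulr_gt0// (lt_le_trans eps0).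
by rewrite h0 ?ltxx.
Qed.

End Descent.

(** * Polynomially Lipschitz nonlinearities *)

Section PolynomiallyLipschitz.
Context {R : realType}.
Implicit Types (f g : R -> R) (x y t : R).

(** A local Lipschitz condition with polynomially growing constant: on
    functions bounded in every [L^q] it yields continuity of [u |-> f u] in
    mean. *)
Definition plip f : Prop := exists C (P : nat), 0 <= C /\
  forall x y, `|f x - f y| <= C * (1 + (`|x| + `|y|) ^+ P) * `|x - y|.

Lemma pow_le_1D (m : R) (P Q : nat) : (P <= Q)%N -> 0 <= m -> m ^+ P <= 1 + m ^+ Q.
Proof.
move=> PQ m0; have [m1|/ltW m1] := leP m 1.
  by rewrite (@le_trans _ _ 1) ?exprn_ile1// lerDl exprn_ge0.
by rewrite (@le_trans _ _ (m ^+ Q)) ?ler_weXn2l// lerDr.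
Qed.

Lemma plipD f g : plip f -> plip g -> plip (fun x => f x + g x).
Proof.
move=> [C [P [C0 hf]]] [C' [P' [C0' hg]]]; exists (2 * C + 2 * C'), (P + P')%N.
split=> [|x y]; first by lra.
have m0 : 0 <= `|x| + `|y| by rewrite addr_ge0.
rewrite opprD addrACA (le_trans (ler_normD _ _))//.
rewrite (le_trans (lerD (hf x y) (hg x y)))// -mulrDl ler_wpM2r//.
have h1 := @pow_le_1D _ _ _ (leq_addr P' P) m0.
have h2 := @pow_le_1D _ _ _ (leq_addl P P') m0.
have h3 : 0 <= (`|x| + `|y|) ^+ (P + P') by rewrite exprn_ge0.
set m := (_ ^+ (P + P')) in h1 h2 h3 *.
have := ler_wpM2l C0 h1; have := ler_wpM2l C0' h2.
have : 0 <= C * m by rewrite mulr_ge0.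
have : 0 <= C' * m by rewrite mulr_ge0.
lra.
Qed.

Lemma plip_id : plip (fun x => x).
Proof.
exists 1, 0%N; split=> [//|x y]; rewrite expr0 mul1r ler_peMl//; lra.
Qed.

Lemma plip_powR (p : R) : 1 < p -> plip (fun x => `|x| `^ p).
Proof.
move=> p1; have [P pP] : exists P : nat, p - 1 <= P%:R.
  by exists (Num.trunc (p - 1)).+1; rewrite ltW// truncnS_gt.
exists p, P; split=> [|x y]; first by lra.
have h : forall z w : R, 0 <= `|z| <= `|z| + `|w| by move=> z w; rewrite normr_ge0 lerDl normr_ge0.
have hy : 0 <= `|y| <= `|x| + `|y| by rewrite addrC h.
apply: le_trans (powR_lipschitz (h x y) hy p1) _.
have m0 : 0 <= `|x| + `|y| by rewrite addr_ge0.
apply: ler_pM => //.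
- by rewrite mulr_ge0 ?powR_ge0//; lra.
- by rewrite ler_wpM2l//; [lra|apply: powR_le1X => //; apply/andP; split; lra].
- exact: ler_dist_dist.
Qed.

Lemma plip_nonlin (p : R) : 1 < p -> plip (nonlin p).
Proof. by move=> p1; apply: plipD; [exact: plip_id|exact: plip_powR]. Qed.

Lemma plip_odd_powR (p : R) : 1 < p -> plip (fun x => `|x| `^ p * x).
Proof.
move=> p1; have [P pP] : exists P : nat, p <= P%:R.
  by exists (Num.trunc p).+1; rewrite ltW// truncnS_gt.
exists ((p + 1) ^+ 2 * 2 ^+ P), P; split=> [|x y].
  by rewrite mulr_ge0 ?sqr_ge0 ?exprn_ge0.
rewrite distrC (distrC x).
have := odd_powR_taylor x (y - x) p1; rewrite subrKC.
set t := y - x => ht; set m := `|x| + `|t| in ht *.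
have m0 : 0 <= m by rewrite addr_ge0.
have tm : `|t| <= m by rewrite lerDr.
have xm : `|x| `^ p <= m `^ p.
  by rewrite ge0_ler_powR ?nnegrE ?lerDl//; lra.
have p0 : 0 < p by lra.
have mp : m `^ (p - 1) * t ^+ 2 <= m `^ p * `|t|.
  rewrite -(mulr_powRB1 m0 p0) -(real_normK (num_real t)) expr2.
  by rewrite (mulrC m) -mulrA ler_wpM2l ?powR_ge0// ler_wpM2r.
have h1 : `| `|y| `^ p * y - `|x| `^ p * x| <= (p + 1) ^+ 2 * (m `^ p * `|t|).
  have h2 : `|(p + 1) * `|x| `^ p * t| <= (p + 1) * (m `^ p * `|t|).
    rewrite !normrM (ger0_norm (_ : 0 <= p + 1)); last by lra.
    rewrite (ger0_norm (powR_ge0 _ _)) -mulrA ler_wpM2l//; first by lra.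
    by rewrite ler_wpM2r.
  set a := (p + 1) * _ * t in ht h2.
  set b := _ - `|x| `^ p * x in ht *.
  have := ler_normD (b - a) a; rewrite subrK => h3.
  have : (p + 1) * p * m `^ (p - 1) * t ^+ 2 <= (p + 1) * p * (m `^ p * `|t|).
    by rewrite -mulrA ler_wpM2l// mulr_ge0; lra.
  move=> h4; set T := m `^ p * `|t| in h2 h4 *.
  have -> : (p + 1) ^+ 2 * T = (p + 1) * p * T + (p + 1) * T by ring.
  lra.
apply: le_trans h1 _.
set N := (`|x| + `|y|) ^+ P; rewrite [leRHS](_ : _ = (p + 1) ^+ 2 * ((2 ^+ P * (1 + N)) * `|t|)); last by ring.
rewrite ler_wpM2l ?sqr_ge0// ler_wpM2r// /N.
have mm : m <= 2 * (`|x| + `|y|).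
  by rewrite /m /t; have := ler_normB y x; have := normr_ge0 y; lra.
have h2 : m `^ p <= 1 + m ^+ P by apply: powR_le1X => //; apply/andP; split; lra.
have h3 : m ^+ P <= 2 ^+ P * (`|x| + `|y|) ^+ P.
  by rewrite -exprMn lerXn2r ?nnegrE ?mulr_ge0 ?addr_ge0.
have h4 : 1 <= 2 ^+ P :> R by rewrite exprn_ege1//; lra.
rewrite mulrDr mulr1; lra.
Qed.

Lemma plip_continuous f : plip f -> continuous f.
Proof.
move=> [C [P [C0 hf]]] x; apply/cvgrPdist_le => e e0.
pose h y := C * (1 + (`|x| + `|y|) ^+ P) * `|x - y|.
have ch : h y @[y --> x] --> h x.
  apply: cvgM; last by apply: cvg_norm; apply: cvgB; [exact: cvg_cst|exact: cvg_id].
  apply: cvgMr; apply: cvgD; first exact: cvg_cst.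
  apply: (@continuous_cvg _ _ _ _ _ (fun y => `|x| + `|y|) (fun z : R => z ^+ P)).
    exact: exprn_continuous.
  by apply: cvgD; [exact: cvg_cst|apply: cvg_norm; exact: cvg_id].
have h0 : h x < e by rewrite /h subrr normr0 mulr0.
near=> y; apply: le_trans (hf x y) _; apply/ltW; near: y.
exact: (cvgr_lt _ ch).
Unshelve. all: by end_near. Qed.

Lemma potential_taylor (p x t : R) (P : nat) : 2 <= p -> p - 1 <= P%:R ->
  `|potential p (x + t) - potential p x - nonlin p x * t|
   <= p * (2 + (`|x| + `|t|) ^+ P) * t ^+ 2.
Proof.
move=> p2 pP; have p1 : 1 < p by lra.
have := odd_powR_taylor x t p1.
set A := _ - (p + 1) * _ * t; set m := `|x| + `|t| => hA.
have m0 : 0 <= m by rewrite addr_ge0.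
have e : potential p (x + t) - potential p x - nonlin p x * t = t ^+ 2 / 2 + A / (p + 1).
  by rewrite /A /potential /nonlin; field; lra.
have i0 : 0 < p + 1 by lra.
have hA2 : `|A / (p + 1)| <= p * m `^ (p - 1) * t ^+ 2.
  rewrite normrM normfV (gtr0_norm i0) ler_pdivrMr//.
  by apply: le_trans hA _; rewrite le_eqVlt; apply/orP; left; apply/eqP; ring.
rewrite e (le_trans (ler_normD _ _))//.
have t20 : 0 <= t ^+ 2 by exact: sqr_ge0.
rewrite (ger0_norm (_ : 0 <= t ^+ 2 / 2)); last by rewrite divr_ge0.
have h2 : m `^ (p - 1) <= 1 + m ^+ P by apply: powR_le1X => //; apply/andP; split; lra.
have p0 : 0 <= p * t ^+ 2 by rewrite mulr_ge0//; lra.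
have h3 : p * t ^+ 2 * m `^ (p - 1) <= p * t ^+ 2 * (1 + m ^+ P) by rewrite ler_wpM2l.
have h4 : 2 * t ^+ 2 <= p * t ^+ 2 by rewrite ler_wpM2r.
set B := m `^ (p - 1) in hA2 h3 *; set Q := m ^+ P in h3 *.
have -> : p * (2 + Q) * t ^+ 2 = p * t ^+ 2 + p * t ^+ 2 * (1 + Q) by ring.
have e3 : p * B * t ^+ 2 = p * t ^+ 2 * B by ring.
rewrite e3 in hA2; lra.
Qed.

Lemma continuous_potential (p : R) : 2 <= p -> continuous (potential p).
Proof.
move=> p2 x; apply: cvgD.
  apply: cvgM; last exact: cvg_cst.
  exact: exprn_continuous.
apply: cvgM; last exact: cvg_cst.
by apply: (plip_continuous (plip_odd_powR _)); lra.
Qed.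

End PolynomiallyLipschitz.

(** * The energy on cosine polynomials *)

Section FiniteContinuity.
Context {R : realType}.
Implicit Types (a b t : nat -> R).

Lemma fincont_norm n (f : (nat -> R) -> R) :
  fincont n f -> fincont n (fun a => `|f a|).
Proof. by move=> cf T F FF c a ca; apply: cvg_norm; exact: cf. Qed.

Lemma fincont_le n (f : (nat -> R) -> R) (h : (nat -> R) -> (nat -> R) -> R) :
  (forall a, fincont n (h a)) -> (forall a, h a a = 0) ->
  (forall a b, `|f b - f a| <= h a b) -> fincont n f.
Proof.
move=> ch h0 hf T F FF c a ca; apply/cvgrPdist_le => e e0.
have hh : h a (c x) @[x --> F] --> 0 by rewrite -(h0 a); exact: ch.
have hn : \forall x \near F, h a (c x) < e by exact: (cvgr_lt _ hh).
near=> x; have hx : h a (c x) < e by near: x.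
by rewrite distrC (le_trans (hf _ _))// ltW.
Unshelve. all: by end_near. Qed.

Definition l1norm (n : nat) a : R := \sum_(0 <= k < n) `|a k|.

Lemma l1norm_ge0 n a : 0 <= l1norm n a.
Proof. exact: sumr_ge0. Qed.

Lemma fincont_l1norm n a : fincont n (fun b => l1norm n (fun k => b k - a k)).
Proof.
apply: fincont_sum => k /andP[_ kn]; apply: fincont_norm.
by apply: fincontB; [exact: (fincont_coord kn)|exact: fincont_cst].
Qed.

Lemma cospolyB m n a b x :
  cospoly m n a x - cospoly m n b x = cospoly m n (fun k => a k - b k) x.
Proof. by rewrite /cospoly -sumrB; apply: eq_bigr => k _; rewrite mulrBl. Qed.

Lemma cospolyD m n a b x :
  cospoly m n (fun k => a k + b k) x = cospoly m n a x + cospoly m n b x.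
Proof. by rewrite /cospoly -big_split; apply: eq_bigr => k _; rewrite mulrDl. Qed.

Lemma continuous_comp_cospoly (f : R -> R) n a :
  continuous f -> continuous (fun x => f (cospoly 0 n a x)).
Proof.
move=> cf x.
exact: (continuous_comp (@continuous_cospoly R 0 n a x) (cf _)).
Qed.

Lemma tintegrable_comp (f w : R -> R) n a : continuous f -> continuous w ->
  tintegrable (fun x => f (cospoly 0 n a x) * w x).
Proof.
move=> cf cw; apply: continuous_tintegrable => x.
by apply: cvgM; [exact: continuous_comp_cospoly|exact: cw].
Qed.

Lemma fincont_tint (f w : R -> R) n : plip f -> continuous w ->
  (forall x, `|w x| <= 1) ->
  fincont n (fun a => tint (fun x => f (cospoly 0 n a x) * w x)).
Proof.
move=> hf cw w1; have cf := plip_continuous hf; have [C [P [C0 {}hf]]] := hf.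
pose d a b := l1norm n (fun k => b k - a k).
apply: (@fincont_le n _ (fun a b =>
  C * (1 + (2 * l1norm n a + d a b) ^+ P) * d a b * (pi *+ 2))).
- move=> a; apply: fincontM; last exact: fincont_cst.
  apply: fincontM; last exact: fincont_l1norm.
  apply: fincontM; first exact: fincont_cst.
  apply: fincontD; first exact: fincont_cst.
  apply: fincontX; apply: fincontD; first exact: fincont_cst.
  exact: fincont_l1norm.
- move=> a; rewrite (_ : d a a = 0) ?mulr0 ?mul0r//.
  by rewrite /d /l1norm big1// => k _; rewrite subrr normr0.
move=> a b; rewrite -tintB; [|exact: tintegrable_comp|exact: tintegrable_comp].
rewrite -tint_cst; apply: ler_norm_tint => [||x].
- by apply: tintegrableB; exact: tintegrable_comp.
- exact: tintegrable_cst.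
rewrite -mulrBl normrM.
have dab : `|cospoly 0 n b x - cospoly 0 n a x| <= d a b.
  by rewrite cospolyB; exact: norm_cospoly_le.
have ha : `|cospoly 0 n a x| <= l1norm n a by exact: norm_cospoly_le.
have hb : `|cospoly 0 n b x| <= l1norm n a + d a b.
  rewrite -[in leLHS](subrK (cospoly 0 n a x) (cospoly 0 n b x)).
  by rewrite (le_trans (ler_normD _ _))// addrC lerD.
apply: (@le_trans _ _ (`|f (cospoly 0 n b x) - f (cospoly 0 n a x)| * 1)).
  by rewrite ler_wpM2l.
rewrite mulr1 (le_trans (hf _ _))//.
have s0 : 0 <= `|cospoly 0 n b x| + `|cospoly 0 n a x| by rewrite addr_ge0.
apply: ler_pM => //.
  by rewrite mulr_ge0// addr_ge0// exprn_ge0.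
rewrite ler_wpM2l// lerD2l lerXn2r ?nnegrE//.
  by rewrite addr_ge0 ?mulr_ge0 ?l1norm_ge0.
lra.
Qed.

End FiniteContinuity.

Section Energy.
Context {R : realType}.
Variables (p lam m0 : R) (ell : nat -> R).
Hypotheses (p2 : 2 <= p) (lam0 : 0 < lam) (m00 : 0 < m0).
Hypotheses (ell0 : ell 0 = 0) (ell_ge : forall k, m0 * k%:R <= ell k).
Implicit Types (a b t : nat -> R) (n : nat).

Let ell_ge0 k : 0 <= ell k.
Proof. by apply: le_trans (ell_ge k); rewrite mulr_ge0// ltW. Qed.

Definition quad n a : R := \sum_(0 <= k < n) cos_weight k * ell k * a k ^+ 2.

(** The functional of [L w = lam * (w + |w|^p)] restricted to cosine polynomials;
    [grad] collects its partial derivatives. *)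
Definition energy n a : R :=
  quad n a / 2 - lam * tint (fun x => potential p (cospoly 0 n a x)).

Definition grad n k a : R := cos_weight k * ell k * a k -
  lam * tint (fun x => nonlin p (cospoly 0 n a x) * cos (k%:R * x)).

Let p1 : 1 < p. Proof. by apply: lt_le_trans p2; rewrite ltr1n. Qed.

Let p0 : 0 <= p. Proof. by apply: le_trans p2. Qed.

Let cnl := plip_continuous (plip_nonlin p1).

Lemma quad_ge0 n a : 0 <= quad n a.
Proof.
apply: sumr_ge0 => k _; rewrite mulr_ge0 ?sqr_ge0// mulr_ge0//.
exact: ltW (cos_weight_gt0 k).
Qed.

Lemma tintegrable_potential n a :
  tintegrable (fun x => potential p (cospoly 0 n a x)).
Proof.
by apply/continuous_tintegrable/continuous_comp_cospoly/continuous_potential.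
Qed.

Lemma tintegrable_nonlin n a (k : nat) :
  tintegrable (fun x => nonlin p (cospoly 0 n a x) * cos (k%:R * x)).
Proof. by apply: tintegrable_comp => //; exact: continuous_cosM. Qed.

Lemma tint_nonlinM n a b :
  tint (fun x => nonlin p (cospoly 0 n a x) * cospoly 0 n b x) =
  \sum_(0 <= k < n) b k * tint (fun x => nonlin p (cospoly 0 n a x) * cos (k%:R * x)).
Proof.
transitivity (tint (fun x => \sum_(0 <= k < n)
    b k * (nonlin p (cospoly 0 n a x) * cos (k%:R * x)))).
  by apply: eq_tint => x; rewrite mulr_sumr; apply: eq_bigr => k _; rewrite mulrCA.
rewrite tint_sum => [|k]; last by apply: tintegrableZ; exact: tintegrable_nonlin.
by apply: eq_bigr => k _; rewrite tintZ//; exact: tintegrable_nonlin.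
Qed.

Lemma sum_grad n a b : \sum_(0 <= k < n) grad n k a * b k =
  \sum_(0 <= k < n) cos_weight k * ell k * (a k * b k) -
  lam * tint (fun x => nonlin p (cospoly 0 n a x) * cospoly 0 n b x).
Proof.
rewrite tint_nonlinM mulr_sumr -sumrB; apply: eq_bigr => k _.
by rewrite /grad; ring.
Qed.

Lemma fincont_grad n k : (k < n)%N -> fincont n (grad n k).
Proof.
move=> kn; apply: fincontB.
  by apply: fincontM; [exact: fincont_cst|exact: (fincont_coord kn)].
apply: fincontM; first exact: fincont_cst.
apply: fincont_tint; first exact: plip_nonlin.
  exact: continuous_cosM.
by move=> x; exact: cos_max.
Qed.

Let P : nat := (Num.trunc p).+1.

Let pP : p - 1 <= P%:R.
Proof. by have := truncnS_gt p; rewrite -/P; lra. Qed.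

(** A bound for half the second derivative of the energy on a unit ball. *)
Definition energy_curv n a : R :=
  1 + \sum_(0 <= k < n) cos_weight k * ell k +
  lam * (p * (2 + (l1norm n a + n%:R) ^+ P) * n%:R * (pi *+ 2)).

Lemma energy_curv_ge1 n a : 1 <= energy_curv n a.
Proof.
rewrite /energy_curv -addrA lerDl addr_ge0//.
  by apply: sumr_ge0 => k _; rewrite mulr_ge0// ltW// cos_weight_gt0.
rewrite mulr_ge0 ?(ltW lam0)// mulr_ge0 ?pi2_ge0// mulr_ge0// mulr_ge0//.
by rewrite addr_ge0// exprn_ge0// addr_ge0// l1norm_ge0.
Qed.

Lemma fincont_energy_curv n : fincont n (energy_curv n).
Proof.
apply: fincontD; first exact: fincont_cst.
apply: fincontM; first exact: fincont_cst.
apply: fincontM; last exact: fincont_cst.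
apply: fincontM; last exact: fincont_cst.
apply: fincontM; first exact: fincont_cst.
apply: fincontD; first exact: fincont_cst.
apply: fincontX; apply: fincontD; last exact: fincont_cst.
by apply: fincont_sum => k /andP[_ kn]; apply: fincont_norm; exact: (fincont_coord kn).
Qed.

Lemma energy_taylor n a t : \sum_(0 <= k < n) t k ^+ 2 <= 1 ->
  `|energy n (fun k => a k + t k) - energy n a -
    \sum_(0 <= k < n) grad n k a * t k| <=
  energy_curv n a * \sum_(0 <= k < n) t k ^+ 2.
Proof.
set S := \sum_(0 <= k < n) t k ^+ 2 => S1.
have S0 : 0 <= S by apply: sumr_ge0 => k _; exact: sqr_ge0.
have tk k : (k < n)%N -> t k ^+ 2 <= S.
  move=> kn; rewrite /S (bigD1_seq k) ?mem_index_iota ?iota_uniq//= lerDl.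
  by apply: sumr_ge0 => i _; exact: sqr_ge0.
set u := cospoly 0 n a; set v := cospoly 0 n t.
have cnlu : continuous (fun x => nonlin p (u x)) by exact: continuous_comp_cospoly.
have iuv : tintegrable (fun x => nonlin p (u x) * v x).
  by apply: tintegrable_comp => //; exact: continuous_cospoly.
have -> : energy n (fun k => a k + t k) - energy n a -
    \sum_(0 <= k < n) grad n k a * t k =
    quad n t / 2 - lam * tint (fun x =>
      potential p (u x + v x) - potential p (u x) - nonlin p (u x) * v x).
  have ip b : tintegrable (fun x => potential p (cospoly 0 n b x)).
    exact: tintegrable_potential.
  have iD : tintegrable (fun x => potential p (u x + v x)).
    by under eq_fun do rewrite -cospolyD.
  rewrite tintB//; last by apply: tintegrableB => //; exact: ip.
  rewrite tintB//; last exact: ip.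
  have -> : tint (fun x => potential p (u x + v x)) =
      tint (fun x => potential p (cospoly 0 n (fun k => a k + t k) x)).
    by apply: eq_tint => x; rewrite cospolyD.
  rewrite sum_grad /energy -/u -/v.
  have -> : quad n (fun k => a k + t k) = quad n a + quad n t +
      2 * \sum_(0 <= k < n) cos_weight k * ell k * (a k * t k).
    by rewrite /quad mulr_sumr -!big_split/=; apply: eq_bigr => k _; ring.
  by field.
have hq : quad n t / 2 <= \sum_(0 <= k < n) cos_weight k * ell k * S.
  have q0 := quad_ge0 n t.
  apply: (@le_trans _ _ (quad n t)); first by lra.
  rewrite /quad big_nat [leRHS]big_nat; apply: ler_sum => k /andP[_ kn].
  by rewrite ler_wpM2l ?tk// mulr_ge0// ltW// cos_weight_gt0.
have vS x : v x ^+ 2 <= n%:R * S.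
  apply: (@le_trans _ _ (l1norm n t ^+ 2)).
    rewrite -(real_normK (num_real (v x))) lerXn2r ?nnegrE ?l1norm_ge0//.
    exact: norm_cospoly_le.
  apply: le_trans (sqr_sum_le _ _) _; rewrite size_iota subn0 ler_wpM2l//.
  by apply: ler_sum => k _; rewrite (real_normK (num_real _)).
have vn x : `|v x| <= n%:R.
  apply: le_trans (norm_cospoly_le 0 n t x) _.
  have -> : n%:R = \sum_(0 <= k < n) (1 : R).
    by rewrite sumr_const_nat subn0.
  rewrite big_nat [leRHS]big_nat; apply: ler_sum => k /andP[_ kn].
  rewrite -(@ler_pXn2r _ 2)// ?nnegrE// expr1n (real_normK (num_real _)).
  exact: le_trans (tk k kn) S1.
have hI : `|tint (fun x => potential p (u x + v x) - potential p (u x) -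
      nonlin p (u x) * v x)| <=
    p * (2 + (l1norm n a + n%:R) ^+ P) * n%:R * (pi *+ 2) * S.
  rewrite (_ : _ * S = p * (2 + (l1norm n a + n%:R) ^+ P) * (n%:R * S) * (pi *+ 2)); last by ring.
  rewrite -tint_cst; apply: ler_norm_tint => [||x].
  - apply: tintegrableB => //; apply: tintegrableB; last exact: tintegrable_potential.
    by under eq_fun do rewrite -cospolyD; exact: tintegrable_potential.
  - exact: tintegrable_cst.
  apply: le_trans (potential_taylor (u x) (v x) p2 pP) _.
  apply: ler_pM => //.
  - by rewrite mulr_ge0// addr_ge0// exprn_ge0// addr_ge0.
  - exact: sqr_ge0.
  - rewrite ler_wpM2l// lerD2l lerXn2r ?nnegrE ?addr_ge0 ?l1norm_ge0//.
    by rewrite lerD//; exact: norm_cospoly_le.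
set I := tint _ in hI *.
apply: le_trans (ler_normB _ _) _.
rewrite (normrM lam) (gtr0_norm lam0) (ger0_norm (_ : 0 <= quad n t / 2)); last first.
  by rewrite divr_ge0// quad_ge0.
rewrite /energy_curv 2!mulrDl mul1r mulr_suml -mulrA.
have h1 := ler_wpM2l (ltW lam0) hI.
have := lerD hq h1; set A := \sum_(_ <= _ < _) _ * S; lra.
Qed.

Lemma fincont_energy n : fincont n (energy n).
Proof.
apply: fincontB.
  apply: fincontM; last exact: fincont_cst.
  apply: fincont_sum => k /andP[_ kn]; apply: fincontM; first exact: fincont_cst.
  by apply: fincontX; exact: (fincont_coord kn).
apply: fincontM; first exact: fincont_cst.
have e a : tint (fun x => potential p (cospoly 0 n a x)) =
  2^-1 * \sum_(0 <= k < n) cos_weight k * a k ^+ 2 +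
  (p + 1)^-1 * tint (fun x => `|cospoly 0 n a x| `^ p * cospoly 0 n a x * cst 1 x).
  rewrite -tint_sqr_cospoly.
  have i1 : tintegrable (fun x => cospoly 0 n a x ^+ 2).
    by apply/continuous_tintegrable/continuous_exprn/continuous_cospoly.
  have i2 : tintegrable (fun x =>
      `|cospoly 0 n a x| `^ p * cospoly 0 n a x * cst 1 x).
    apply: (@tintegrable_comp _ (fun y => `|y| `^ p * y)).
      exact: plip_continuous (plip_odd_powR p1).
    by move=> x; exact: cvg_cst.
  rewrite -!tintZ// -tintD; [|exact: tintegrableZ..].
  by apply: eq_tint => x; rewrite /potential/= mulr1; ring.
rewrite (_ : (fun a => _) = (fun a => 2^-1 * \sum_(0 <= k < n) cos_weight k * a k ^+ 2 +
  (p + 1)^-1 * tint (fun x => `|cospoly 0 n a x| `^ p * cospoly 0 n a x * cst 1 x))); last first.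
  exact/funext.
apply: fincontD; apply: fincontM; try exact: fincont_cst.
  apply: fincont_sum => k /andP[_ kn]; apply: fincontM; first exact: fincont_cst.
  by apply: fincontX; exact: (fincont_coord kn).
apply: (@fincont_tint _ (fun y => `|y| `^ p * y)).
- exact: plip_odd_powR.
- by move=> x; exact: cvg_cst.
- by move=> x /=; rewrite normr1.
Qed.

End Energy.

(** * Mountain-pass geometry of the energy *)

Section EnergyGeometry.
Context {R : realType}.
Variables (p lam m0 : R) (ell : nat -> R).
Hypotheses (p2 : 2 <= p) (lam0 : 0 < lam) (m00 : 0 < m0).
Hypotheses (ell0 : ell 0 = 0) (ell_ge : forall k, m0 * k%:R <= ell k).
Implicit Types (a b : nat -> R) (n : nat).

Let p1 : 1 < p. Proof. by apply: lt_le_trans p2; rewrite ltr1n. Qed.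

Let pos_pi : 0 < pi :> R. Proof. exact: pi_gt0. Qed.

(** The coefficients of [t + h cos x]. *)
Definition low_coef (t h : R) (k : nat) : R :=
  if k == 0%N then t else if k == 1%N then h else 0.

Lemma cospoly_low n t h x : (1 < n)%N ->
  cospoly 0 n (low_coef t h) x = t + h * cos x.
Proof.
move=> n1; rewrite /cospoly big_ltn ?(ltnW n1)// big_ltn//.
rewrite big_nat big1 => [|[//|[//|k]] _]; last by rewrite /low_coef/= mul0r.
by rewrite /low_coef/= mul0r cos0 mulr1 mul1r addr0.
Qed.

Lemma quad_low n t h : (1 < n)%N -> quad ell n (low_coef t h) = pi * ell 1 * h ^+ 2.
Proof.
move=> n1; rewrite /quad big_ltn ?(ltnW n1)// big_ltn//.
rewrite big_nat big1 => [|[//|[//|k]] _]; last by rewrite /low_coef/= expr0n mulr0.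
by rewrite ell0 mulr0 mul0r add0r addr0 /low_coef/cos_weight.
Qed.

Lemma energy_const n t : (1 < n)%N ->
  energy p lam ell n (low_coef t 0) = - (lam * (potential p t * (pi *+ 2))).
Proof.
move=> n1; rewrite /energy quad_low// expr0n/= mulr0 mul0r sub0r -tint_cst.
by congr (- (_ * _)); apply: eq_tint => x; rewrite cospoly_low// mul0r addr0.
Qed.

Let theta : R := Num.min (pi * m0 / 2) (lam * pi / 6).

Let theta0 : 0 < theta.
Proof. by rewrite lt_min !divr_gt0// mulr_gt0. Qed.

(** The barrier at [-1] gains [w^2/6] pointwise; together with the quadratic
    form, which does not see the mean value, this controls the full [H^(1/2)]
    norm. *)
Lemma half_norm_le_quad n b : theta * half_norm 0 n b <=
  quad ell n b / 2 + lam / 6 * tint (fun x => cospoly 0 n b x ^+ 2).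
Proof.
rewrite tint_sqr_cospoly /half_norm /quad !mulr_sumr mulr_suml -big_split/=.
apply: ler_sum => k _.
have b0 : 0 <= b k ^+ 2 by exact: sqr_ge0.
have w := @cos_weight_ge R k.
have t1 : theta <= pi * m0 / 2 by rewrite ge_min lexx.
have t2 : theta <= lam * pi / 6 by rewrite ge_min lexx orbT.
have h1 : theta * k%:R <= cos_weight k * ell k / 2.
  apply: (@le_trans _ _ (pi * m0 / 2 * k%:R)); first by rewrite ler_wpM2r.
  have : pi * (m0 * k%:R) <= cos_weight k * ell k.
    exact: (ler_pM (ltW pos_pi) (mulr_ge0 (ltW m00) (ler0n _ k)) w (ell_ge k)).
  lra.
have h2 : theta <= lam / 6 * cos_weight k.
  apply: le_trans t2 _; have : lam * pi <= lam * cos_weight k by rewrite ler_wpM2l// ltW.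
  lra.
rewrite -natr1 mulrA mulrDr mulr1 [X in _ <= X](_ : _ =
  (cos_weight k * ell k / 2 + lam / 6 * cos_weight k) * b k ^+ 2); last by ring.
by rewrite ler_wpM2r// lerD.
Qed.

(** Near [-1] the potential loses [w^2/6] up to a high power of [w], which the
    embedding makes negligible against the [H^(1/2)] norm on a small ball; the
    radius and the height of the ridge do not depend on the dimension. *)
Lemma energy_barrier : exists rho alpha : R, [/\ 0 < rho <= 1,
  - (lam * (potential p (- 1) * (pi *+ 2))) < alpha &
  forall M a, (1 < M)%N ->
    let n := dyad M in let D := half_norm 0 n (fun k => a k - low_coef (- 1) 0 k) in
    (D <= rho -> energy p lam ell n (low_coef (- 1) 0) <= energy p lam ell n a) /\
    (D = rho -> alpha <= energy p lam ell n a)].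
Proof.
pose r := (Num.trunc p).+2.
have [//|K K0 hK] := @tint_block_sum_le R r.
pose rho : R := Num.min 1 (theta / (2 * (lam * K + 1))).
have lK : 0 <= lam * K by rewrite mulr_ge0// ltW.
have lK1 : 0 < 2 * (lam * K + 1) by lra.
have rho0 : 0 < rho by rewrite lt_min ltr01/= divr_gt0.
have rho1 : rho <= 1 by rewrite ge_min lexx.
have rhoK : lam * K * rho <= theta / 2.
  apply: (@le_trans _ _ ((lam * K + 1) * rho)); first by rewrite ler_wpM2r ?ltW//; lra.
  have : rho * (2 * (lam * K + 1)) <= theta.
    by rewrite -ler_pdivlMr// ge_min lexx orbT.
  lra.
set e := - _.
exists rho, (e + theta / 2 * rho); split; first by rewrite rho0.
  by rewrite ltrDl mulr_gt0// divr_gt0.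
move=> M a M1 n; set b := fun k => _.
have n1 : (1 < n)%N.
  by apply: (@leq_trans (dyad 2)) => //; exact: leq_dyad.
pose D : R := half_norm 0 n b.
have D0 : 0 <= D by exact: half_norm_ge0.
have ub x : cospoly 0 n a x = cospoly 0 n b x - 1.
  by rewrite -[in RHS]cospolyB cospoly_low// mul0r addr0 opprK addrK.
have qab : quad ell n a = quad ell n b.
  apply: eq_bigr => -[|k] _; first by rewrite ell0 mulr0 !mul0r.
  by rewrite /b /low_coef/=; case: (k.+1 == 1)%N; rewrite subr0.
have gap : D <= rho -> e + theta / 2 * D <= energy p lam ell n a.
  move=> Drho.
  have ib : tintegrable (fun x => cospoly 0 n b x ^+ 2).
    by apply/continuous_tintegrable/continuous_exprn/continuous_cospoly.
  have ibr : tintegrable (fun x => `|cospoly 0 n b x| ^+ (2 * r)).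
    by apply/continuous_tintegrable/continuous_exprn/continuous_normf/continuous_cospoly.
  have hP : tint (fun x => potential p (cospoly 0 n a x)) <=
      potential p (- 1) * (pi *+ 2) - 6^-1 * tint (fun x => cospoly 0 n b x ^+ 2) +
      tint (fun x => `|cospoly 0 n b x| ^+ (2 * r)).
    rewrite -tint_cst -tintZ// -tintB; [|exact: tintegrable_cst|exact: tintegrableZ].
    rewrite -tintD//; last by apply: tintegrableB; [exact: tintegrable_cst|exact: tintegrableZ].
    apply: le_tint; first exact: tintegrable_potential.
      by apply: tintegrableD => //; apply: tintegrableB; [exact: tintegrable_cst|exact: tintegrableZ].
    move=> x; rewrite ub.
    have pr : p + 1 <= (2 * r)%:R.
      apply: (@le_trans _ _ r%:R); last by rewrite ler_nat leq_pmull.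
      by rewrite /r -natr1 lerD2r ltW// truncnS_gt.
    by have := @potential_barrier R p (cospoly 0 n b x) (2 * r) p2 pr; lra.
  have hKD : tint (fun x => `|cospoly 0 n b x| ^+ (2 * r)) <= K * D ^+ r.
    have := hK b 0%N M D (leq0n M) (lexx _); rewrite expr0 mulr1; apply: le_trans.
    apply: le_tint => // [|x].
      exact/continuous_tintegrable/continuous_exprn/continuous_block_sum.
    rewrite lerXn2r ?nnegrE// ?block_sum_ge0//.
    exact: (@norm_cospoly_block_sum _ 0 M).
  have hDr : D ^+ r <= rho * D.
    rewrite exprS mulrC ler_wpM2r//; apply: (le_trans _ Drho).
    by rewrite exprS ler_piMr// exprn_ile1// (le_trans Drho).
  have h1 := half_norm_le_quad n b.
  rewrite /energy qab -/D in h1 *.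
  have h2 := ler_wpM2l (ltW lam0) hP.
  have h3 := ler_wpM2l lK hDr.
  have h4 := ler_wpM2l (ltW lam0) hKD.
  have h5 := ler_wpM2r D0 rhoK.
  rewrite /e; lra.
split=> [Dr|Dr].
  rewrite energy_const//; apply: le_trans (gap Dr).
  by rewrite lerDl mulr_ge0// divr_ge0// ltW.
by have := gap _; rewrite /D Dr; apply.
Qed.

(** Below the resonance [ell 1 < lam] the path
    [t + delta (1 - t^2) cos x], [-1 <= t <= 1], leads from [-1] to [1] through
    negative energies: it avoids the critical point [0] along [cos x]. *)
Lemma energy_path : ell 1 < lam -> exists delta beta : R, beta < 0 /\
  forall n (t : R), (1 < n)%N -> -1 <= t <= 1 ->
    energy p lam ell n (low_coef t (delta * (1 - t ^+ 2))) <= beta.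
Proof.
move=> ell1.
pose C : R := p * 2 `^ (p - 2).
have p0 : 0 < p by apply: lt_trans p1.
have C0 : 0 < C by rewrite mulr_gt0// powR_gt0.
pose Q : R := 6 * C ^+ 2 + 2 * C.
have Q0 : 0 < Q by rewrite addr_gt0// mulr_gt0// exprn_gt0.
pose delta : R := Num.min 1 ((lam - ell 1) / (4 * lam * Q)).
have gap0 : 0 < lam - ell 1 by rewrite subr_gt0.
have lQ : 0 < 4 * lam * Q by rewrite mulr_gt0// mulr_gt0.
have d0 : 0 < delta by rewrite lt_min ltr01 divr_gt0.
have d1 : delta <= 1 by rewrite ge_min lexx.
have dQ : lam * (Q * delta) <= (lam - ell 1) / 4.
  have : delta * (4 * lam * Q) <= lam - ell 1.
    by rewrite -ler_pdivlMr// ge_min lexx orbT.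
  lra.
have bound n (t h : R) : (1 < n)%N -> -1 <= t <= 1 -> 0 <= h <= delta ->
    energy p lam ell n (low_coef t h) <=
    - (pi * (lam - ell 1) / 4 * h ^+ 2) - lam * pi / 6 * t ^+ 2.
  move=> n1 t1 /andP[h0 hd].
  have t1' : `|t| <= 1 by rewrite ler_norml.
  have h20 : 0 <= h ^+ 2 by exact: sqr_ge0.
  have th0 : 0 <= `|t| + h by rewrite addr_ge0.
  have pw x : potential p t + (nonlin p t * h) * cos x + 2^-1 * (h * cos x) ^+ 2
      - C * (`|t| + h) * h ^+ 2 <= potential p (t + h * cos x).
    have := odd_powR_taylor t (h * cos x) p1.
    set A := _ - (p + 1) * _ * (h * cos x); set m := `|t| + `|h * cos x| => hA.
    have m0' : 0 <= m by rewrite addr_ge0.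
    have -> : potential p (t + h * cos x) = potential p t + (nonlin p t * h) * cos x +
        2^-1 * (h * cos x) ^+ 2 + A / (p + 1).
      by rewrite /A /potential /nonlin; field; rewrite gt_eqF// addr_gt0.
    rewrite lerD2l.
    have hc : `|h * cos x| <= h by rewrite normrM (ger0_norm h0) ler_piMr// cos_max.
    have mh : m <= `|t| + h by rewrite lerD2l.
    have m2 : m <= 2 by apply: le_trans mh _; move: d1 hd t1'; lra.
    have hm : m `^ (p - 1) <= 2 `^ (p - 2) * (`|t| + h).
      have p20 : 0 <= p - 2 by rewrite subr_ge0.
      move: (m0'); rewrite le_eqVlt => /predU1P[<-|mpos].
        rewrite powR0 ?mulr_ge0 ?powR_ge0// gt_eqF// subr_gt0//.
      have -> : p - 1 = (p - 2) + 1 by ring.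
      rewrite powRD ?(gt_eqF mpos) ?implybT// powRr1//.
      apply: ler_pM => //; first exact: powR_ge0.
      by rewrite ge0_ler_powR ?nnegrE.
    have hA2 : `|A / (p + 1)| <= p * m `^ (p - 1) * (h * cos x) ^+ 2.
      have i0 : 0 < p + 1 by rewrite addr_gt0.
      rewrite normrM normfV (gtr0_norm i0) ler_pdivrMr//.
      by apply: le_trans hA _; rewrite le_eqVlt; apply/orP; left; apply/eqP; ring.
    rewrite -(opprK (A / _)) lerN2; apply: le_trans (ler_norm _) _.
    rewrite normrN; apply: le_trans hA2 _.
    apply: ler_pM; rewrite ?sqr_ge0 ?mulr_ge0 ?powR_ge0 ?(ltW p0)//.
      by rewrite /C -mulrA ler_wpM2l// ltW.
    by rewrite -(real_normK (num_real (h * cos x))) lerXn2r ?nnegrE.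
  have ci1 : tintegrable (fun x => 2^-1 * (h * cos x) ^+ 2).
    apply/tintegrableZ/continuous_tintegrable/continuous_exprn => x.
    by apply: cvgMr; exact: continuous_cos.
  have ci2 : tintegrable (fun x => nonlin p t * h * cos x).
    by apply/tintegrableZ/continuous_tintegrable; exact: continuous_cos.
  have icos : tint (@cos R) = 0.
    by rewrite -[RHS](tint_cos 1); apply: eq_tint => x; rewrite mul1r.
  have icos2 : tint (fun x : R => (h * cos x) ^+ 2) = pi * h ^+ 2.
    transitivity (tint (fun x => h ^+ 2 * (cos (1%:R * x) * cos (1%:R * x)))).
      by apply: eq_tint => x; rewrite mul1r; ring.
    rewrite tintZ ?tint_cosM/= /cos_weight/= 1?mulrC//.
    by apply: continuous_tintegrable => x; apply: cvgM; exact: continuous_cosM.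
  have hI : potential p t * (pi *+ 2) + 2^-1 * (pi * h ^+ 2)
      - C * (`|t| + h) * h ^+ 2 * (pi *+ 2) <=
      tint (fun x => potential p (cospoly 0 n (low_coef t h) x)).
    have ic r : tintegrable (fun=> r : R) := tintegrable_cst r.
    have i1 : tintegrable (fun x => potential p t + nonlin p t * h * cos x).
      exact: tintegrableD.
    have i2 : tintegrable (fun x => potential p t + nonlin p t * h * cos x +
        2^-1 * (h * cos x) ^+ 2) by exact: tintegrableD.
    have -> : potential p t * (pi *+ 2) + 2^-1 * (pi * h ^+ 2)
        - C * (`|t| + h) * h ^+ 2 * (pi *+ 2) =
        tint (fun x => potential p t + nonlin p t * h * cos x +
          2^-1 * (h * cos x) ^+ 2 - C * (`|t| + h) * h ^+ 2).
      rewrite tintB// tintD// tintD// !tint_cst !tintZ ?icos ?icos2.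
      - by rewrite mulr0 addr0.
      - apply/continuous_tintegrable/continuous_exprn => x.
        by apply: cvgMr; exact: continuous_cos.
      - by apply: continuous_tintegrable; exact: continuous_cos.
    apply: le_tint; [exact: tintegrableB|exact: tintegrable_potential|].
    by move=> x; rewrite cospoly_low.
  have hpt : t ^+ 2 / 6 <= potential p t.
    have hp : `|t| `^ p * `|t| <= t ^+ 2.
      rewrite -(real_normK (num_real t)) expr2 ler_wpM2r//.
      have [->|t0] := eqVneq t 0; first by rewrite normr0 powR0 ?gt_eqF.
      by rewrite ge1r_powR ?normr_gt0 ?t0// ltW.
    have hp2 : `| `|t| `^ p * t / (p + 1)| <= t ^+ 2 / 3.
      rewrite !normrM normfV (ger0_norm (powR_ge0 _ _)).
      have i0 : 0 < p + 1 by rewrite addr_gt0.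
      rewrite (gtr0_norm i0); apply: ler_pM; rewrite ?mulr_ge0 ?powR_ge0 ?invr_ge0 ?(ltW i0)//.
      by rewrite lef_pV2 ?posrE//; move: p2; lra.
    have := ler_norm (- (`|t| `^ p * t / (p + 1))); rewrite normrN /potential.
    lra.
  rewrite /energy quad_low//.
  have h1 := ler_wpM2l (ltW lam0) hI.
  have h2 : lam * pi * (t ^+ 2 / 6) <= lam * pi * potential p t.
    by rewrite ler_wpM2l// mulr_ge0// ltW.
  (* The mixed term |t| h^2 is split between t^2 and h^4. *)
  have sq : 0 <= (`|t| - 6 * C * h ^+ 2) ^+ 2 by exact: sqr_ge0.
  have sq2 : 2 * C * `|t| * h ^+ 2 <= t ^+ 2 / 6 + 6 * C ^+ 2 * h ^+ 2 * h ^+ 2.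
    rewrite sqrrB (real_normK (num_real t)) in sq.
    rewrite (_ : (6 * C * h ^+ 2) ^+ 2 = 36 * C ^+ 2 * h ^+ 2 * h ^+ 2) in sq; last by ring.
    lra.
  have hQ : 6 * C ^+ 2 * h ^+ 2 * h ^+ 2 + 2 * C * h * h ^+ 2 <= Q * delta * h ^+ 2.
    have C2 : 0 <= 6 * C ^+ 2 by rewrite mulr_ge0 ?sqr_ge0.
    have C1 : 0 <= 2 * C by rewrite mulr_ge0 ?(ltW C0).
    have hh : h ^+ 2 <= delta.
      apply: (le_trans _ hd); rewrite expr2 ler_piMl//.
      exact: le_trans hd d1.
    have e1 := ler_wpM2r h20 (ler_wpM2l C2 hh).
    have e2 := ler_wpM2r h20 (ler_wpM2l C1 hd).
    rewrite /Q; lra.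
  have lp : 0 <= lam * pi by rewrite mulr_ge0// ltW.
  have h3 := ler_wpM2l lp sq2.
  have h4 := ler_wpM2l lp hQ.
  have h5 : pi * h ^+ 2 * (lam * (Q * delta)) <= pi * h ^+ 2 * ((lam - ell 1) / 4).
    by rewrite ler_wpM2l// mulr_ge0// ltW.
  lra.
exists delta, (- Num.min (lam * pi / 12) (pi * (lam - ell 1) / 16 * delta ^+ 2)).
split.
  by rewrite oppr_lt0 lt_min !divr_gt0 ?mulr_gt0//= divr_gt0// exprn_gt0.
move=> n t n1 t1.
have t2 : t ^+ 2 <= 1 by rewrite -(real_normK (num_real t)) exprn_ile1// ler_norml.
have h1 : 0 <= 1 - t ^+ 2 by rewrite subr_ge0.
have t20 := sqr_ge0 t.
have hh : 0 <= delta * (1 - t ^+ 2) <= delta.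
  rewrite (mulr_ge0 (ltW d0) h1)/=.
  by rewrite (ler_piMr (ltW d0))// gerBl.
apply: le_trans (bound _ _ _ n1 t1 hh) _.
set h := delta * _ in hh *.
have lp : 0 < lam * pi by rewrite mulr_gt0.
have gp : 0 < pi * (lam - ell 1) by rewrite mulr_gt0.
have h20 : 0 <= h ^+ 2 by exact: sqr_ge0.
have [ht|/ltW ht] := leP 2^-1 (t ^+ 2).
  apply: (@le_trans _ _ (- (lam * pi / 12))); last by rewrite lerN2 ge_min lexx.
  have := ler_wpM2l (ltW lp) ht; have := mulr_ge0 (ltW gp) h20; lra.
apply: (@le_trans _ _ (- (pi * (lam - ell 1) / 16 * delta ^+ 2))); last first.
  by rewrite lerN2 ge_min lexx orbT.
have hd2 : delta ^+ 2 / 4 <= h ^+ 2.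
  have : delta / 2 <= h.
    rewrite /h ler_wpM2l ?(ltW d0)//; lra.
  have dd : 0 <= delta / 2 by rewrite divr_ge0// ltW.
  have -> : delta ^+ 2 / 4 = (delta / 2) ^+ 2 by field.
  by move=> ?; rewrite lerXn2r ?nnegrE//; case/andP: hh.
have := ler_wpM2l (ltW gp) hd2; have := mulr_ge0 (ltW lp) t20; lra.
Qed.

End EnergyGeometry.

(** * Almost critical points *)

Section ApproximateCriticalPoints.
Context {R : realType}.
Variables (p lam m0 : R) (ell : nat -> R).
Hypotheses (p2 : 2 <= p) (lam0 : 0 < lam) (m00 : 0 < m0).
Hypotheses (ell0 : ell 0 = 0) (ell_ge : forall k, m0 * k%:R <= ell k).
Implicit Types (a b : nat -> R) (n : nat).

Let p1 : 1 < p. Proof. by apply: lt_le_trans p2; rewrite ltr1n. Qed.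
Let p0 : 0 < p. Proof. by apply: lt_trans p1. Qed.

(** The cut-off [L] separates the range where [x^(p+1)] is controlled by [x^p]
    from the one where a high power takes over. *)
Lemma powR_interpolate (x L : R) (P : nat) : 0 <= x -> 1 <= L -> p + 1 <= P%:R ->
  x `^ p * x <= L * x `^ p + x ^+ (4 * P) / L ^+ (3 * P).
Proof.
move=> x0 L1 pP; have L0 : 0 < L by apply: lt_le_trans L1.
have LP : 0 < L ^+ (3 * P) by rewrite exprn_gt0.
have [xL|/ltW Lx] := leP x L.
  apply: (@le_trans _ _ (L * x `^ p)); first by rewrite mulrC ler_wpM2r ?powR_ge0.
  by rewrite lerDl divr_ge0 ?exprn_ge0// ltW.
have x1 : 1 <= x := le_trans L1 Lx.
apply: (@le_trans _ _ (x ^+ (4 * P) / L ^+ (3 * P))); last first.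
  by rewrite lerDr mulr_ge0 ?powR_ge0// ltW.
rewrite ler_pdivlMr// (_ : (4 * P = P + 3 * P)%N); last by rewrite -mulSn.
rewrite exprD; apply: ler_pM; rewrite ?mulr_ge0 ?powR_ge0 ?(ltW LP)//.
  rewrite mulrC (_ : x * x `^ p = x `^ (p + 1)).
    by rewrite -powR_mulrn// ler_powR.
  by rewrite -[in RHS](@mulr_powRB1 _ x) ?addrK// addr_gt0.
by rewrite lerXn2r ?nnegrE// ltW.
Qed.

(** Testing the almost-critical equation against the constant [1] bounds
    [u] in [L^p]; interpolating with the embedding then shows that the
    [|u|^(p+1)] part of a nonpositive energy grows slower than the quadratic
    part. *)
Lemma energy_coercive : exists Zb : R, forall M a, (1 < M)%N ->
  let n := dyad M in
  energy p lam ell n a <= 0 -> grad p lam ell n 0 a ^+ 2 <= 1 ->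
  half_norm 0 n a <= Zb.
Proof.
pose theta : R := Num.min (pi * m0 / 2) (lam * pi / 6).
have theta0 : 0 < theta by rewrite lt_min !divr_gt0// mulr_gt0// pi_gt0.
pose P := (Num.trunc p).+2.
have pP : p + 1 <= P%:R by rewrite /P -natr1 lerD2r ltW// truncnS_gt.
have [//|K K0 hK] := @tint_block_sum_le R (2 * P).
pose C1 : R := 2 / lam + 4 * pi.
have C10 : 0 <= C1 by rewrite addr_ge0 ?divr_ge0 ?mulr_ge0 ?pi_ge0// ltW.
pose C2 : R := lam * (pi *+ 2 + 2 * C1 + K).
exists (1 + (C2 / theta) ^+ 4) => M a M1 n En g0.
have C20 : 0 <= C2.
  by apply: mulr_ge0 (ltW lam0) _; have := @pi2_ge0 R; lra.
have C2t : 0 <= (C2 / theta) ^+ 4 by rewrite exprn_ge0// divr_ge0// ltW.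
set Z := half_norm 0 n a.
have [Z1|/ltW Z1] := leP Z 1; first by rewrite (le_trans Z1)// lerDl.
have Z0 : 0 <= Z by exact: half_norm_ge0.
(* With the cut-off L = Z^(3/4) every term bounding the potential is O(L),
   whereas the quadratic part is at least theta * Z = theta * Y * L. *)
pose Y := Num.sqrt (Num.sqrt Z).
have Y4 : Y ^+ 4 = Z.
  by rewrite (_ : 4 = 2 * 2)%N// exprM !sqr_sqrtr// sqrtr_ge0.
have Y1 : 1 <= Y.
  by rewrite -(@ler_pXn2r _ 4) ?nnegrE ?sqrtr_ge0// expr1n Y4.
have Y0 : 0 < Y by apply: lt_le_trans Y1.
pose L := Y ^+ 3; have L1 : 1 <= L by rewrite exprn_ege1.
have L0 : 0 < L by apply: lt_le_trans L1.
pose u := cospoly 0 n a.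
have cu : continuous u by exact: continuous_cospoly.
have iu (f : R -> R) : plip f -> tintegrable (fun x => f (u x)).
  by move=> /plip_continuous cf; apply/continuous_tintegrable/continuous_comp_cospoly.
have iX m : tintegrable (fun x => `|u x| ^+ m).
  by apply/continuous_tintegrable/continuous_exprn/continuous_normf.
have ipow : tintegrable (fun x => `|u x| `^ p).
  by apply: (@iu (fun y => `|y| `^ p)); exact: plip_powR.
have icst (r : R) : tintegrable (fun=> r) by exact: tintegrable_cst.
have hp : tint (fun x => `|u x| `^ p) <= C1.
  have gE : grad p lam ell n 0 a = - (lam * tint (fun x => nonlin p (u x))).
    rewrite /grad ell0 mulr0 mul0r sub0r; congr (- (_ * _)).
    by apply: eq_tint => x; rewrite mul0r cos0 mulr1.
  have gl : lam * tint (fun x => nonlin p (u x)) <= 1.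
    have : `|grad p lam ell n 0 a| <= 1.
      by rewrite -(@ler_pXn2r _ 2)// ?nnegrE// expr1n (real_normK (num_real _)).
    by rewrite gE normrN; apply: le_trans; exact: ler_norm.
  have hI : tint (fun x => 2^-1 * `|u x| `^ p - 1) <= tint (fun x => nonlin p (u x)).
    apply: le_tint; [by apply: tintegrableB => //; exact: tintegrableZ|exact/iu/plip_nonlin|move=> x].
    have h1 : `|u x| <= 1 + 2^-1 * `|u x| `^ p.
      have s0 : 0 <= (`|u x| - 1) ^+ 2 by exact: sqr_ge0.
      have : `|u x| ^+ 2 <= 1 + `|u x| `^ p.
        have [x1|/ltW x1] := leP `|u x| 1.
          by rewrite (@le_trans _ _ 1) ?exprn_ile1// lerDl powR_ge0.
        by rewrite (@le_trans _ _ (`|u x| `^ p)) ?lerDr// -powR_mulrn// ler_powR.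
      rewrite sqrrB1 in s0; lra.
    have := ler_norm (- u x); rewrite normrN /nonlin; lra.
  rewrite tintB ?tintZ ?tint_cst// ?mul1r in hI; last exact: tintegrableZ.
  have h2 := ler_wpM2l (ltW lam0) hI.
  have h3 : 2^-1 * tint (fun x => `|u x| `^ p) - pi *+ 2 <= lam^-1.
    by rewrite -(ler_pM2l lam0) mulfV ?gt_eqF//; exact: le_trans h2 gl.
  rewrite /C1; lra.
have hE : theta * Z <= lam * tint (fun x => potential p (u x) + 6^-1 * `|u x| ^+ 2).
  rewrite tintD ?tintZ//; [|exact: tintegrable_potential|exact: tintegrableZ].
  have := half_norm_le_quad lam0 m00 ell_ge n a; rewrite -/theta -/Z.
  have -> : tint (fun x => cospoly 0 n a x ^+ 2) = tint (fun x => `|u x| ^+ 2).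
    by apply: eq_tint => x; rewrite (real_normK (num_real _)).
  by move: En; rewrite /energy -/u; lra.
have hI : tint (fun x => potential p (u x) + 6^-1 * `|u x| ^+ 2) <=
    pi *+ 2 + 2 * L * tint (fun x => `|u x| `^ p) +
    (L ^+ (3 * P))^-1 * tint (fun x => `|u x| ^+ (2 * (2 * P))).
  rewrite -[pi *+ 2]mul1r -tint_cst -!tintZ// -tintD//; last exact: tintegrableZ.
  rewrite -tintD; [|by apply: tintegrableD => //; exact: tintegrableZ|exact: tintegrableZ].
  apply: le_tint.
  - by apply: tintegrableD; [exact: tintegrable_potential|exact: tintegrableZ].
  - apply: tintegrableD; last exact: tintegrableZ.
    by apply: tintegrableD => //; exact: tintegrableZ.
  move=> x; have x0 := normr_ge0 (u x).
  have h1 := powR_interpolate x0 L1 pP.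
  rewrite mulnA (_ : (2 * 2)%N = 4)// [X in _ + X]mulrC.
  have h2 : `|u x| ^+ 2 <= 1 + `|u x| `^ p.
    have [x1|/ltW x1] := leP `|u x| 1.
      by rewrite (@le_trans _ _ 1) ?exprn_ile1// lerDl powR_ge0.
    by rewrite (@le_trans _ _ (`|u x| `^ p)) ?lerDr// -powR_mulrn// ler_powR.
  have h3 : potential p (u x) <= `|u x| ^+ 2 / 2 + `|u x| `^ p * `|u x|.
    rewrite /potential (real_normK (num_real _)) lerD2l.
    have i1 : (p + 1)^-1 <= 1 by rewrite invf_le1 ?addr_gt0// lerDr ltW.
    have pu0 : 0 <= `|u x| `^ p * `|u x| by rewrite mulr_ge0 ?powR_ge0.
    apply: (@le_trans _ _ (`|u x| `^ p * `|u x| / (p + 1))).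
      rewrite ler_wpM2r ?invr_ge0 ?(ltW (addr_gt0 p0 ltr01))//.
      by rewrite ler_wpM2l ?powR_ge0// ler_norm.
    by rewrite ler_piMr.
  have h4 : `|u x| `^ p <= L * `|u x| `^ p by rewrite ler_peMl ?powR_ge0.
  have h5 : 0 <= `|u x| ^+ 2 by rewrite exprn_ge0.
  lra.
have hK2 : (L ^+ (3 * P))^-1 * tint (fun x => `|u x| ^+ (2 * (2 * P))) <= K.
  have h1 : tint (fun x => `|u x| ^+ (2 * (2 * P))) <= K * Z ^+ (2 * P).
    have := hK a 0%N M Z (leq0n M) (lexx _); rewrite expr0 mulr1; apply: le_trans.
    apply: le_tint => // [|x].
      exact/continuous_tintegrable/continuous_exprn/continuous_block_sum.
    rewrite lerXn2r ?nnegrE ?block_sum_ge0//.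
    exact: (@norm_cospoly_block_sum _ 0 M).
  rewrite mulrC ler_pdivrMr ?exprn_gt0//; apply: le_trans h1 _.
  rewrite ler_wpM2l// -Y4 /L -!exprM ler_weXn2l//.
  by rewrite !mulnA leq_mul2r.
have hY : theta * Y <= C2.
  rewrite -(ler_pM2r L0) -mulrA -[Y * L]exprS Y4.
  apply: le_trans hE _; rewrite /C2 -[leRHS]mulrA ler_wpM2l ?(ltW lam0)//.
  apply: le_trans hI _.
  have h1 : 2 * L * tint (fun x => `|u x| `^ p) <= 2 * L * C1.
    by rewrite ler_wpM2l// mulr_ge0// ltW.
  have h2 : pi *+ 2 <= pi *+ 2 * L by rewrite ler_peMr// pi2_ge0.
  have h3 : K <= K * L by rewrite ler_peMr.
  lra.
have hY2 : Y <= C2 / theta by rewrite ler_pdivlMr// mulrC.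
rewrite -Y4 (@le_trans _ _ ((C2 / theta) ^+ 4))//.
  by rewrite lerXn2r ?nnegrE ?(ltW Y0)// divr_ge0// ltW.
by rewrite lerDr.
Qed.

(** The ridge, the path and the coercivity bound are the same for all
    dimensions, hence so are the energy window and the [H^(1/2)] bound. *)
Lemma approximate_critical_points : ell 1 < lam -> exists alpha beta Zb : R,
  [/\ - (lam * (potential p (- 1) * (pi *+ 2))) < alpha, beta < 0 &
  forall M (eps : R), (1 < M)%N -> 0 < eps <= 1 ->
    let n := dyad M in exists a,
    [/\ alpha <= energy p lam ell n a <= beta,
        \sum_(0 <= k < n) grad p lam ell n k a ^+ 2 <= eps &
        half_norm 0 n a <= Zb]].
Proof.
move=> ell1.
have [rho [alpha [/andP[rho0 rho1] ealpha barrier]]] :=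
  energy_barrier p2 lam0 m00 ell0 ell_ge.
have [delta [beta [beta0 path]]] := energy_path p2 lam0 ell0 ell1.
have [Zb hZb] := energy_coercive.
exists alpha, beta, Zb; split => // M eps M1 /andP[eps0 eps1] n.
have n1 : (1 < n)%N by apply: (@leq_trans (dyad 2)) => //; exact: leq_dyad.
pose c (x : R) := low_coef (2 * x - 1) (delta * (1 - (2 * x - 1) ^+ 2)).
have c0 : c 0 = low_coef (- 1) 0.
  by rewrite /c mulr0 sub0r sqrrN expr1n subrr mulr0.
have c1 : c 1 = low_coef 1 0.
  by rewrite /c (_ : 2 * 1 - 1 = 1); [rewrite expr1n subrr mulr0|ring].
pose D (a : nat -> R) : R := half_norm 0 n (fun k => a k - low_coef (- 1) 0 k).
have cD : fincont n D.
  apply: fincont_sum => k /andP[_ kn]; apply: fincontM; first exact: fincont_cst.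
  by apply: fincontX; apply: fincontB; [exact: (fincont_coord kn)|exact: fincont_cst].
have taylor a t : \sum_(0 <= k < n) t k ^+ 2 <= 1 ->
    energy p lam ell n (fun k => a k + t k) <= energy p lam ell n a +
    \sum_(0 <= k < n) grad p lam ell n k a * t k +
    energy_curv p lam ell n a * \sum_(0 <= k < n) t k ^+ 2.
  move=> /(energy_taylor p2 lam0 m00 ell_ge a) h.
  have := le_trans (ler_norm _) h; lra.
have cc k : continuous (c ^~ k).
  move=> x; rewrite /c /low_coef; case: (k == 0%N).
    by apply: cvgB; [apply: cvgMr; exact: cvg_id|exact: cvg_cst].
  case: (k == 1%N); last exact: cvg_cst.
  apply: cvgMr; apply: cvgB; first exact: cvg_cst.
  apply: (@continuous_exprn _ (fun x => 2 * x - 1)) => {}x.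
  by apply: cvgB; [apply: cvgMr; exact: cvg_id|exact: cvg_cst].
have g0 k : (k < n)%N -> grad p lam ell n k (c 0) = 0.
  move=> kn; rewrite c0 /grad.
  have -> : tint (fun x => nonlin p (cospoly 0 n (low_coef (- 1) 0) x) *
      cos (k%:R * x)) = 0.
    rewrite -[RHS](mul0r (pi *+ 2)) -tint_cst; apply: eq_tint => x.
    by rewrite cospoly_low// mul0r addr0 /nonlin normrN1 powR1 addNr mul0r.
  rewrite mulr0 subr0; case: k {kn} => [|k]; first by rewrite ell0 mulr0 mul0r.
  by rewrite /low_coef/=; case: (k.+1 == 1)%N; rewrite mulr0.
have D0 : D (c 0) <= rho.
  by rewrite c0 /D /half_norm big1 ?ltW// => k _; rewrite subrr expr0n mulr0.
have E1 : energy p lam ell n (c 1) < energy p lam ell n (c 0).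
  rewrite c0 c1 !energy_const// ltrN2 ltr_pM2l// ltr_pM2r ?pi2_gt0//.
  rewrite /potential normrN1 normr1 powR1 sqrrN ltrD2l !mul1r mulN1r.
  by rewrite gtrN// invr_gt0 addr_gt0.
have D_le a : D a <= rho -> energy p lam ell n (c 0) <= energy p lam ell n a.
  by move=> Da; rewrite c0; exact: (barrier M a M1).1.
have D_eq a : D a = rho -> alpha <= energy p lam ell n a.
  by move=> Da; exact: (barrier M a M1).2.
have cE : fincont n (energy p lam ell n) by exact: fincont_energy.
have cL : fincont n (energy_curv p lam ell n) by exact: fincont_energy_curv.
have cG k : (k < n)%N -> fincont n (grad p lam ell n k) by exact: fincont_grad.
have L1 a : 1 <= energy_curv p lam ell n a by exact: (energy_curv_ge1 _ _ m00).
have [a [[x x01 Eax] Ea ga]] := @mountain_pass R n (energy p lam ell n)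
  (energy_curv p lam ell n) D (grad p lam ell n)
  cE cL cD cG L1 taylor c alpha rho cc g0 D0 D_le D_eq E1 eps eps0.
have Eb : energy p lam ell n a <= beta.
  apply: le_trans Eax _; apply: path => //.
  by move: x01 => /andP[? ?]; apply/andP; split; lra.
exists a; split; [by rewrite Ea Eb|exact: ga|apply: hZb => //].
  by rewrite (le_trans Eb)// ltW.
apply: le_trans (le_trans _ ga) eps1.
rewrite [leRHS](bigD1_seq 0%N) ?mem_index_iota ?iota_uniq ?(ltnW n1)//= lerDl.
by apply: sumr_ge0 => k _; exact: sqr_ge0.
Qed.

End ApproximateCriticalPoints.

(** * Cosine series with finite half-order norm *)

Section CosineSeries.
Context {R : realType}.
Notation mu := (@lebesgue_measure R).
Implicit Types (a : nat -> R) (x : R).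

(** The sum of the cosine series along the dyadic partial sums; the upper limit
    only makes the function measurable and everywhere defined. *)
Definition cosine_series a x : R :=
  fine (limn_esup (fun J => (cospoly 0 (dyad J) a x)%:E)).

Lemma cosine_series_cvg a x (l : R) :
  cospoly 0 (dyad J) a x @[J --> \oo] --> l -> cosine_series a x = l.
Proof.
move=> h; have hE : (cospoly 0 (dyad J) a x)%:E @[J --> \oo] --> l%:E.
  by apply: cvg_EFin => //; apply: nearW.
rewrite /cosine_series is_cvg_limn_esupE; last by apply/cvg_ex; exists l%:E.
by rewrite (cvg_lim _ hE).
Qed.

Lemma measurable_cosine_series a : measurable_fun setT (cosine_series a).
Proof.
apply: (measurableT_comp (fine_measurable measurableT)) => //.
apply: measurable_fun_limn_esup => J.
apply/measurable_EFinP; apply: continuous_measurable_fun.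
exact: continuous_cospoly.
Qed.

Lemma cospoly_periodic m n a : periodic (cospoly m n a) (pi *+ 2).
Proof.
move=> x; apply: eq_bigr => k _; congr (_ * _).
by rewrite mulrDr (mulr_natl (pi *+ 2)) (periodicn (@cosD2pi R)).
Qed.

Lemma cospoly_even m n a x : cospoly m n a (- x) = cospoly m n a x.
Proof. by apply: eq_bigr => k _; rewrite mulrN cosN. Qed.

Lemma cosine_series_periodic a : periodic (cosine_series a) (pi *+ 2).
Proof.
move=> x; rewrite /cosine_series; congr (fine (limn_esup _)).
by apply/funext => J; rewrite cospoly_periodic.
Qed.

Lemma cosine_series_even a x : cosine_series a (- x) = cosine_series a x.
Proof.
rewrite /cosine_series; congr (fine (limn_esup _)).
by apply/funext => J; rewrite cospoly_even.
Qed.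

Lemma cospoly_cvg a x (B : R) : (forall N, block_sum 0 N a x <= B) ->
  cospoly 0 (dyad J) a x @[J --> \oo] --> cosine_series a x.
Proof.
move=> hB.
have cb : cvgn (series (fun j => block j a x)).
  apply: normed_cvg; apply: nondecreasing_is_cvgn.
    by apply: nondecreasing_series => j _ _; exact: normr_ge0.
  by exists B => _ [N _ <-]; exact: hB.
have e : series (fun j => block j a x) = (fun J => cospoly 0 (dyad J) a x).
  by apply/funext => J; rewrite /series/= sum_block.
rewrite e in cb; rewrite (cosine_series_cvg cb); exact: cb.
Qed.

Lemma block_sum_le_homo a x : {homo (fun N => block_sum 0 N a x) : m n / (m <= n)%N >-> m <= n}.
Proof. by apply: nondecreasing_series => j _ _; exact: normr_ge0. Qed.

Section DominatedConvergence.
Variables (a : nat -> R) (Z : R).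
Hypothesis hZ : forall n, half_norm 0 n a <= Z.
Variable r : nat.
Hypothesis r0 : (0 < r)%N.

Let X (x : R) : \bar R := limn (fun N => (block_sum 0 N a x ^+ (2 * r))%:E).

Let homoX x : {homo (fun N => (block_sum 0 N a x ^+ (2 * r))%:E) :
  m n / (m <= n)%N >-> (m <= n)%E}.
Proof.
move=> m n mn; rewrite lee_fin lerXn2r ?nnegrE ?block_sum_ge0//.
exact: block_sum_le_homo.
Qed.

Let cvgX x : (block_sum 0 N a x ^+ (2 * r))%:E @[N --> \oo] --> X x.
Proof. exact/ereal_nondecreasing_is_cvgn/homoX. Qed.

Let leX x N : ((block_sum 0 N a x ^+ (2 * r))%:E <= X x)%E.
Proof.
rewrite /X (cvg_lim _ (ereal_nondecreasing_cvgn (@homoX x)))//.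
by apply: ereal_sup_ubound; exists N.
Qed.

Let X_ge0 x : (0 <= X x)%E.
Proof. by apply: le_trans (leX x 0); rewrite lee_fin exprn_ge0// block_sum_ge0. Qed.

Let mS N : measurable_fun (`[- pi, pi]%classic : set (measurableTypeR R))
  (fun x : measurableTypeR R => (block_sum 0 N a x ^+ (2 * r))%:E).
Proof.
apply/measurable_EFinP; apply: measurable_funTS; apply: continuous_measurable_fun.
by apply: continuous_exprn; exact: continuous_block_sum.
Qed.

Let iX : mu.-integrable `[- pi, pi] X.
Proof.
apply/integrableP; split.
  apply: (emeasurable_fun_cvg (fun N x => (block_sum 0 N a x ^+ (2 * r))%:E)) => [N|x _].
    exact: mS.
  exact: cvgX.
under eq_integral do rewrite (gee0_abs (X_ge0 _)).
have [K K0 hK] := tint_block_sum_le (R := R) r0.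
have := cvg_monotone_convergence measurable_torus mS
  (fun N x _ => ltac:(by rewrite lee_fin exprn_ge0// block_sum_ge0))
  (fun x _ => @homoX x).
move=> /(_ mu) h; apply: (@le_lt_trans _ _ (K * Z ^+ r)%:E); last exact: ltry.
rewrite -(cvg_lim _ h)//; apply: lime_le; first by apply/cvg_ex; eexists; exact: h.
apply: nearW => N.
have iN : tintegrable (fun x => block_sum 0 N a x ^+ (2 * r)).
  by apply/continuous_tintegrable/continuous_exprn/continuous_block_sum.
have := hK a 0%N N Z (leq0n N) (hZ _); rewrite expr0 mulr1 => hN.
rewrite -[leLHS]fineK; first by rewrite lee_fin.
exact: (integrable_fin_num measurable_torus iN).
Qed.

(** The blocks are summable in [L^(2r)], so the partial sums converge almost
    everywhere below a common [L^(2r)] majorant [B]. *)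
Lemma cosine_series_dct (C : R) (h : nat -> R -> R) (h' : R -> R) :
  0 <= C -> (forall J, measurable_fun setT (h J)) -> measurable_fun setT h' ->
  (forall x, cospoly 0 (dyad J) a x @[J --> \oo] --> cosine_series a x ->
     h J x @[J --> \oo] --> h' x) ->
  (forall x B, 0 <= B -> (forall N, block_sum 0 N a x <= B) ->
     forall J, `|h J x| <= C * (1 + B ^+ (2 * r))) ->
  tintegrable h' /\ tint (h J) @[J --> \oo] --> tint h'.
Proof.
move=> C0 mh mh' ch bh.
have fin x : X x \is a fin_num -> exists B, [/\ 0 <= B,
    forall N, block_sum 0 N a x <= B & ((B ^+ (2 * r))%:E <= X x)%E].
  move=> fX; have hN N : block_sum 0 N a x ^+ (2 * r) <= fine (X x).
    by rewrite -lee_fin fineK.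
  have cS : cvgn (fun N => block_sum 0 N a x).
    apply: nondecreasing_is_cvgn; first exact: block_sum_le_homo.
    exists (1 + fine (X x)) => _ [N _ <-].
    rewrite -[block_sum _ _ _ _]expr1 (le_trans (@pow_le_1D _ _ _ (2 * r) _ _))//.
    - by rewrite muln_gt0.
    - exact: block_sum_ge0.
    - by rewrite lerD2l.
  exists (limn (fun N => block_sum 0 N a x)); split.
  - by apply: (@limr_ge _ _ _ _ _ _ cS); apply: nearW => N; exact: block_sum_ge0.
  - by apply: nondecreasing_cvgn_le => //; exact: block_sum_le_homo.
  - rewrite -[leRHS]fineK// lee_fin.
    have cSr : block_sum 0 N a x ^+ (2 * r) @[N --> \oo] -->
        limn (fun N => block_sum 0 N a x) ^+ (2 * r).
      apply: (@continuous_cvg _ _ _ _ _ (fun N => block_sum 0 N a x) (fun y : R => y ^+ (2 * r))) => //.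
      exact: exprn_continuous.
    by apply: (cvgr_to_le cSr); exact: nearW.
have aefin := integrable_ae measurable_torus iX.
have [] := @dominated_convergence _ _ _ mu _ measurable_torus
  (fun J x => (h J x)%:E) (fun x => (h' x)%:E) (fun x => C%:E + C%:E * X x)%E.
- by move=> J; apply/measurable_EFinP; apply: measurable_funTS; exact: mh.
- by apply/measurable_EFinP; apply: measurable_funTS; exact: mh'.
- apply: filterS aefin => x fx Dx; have [B [_ hB _]] := fin x (fx Dx).
  apply: cvg_EFin; first exact: nearW.
  by apply: ch; exact: (cospoly_cvg hB).
- have iC := tintegrable_cst C.
  exact: (integrableD measurable_torus iC (integrableZl measurable_torus C iX)).
- apply: filterS aefin => x fx J Dx; have [B [B0 hB XB]] := fin x (fx Dx).
  rewrite -[X in (_ <= _ + _ * X)%E](fineK (fx Dx)) lee_fin.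
  apply: le_trans (bh x B B0 hB J) _; rewrite mulrDr mulr1 lerD2l ler_wpM2l//.
  by rewrite -lee_fin fineK// fx.
move=> ih' _ hc; split => //; apply: fine_cvg.
by rewrite /tint /Rintegral fineK//; exact: (integrable_fin_num measurable_torus ih').
Qed.

End DominatedConvergence.

End CosineSeries.

(** * Passage to the limit in the dimension *)

Section WeakLimit.
Context {R : realType}.
Implicit Types (a b : nat -> R) (x : R).

Lemma plip_le (f : R -> R) : plip f -> exists C (r : nat), [/\ 0 <= C, (0 < r)%N &
  forall y B, `|y| <= B -> `|f y| <= C * (1 + B ^+ (2 * r))].
Proof.
move=> [C [P [C0 hf]]]; exists (`|f 0| + 2 * C), P.+1; split => //.
  by rewrite addr_ge0 ?mulr_ge0.
move=> y B yB; have y0 := normr_ge0 y; have B0 := le_trans y0 yB.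
have h1 : `|f y| <= `|f 0| + C * (1 + B ^+ P) * B.
  rewrite -[f y](subrK (f 0)) addrC (le_trans (ler_normD _ _))// lerD2l.
  apply: le_trans (hf y 0) _; rewrite normr0 addr0 subr0.
  apply: ler_pM => //; first by rewrite mulr_ge0// addr_ge0// exprn_ge0.
  by rewrite ler_wpM2l// lerD2l lerXn2r ?nnegrE.
have hB : B <= 1 + B ^+ (2 * P.+1) by rewrite -[leLHS]expr1 pow_le_1D// muln_gt0.
have hBP : B ^+ P.+1 <= 1 + B ^+ (2 * P.+1) by rewrite pow_le_1D// leq_pmull.
have S0 : 0 <= B ^+ (2 * P.+1) by rewrite exprn_ge0.
set S := B ^+ (2 * P.+1) in hB hBP S0 *.
have h2 := ler_wpM2l C0 hB; have h3 := ler_wpM2l C0 hBP.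
have h4 : 0 <= `|f 0| * S by rewrite mulr_ge0.
have e : C * (1 + B ^+ P) * B = C * B + C * B ^+ P.+1 by rewrite exprSr; ring.
rewrite e in h1; lra.
Qed.

(** Truncating to the first [J] dyadic blocks changes a polynomially growing
    functional by an amount exponentially small in [J], uniformly on
    [H^(1/2)]-bounded sets: this is where compactness of the embedding enters. *)
Lemma plip_tail (f : R -> R) (Z : R) : plip f -> exists2 C : R, 0 <= C &
  forall (w : R -> R) b J N, continuous w -> (forall x, `|w x| <= 1) ->
    (J <= N)%N -> half_norm 0 (dyad N) b <= Z ->
    `|tint (fun x => f (cospoly 0 (dyad N) b x) * w x) -
      tint (fun x => f (cospoly 0 (dyad J) b x) * w x)| <= C * (5 / 6) ^+ J.
Proof.
move=> hf; have cf := plip_continuous hf; have [C [P [C0 {}hf]]] := hf.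
have [//|K K0 hK] := @tint_block_sum_le R P.+1.
have [//|K1 K10 hK1] := @tint_block_sum_le R 1.
pose Z' := `|Z|; have Z'0 : 0 <= Z' by exact: normr_ge0.
pose W : R := 2 * (8 * (pi *+ 2) + 2 * 4 ^+ P.+1 * (K * Z' ^+ P.+1)).
have W0 : 0 <= W.
  have : 0 <= 2 * 4 ^+ P.+1 * (K * Z' ^+ P.+1) by rewrite !mulr_ge0 ?exprn_ge0// normr_ge0.
  by have := @pi2_ge0 R; rewrite /W; lra.
exists (C * (W + K1 * Z')); first by rewrite mulr_ge0// addr_ge0// mulr_ge0.
move=> w b J N cw w1 JN hb.
have Z0 : 0 <= Z by apply: le_trans hb; exact: half_norm_ge0.
have ZZ : Z' = Z by rewrite /Z' ger0_norm.
pose X x := block_sum 0 N b x; pose RJ x := block_sum J N b x.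
have iX m : tintegrable (fun x => X x ^+ m).
  by apply/continuous_tintegrable/continuous_exprn/continuous_block_sum.
have iR m : tintegrable (fun x => RJ x ^+ m).
  by apply/continuous_tintegrable/continuous_exprn/continuous_block_sum.
have ic (r : R) : tintegrable (fun=> r) by exact: tintegrable_cst.
(* Weighted Young inequality: the weight q^-1 on the tail costs less than the
   decay (2/3)^J of the tail, as 2/3 = 5/6 * 4/5, and q <= (5/6)^J. *)
pose q : R := (4 / 5) ^+ J.
have q0 : 0 < q by rewrite exprn_gt0//; lra.
have bnd x : `|f (cospoly 0 (dyad N) b x) * w x - f (cospoly 0 (dyad J) b x) * w x| <=
    C * (q * (8 + 2 * 4 ^+ P.+1 * X x ^+ (2 * P.+1)) + q^-1 * RJ x ^+ 2).
  have X0 : 0 <= X x by exact: block_sum_ge0.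
  have R0 : 0 <= RJ x by exact: block_sum_ge0.
  rewrite -mulrBl normrM.
  apply: (@le_trans _ _ (`|f (cospoly 0 (dyad N) b x) - f (cospoly 0 (dyad J) b x)| * 1)).
    by rewrite ler_wpM2l.
  rewrite mulr1; apply: le_trans (hf _ _) _; rewrite -mulrA ler_wpM2l//.
  have hN : `|cospoly 0 (dyad N) b x| <= X x by exact: (@norm_cospoly_block_sum _ 0 N).
  have hJ : `|cospoly 0 (dyad J) b x| <= X x.
    apply: le_trans (norm_cospoly_block_sum b x (leq0n J)) _.
    by rewrite /X /block_sum (big_cat_nat (leq0n J) JN)/= lerDl sumr_ge0.
  have hD : `|cospoly 0 (dyad N) b x - cospoly 0 (dyad J) b x| <= RJ x.
    have dJN := leq_dyad JN.
    rewrite (cospoly_split _ _ (leq0n (dyad J)) dJN) addrAC subrr add0r.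
    exact: norm_cospoly_block_sum.
  set D := `|_ - _| in hD *.
  have h2X : (`|cospoly 0 (dyad N) b x| + `|cospoly 0 (dyad J) b x|) ^+ P <= (2 * X x) ^+ P.
    by rewrite lerXn2r ?nnegrE ?addr_ge0 ?mulr_ge0//; lra.
  have h3X : (2 * X x) ^+ P <= 1 + (2 * X x) ^+ P.+1 by rewrite pow_le_1D// mulr_ge0.
  set T := (2 * X x) ^+ P.+1 in h3X.
  have T0 : 0 <= T by rewrite exprn_ge0// mulr_ge0.
  apply: (@le_trans _ _ ((2 + T) * RJ x)).
    have g1 : 0 <= (`|cospoly 0 (dyad N) b x| + `|cospoly 0 (dyad J) b x|) ^+ P.
      by rewrite exprn_ge0// addr_ge0.
    have D0 : 0 <= D by exact: normr_ge0.
    by apply: ler_pM => //; move: h2X h3X g1; set V := (_ + _) ^+ P; lra.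
  have T2 : T ^+ 2 = 4 ^+ P.+1 * X x ^+ (2 * P.+1).
    have <- : (2 : R) ^+ 2 = 4 by ring.
    by rewrite /T -exprM mulnC exprMn exprM.
  rewrite (_ : 2 * 4 ^+ P.+1 * _ = 2 * T ^+ 2); last by rewrite T2; ring.
  have s1 : 0 <= q^-1 * (q * (2 + T) - RJ x) ^+ 2 by rewrite mulr_ge0 ?sqr_ge0 ?invr_ge0 ?ltW.
  have e1 : q^-1 * (q * (2 + T) - RJ x) ^+ 2 =
      q * (2 + T) ^+ 2 - 2 * ((2 + T) * RJ x) + q^-1 * RJ x ^+ 2.
    by field; rewrite gt_eqF.
  have s2 : 0 <= (T - 2) ^+ 2 by exact: sqr_ge0.
  have s3 : (2 + T) ^+ 2 <= 8 + 2 * T ^+ 2.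
    rewrite (_ : 8 + 2 * T ^+ 2 = (2 + T) ^+ 2 + (T - 2) ^+ 2); last by ring.
    by rewrite lerDl.
  have := ler_wpM2l (ltW q0) s3.
  have : 0 <= (2 + T) * RJ x by rewrite mulr_ge0// addr_ge0.
  have : 0 <= q^-1 * RJ x ^+ 2 by rewrite mulr_ge0 ?sqr_ge0 ?invr_ge0 ?ltW.
  rewrite e1 in s1; lra.
rewrite -tintB; [|exact: tintegrable_comp|exact: tintegrable_comp].
have i1 : tintegrable (fun x => 2 * 4 ^+ P.+1 * X x ^+ (2 * P.+1)) by exact: tintegrableZ.
have i2 : tintegrable (fun x => 8 + 2 * 4 ^+ P.+1 * X x ^+ (2 * P.+1)) by exact: tintegrableD.
have i3 : tintegrable (fun x => q * (8 + 2 * 4 ^+ P.+1 * X x ^+ (2 * P.+1))) by exact: tintegrableZ.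
have i4 : tintegrable (fun x => q^-1 * RJ x ^+ 2) by exact: tintegrableZ.
have i5 := tintegrableD i3 i4.
apply: le_trans (ler_norm_tint _ (tintegrableZ C i5) bnd) _.
  by apply: tintegrableB; exact: tintegrable_comp.
rewrite tintZ// tintD// !tintZ// tintD// tint_cst tintZ// -(mulrA C) ler_wpM2l//.
have h1 := hK b 0%N N Z (leq0n N) hb; rewrite expr0 mulr1 in h1.
have h2 := hK1 b J N Z JN hb; rewrite expr1 in h2.
have h3 : 2 * 4 ^+ P.+1 * tint (fun x => X x ^+ (2 * P.+1)) <=
    2 * 4 ^+ P.+1 * (K * Z' ^+ P.+1).
  by rewrite ZZ ler_wpM2l// mulr_ge0// exprn_ge0.
have h4 : q <= (5 / 6) ^+ J by rewrite lerXn2r ?nnegrE//; lra.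
have h5 : q^-1 * tint (fun x => RJ x ^+ 2) <= (5 / 6) ^+ J * (K1 * Z').
  rewrite mulrC ler_pdivrMr// (le_trans h2)// ZZ.
  rewrite (_ : (2 / 3 : R) ^+ J = (5 / 6) ^+ J * q); last first.
    by rewrite /q -exprMn; congr (_ ^+ _); field.
  by rewrite le_eqVlt; apply/orP; left; apply/eqP; ring.
have h6 : q * (8 * (pi *+ 2) + 2 * 4 ^+ P.+1 * tint (fun x => X x ^+ (2 * P.+1))) <=
    (5 / 6) ^+ J * W.
  apply: ler_pM => //; first exact: ltW.
    rewrite addr_ge0 ?mulr_ge0 ?pi2_ge0 ?exprn_ge0//.
    by apply: tint_ge0 => x; rewrite exprn_ge0// block_sum_ge0.
  by move: W0 h3; rewrite /W; lra.
by rewrite [leRHS](_ : _ = (5 / 6) ^+ J * W + (5 / 6) ^+ J * (K1 * Z')); [exact: lerD h6 h5|ring].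
Qed.

Lemma cosine_series_plip_dct (f w : R -> R) a (Z : R) : plip f -> continuous w ->
  (forall x, `|w x| <= 1) -> (forall n, half_norm 0 n a <= Z) ->
  tintegrable (fun x => f (cosine_series a x) * w x) /\
  tint (fun x => f (cospoly 0 (dyad J) a x) * w x) @[J --> \oo] -->
    tint (fun x => f (cosine_series a x) * w x).
Proof.
move=> hf cw w1 hZ; have cf := plip_continuous hf.
have [C [r [C0 r0 bf]]] := plip_le hf.
have mw : measurable_fun setT w by exact: continuous_measurable_fun.
apply: (@cosine_series_dct _ a Z hZ r r0 C (fun J x => f (cospoly 0 (dyad J) a x) * w x)) => //.
- move=> J; apply: continuous_measurable_fun => x.
  by apply: cvgM; [exact: continuous_comp_cospoly|exact: cw].
- apply: measurable_funM => //.
  apply: (measurableT_comp (continuous_measurable_fun cf)).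
  exact: measurable_cosine_series.
- move=> x cx; apply: cvgM; last exact: cvg_cst.
  exact: (@continuous_cvg _ _ _ _ _ _ f _ (cf _) cx).
- move=> x B B0 hB J; rewrite normrM.
  apply: (@le_trans _ _ (`|f (cospoly 0 (dyad J) a x)| * 1)); first by rewrite ler_wpM2l.
  rewrite mulr1; apply: bf; apply: le_trans (hB J).
  exact: (@norm_cospoly_block_sum _ 0 J).
Qed.

(** Coefficientwise convergence suffices: for a fixed number [J] of blocks the
    integrals are continuous in finitely many coefficients, and the error of
    truncation is uniform by [plip_tail]. *)
Lemma tint_plip_cvg (f w : R -> R) (A : nat -> nat -> R) a (Z : R)
    (U : set_system nat) (FU : ProperFilter U) : plip f -> continuous w ->
  (forall x, `|w x| <= 1) -> (forall M n, half_norm 0 n (A M) <= Z) ->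
  (forall n, half_norm 0 n a <= Z) ->
  (forall S, (\oo : set_system nat) S -> U S) ->
  (forall k, A M k @[M --> U] --> a k) ->
  tint (fun x => f (cospoly 0 (dyad M.+2) (A M) x) * w x) @[M --> U] -->
    tint (fun x => f (cosine_series a x) * w x).
Proof.
move=> hf cw w1 hA ha oU Aa; apply/cvgrPdist_le => e e0.
have e3 : 0 < e / 3 by rewrite divr_gt0.
have [C C0 hC] := plip_tail Z hf.
have [_ lim1] := cosine_series_plip_dct hf cw w1 ha.
have [J [J1 J2]] : exists J, `|tint (fun x => f (cosine_series a x) * w x) -
      tint (fun x => f (cospoly 0 (dyad J) a x) * w x)| <= e / 3 /\
    C * (5 / 6) ^+ J <= e / 3.
  have geo : C * (5 / 6) ^+ J @[J --> \oo] --> 0.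
    rewrite -(mulr0 C); apply: cvgMr; apply: cvg_expr.
    by rewrite ger0_norm; lra.
  have n1 : \forall J \near \oo, `|tint (fun x => f (cosine_series a x) * w x) -
      tint (fun x => f (cospoly 0 (dyad J) a x) * w x)| <= e / 3.
    by move/cvgrPdist_le: lim1; apply.
  have n2 : \forall J \near \oo, C * (5 / 6) ^+ J <= e / 3.
    have : \forall J \near \oo, C * (5 / 6) ^+ J < e / 3 by exact: (cvgr_lt _ geo).
    by apply: filterS => J /ltW.
  have [J] := @filter_ex _ _ _ _ (filterI n1 n2); by exists J.
have lim2 : tint (fun x => f (cospoly 0 (dyad J) (A M) x) * w x) @[M --> U] -->
    tint (fun x => f (cospoly 0 (dyad J) a x) * w x).
  by apply: (fincont_tint hf cw w1) => k _; exact: Aa.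
have n3 : \forall M \near U, `|tint (fun x => f (cospoly 0 (dyad J) a x) * w x) -
    tint (fun x => f (cospoly 0 (dyad J) (A M) x) * w x)| <= e / 3.
  by move/cvgrPdist_le: lim2; apply.
have n4 : \forall M \near U, (J <= M)%N by apply: oU; exists J.
apply: filterS (filterI n3 n4) => M [h3 JM].
have JM2 : (J <= M.+2)%N by rewrite !leqW.
have := hC w (A M) J M.+2 cw w1 JM2 (hA M _) => h4.
set x1 := tint _ in J1 *; set x2 := tint _ in J1 h3; set x3 := tint _ in h3 h4.
set x4 := tint _ in h4 *.
have -> : x1 - x4 = (x1 - x2) + (x2 - x3) - (x4 - x3) by ring.
apply: le_trans (ler_normB _ _) _.
have h5 := ler_normD (x1 - x2) (x2 - x3).
lra.
Qed.

End WeakLimit.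

(** * Existence of a nonconstant weak solution *)

Section WeakSolution.
Context {R : realType}.
Notation mu := (@lebesgue_measure R).
Implicit Types (a b : nat -> R) (x : R).

(** Along an ultrafilter all coefficients converge at once, without extraction
    of a diagonal subsequence. *)
Lemma bounded_ultra_cvg (U : set_system nat) (FU : UltraFilter U) (f : nat -> R) (B : R) :
  (forall M, `|f M| <= B) -> exists l : R, f M @[M --> U] --> l.
Proof.
move=> hf.
have UB : U (f @^-1` `[- B, B]%classic).
  by apply: filterE => M; have := hf M; rewrite ler_norml /= in_itv.
have [l [_ cl]] := @segment_compact R (- B) B (fmap f U) _ UB.
exists l => V lV; have [//|UV] := in_ultra_setVsetC (f @^-1` V) FU.
by have [y [nVy Vy]] := cl (~` V) V UV lV.
Qed.

Lemma eq_cospoly n a b : (forall k, (k < n)%N -> a k = b k) ->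
  cospoly 0 n a = cospoly 0 n b.
Proof.
move=> ab; apply/funext => x; apply: eq_big_nat => k /andP[_ kn].
by rewrite ab.
Qed.

Variables (p lam m0 : R) (ell : nat -> R).
Hypotheses (p2 : 2 <= p) (lam0 : 0 < lam) (m00 : 0 < m0).
Hypotheses (ell0 : ell 0 = 0) (ell_ge : forall k, m0 * k%:R <= ell k).

Let p1 : 1 < p. Proof. by apply: lt_le_trans p2; rewrite ltr1n. Qed.
Let p0 : 0 < p. Proof. by apply: lt_trans p1. Qed.

Let gamma : R := 2^-1 - (p + 1)^-1.

(** At an almost critical point the energy reduces to a multiple of the integral
    of [|u|^p u], in which the limit can be taken, unlike in the quadratic form. *)
Lemma energy_sum_grad n a : energy p lam ell n a =
  2^-1 * \sum_(0 <= k < n) grad p lam ell n k a * a k +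
  lam * gamma * tint (fun x => `|cospoly 0 n a x| `^ p * cospoly 0 n a x * 1).
Proof.
pose u := cospoly 0 n a.
have cu : continuous u by exact: continuous_cospoly.
have i1 : tintegrable (fun x => nonlin p (u x) * u x).
  by apply: tintegrable_comp => //; exact: plip_continuous (plip_nonlin p1).
have i2 : tintegrable (fun x => potential p (u x)) by exact: tintegrable_potential.
have i3 : tintegrable (fun x => `|u x| `^ p * u x * 1).
  apply: (@tintegrable_comp _ (fun y => `|y| `^ p * y)).
    exact: plip_continuous (plip_odd_powR p1).
  by move=> x; exact: cvg_cst.
have e : gamma * tint (fun x => `|u x| `^ p * u x * 1) =
    2^-1 * tint (fun x => nonlin p (u x) * u x) - tint (fun x => potential p (u x)).
  rewrite -!tintZ// -tintB//; last exact: tintegrableZ.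
  by apply: eq_tint => x; rewrite /gamma /nonlin /potential; ring.
rewrite sum_grad// -mulrA e /energy -/u.
have -> : quad ell n a = \sum_(0 <= k < n) cos_weight k * ell k * (a k * a k).
  by apply: eq_bigr => k _; rewrite expr2.
by ring.
Qed.

Lemma constant_solutions (t : R) : nonlin p t = 0 -> t = 0 \/ t = -1.
Proof.
have [->|t0] := eqVneq t 0; first by left.
have tp : 0 < `|t| by rewrite normr_gt0.
rewrite /nonlin -(mulr_powRB1 (ltW tp) p0) => h; right.
have [tpos|tneg] := ltP 0 t.
  have : 0 < t + `|t| * `|t| `^ (p - 1) by rewrite addr_gt0// mulr_gt0// powR_gt0.
  by rewrite h ltxx.
have e : `|t| = - t by rewrite ler0_norm.
have h1 : `|t| `^ (p - 1) = 1.
  apply: (mulfI (lt0r_neq0 tp)); rewrite mulr1.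
  by apply/eqP; rewrite -subr_eq0 [X in _ - X]e opprK addrC h.
have p10 : 0 < p - 1 by rewrite subr_gt0.
have : `|t| = 1.
  apply: (powR_injective p10); rewrite ?nnegrE//.
  by rewrite h1 powR1.
by rewrite e => h2; rewrite -[t]opprK h2.
Qed.

(** A limit of almost critical points solves the equation weakly.  Its energy
    lies strictly between those of the only two constant solutions [-1] and
    [0], so it cannot be constant. *)
Lemma weak_solution : ell 1 < lam -> exists a (Z : R),
  [/\ forall n, half_norm 0 n a <= Z,
   forall k, cos_weight k * ell k * a k =
     lam * tint (fun x => nonlin p (cosine_series a x) * cos (k%:R * x)) &
   nonconstant (cosine_series a)].
Proof.
move=> ell1.
have [alpha [beta [Z [ealpha beta0 crit]]]] :=
  approximate_critical_points p2 lam0 m00 ell0 ell_ge ell1.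
pose d M : R := M.+1%:R^-1.
have d0 M : 0 < d M by rewrite invr_gt0.
have d1 M : d M <= 1 by rewrite invf_le1// ler1n.
(* Dimension dyad (M + 2), as the almost critical points need at least two
   blocks. *)
have /choice[b hb] : forall M, exists b, let n := dyad M.+2 in
    [/\ alpha <= energy p lam ell n b <= beta,
        \sum_(0 <= k < n) grad p lam ell n k b ^+ 2 <= d M ^+ 2 &
        half_norm 0 n b <= Z].
  move=> M; apply: crit => //.
  by rewrite exprn_gt0//= exprn_ile1// ltW.
pose A M k := if (k < dyad M.+2)%N then b M k else 0.
have AbE M : cospoly 0 (dyad M.+2) (A M) = cospoly 0 (dyad M.+2) (b M).
  by apply: eq_cospoly => k kn; rewrite /A kn.
have hA M n : half_norm 0 n (A M) <= Z.
  have [_ _] := hb M; apply: le_trans.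
  apply: (@le_trans _ _ (half_norm 0 (n + dyad M.+2) (A M))).
    by apply: half_norm_le => //; exact: leq_addr.
  rewrite /half_norm (big_cat_nat (leq0n (dyad M.+2)) (leq_addl n _))/=.
  rewrite [X in _ + X](_ : _ = 0) ?addr0; last first.
    rewrite big_nat; apply: big1 => k /andP[kn _].
    by rewrite /A ltnNge kn/= expr0n mulr0.
  by rewrite le_eqVlt; apply/orP; left; apply/eqP/eq_big_nat => k /andP[_ kn]; rewrite /A kn.
have Z0 : 0 <= Z by apply: le_trans (hA 0%N 0%N); exact: half_norm_ge0.
have bA M k : `|A M k| <= 1 + Z.
  have h1 : A M k ^+ 2 <= Z.
    apply: le_trans (hA M k.+1); rewrite /half_norm big_nat_recr//=.
    have : A M k ^+ 2 <= k.+1%:R * A M k ^+ 2 by rewrite ler_peMl ?sqr_ge0// ler1n.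
    move=> h; apply: (le_trans h); rewrite lerDr.
    exact: half_norm_ge0.
  rewrite -[`|_|]expr1 (le_trans (@pow_le_1D _ _ 1 2 _ _))// lerD2l.
  by rewrite (real_normK (num_real _)).
have [U [UU oU]] := @ultraFilterLemma nat \oo _.
have /choice[a Aa] : forall k, exists l : R, A M k @[M --> U] --> l.
  by move=> k; apply: (bounded_ultra_cvg UU (B := 1 + Z)) => M.
have ha n : half_norm 0 n a <= Z.
  have cH : fincont n (fun b => \sum_(0 <= k < n) k.+1%:R * b k ^+ 2).
    apply: fincont_sum => k /andP[_ kn].
    apply: fincontM; first exact: fincont_cst.
    by apply: fincontX; exact: (fincont_coord kn).
  have lim : half_norm 0 n (A M) @[M --> U] --> half_norm 0 n a by apply: cH => k _; exact: Aa.
  by apply: (cvgr_to_le lim); exact: nearW.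
have lim_tint (f w : R -> R) : plip f -> continuous w -> (forall x, `|w x| <= 1) ->
    tint (fun x => f (cospoly 0 (dyad M.+2) (A M) x) * w x) @[M --> U] -->
    tint (fun x => f (cosine_series a x) * w x).
  by move=> hf cw w1; exact: (@tint_plip_cvg R f w A a Z U _ hf cw w1 hA ha oU Aa).
have d_cvg : d M @[M --> U] --> 0.
  have h : d M @[M --> \oo] --> 0 by exact: cvg_harmonic.
  by move=> V hV; apply: oU; exact: h.
have eqn k : cos_weight k * ell k * a k =
    lam * tint (fun x => nonlin p (cosine_series a x) * cos (k%:R * x)).
  have gA : grad p lam ell (dyad M.+2) k (A M) @[M --> U] -->
      cos_weight k * ell k * a k -
      lam * tint (fun x => nonlin p (cosine_series a x) * cos (k%:R * x)).
    apply: cvgB; first by apply: cvgMr; exact: Aa.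
    apply: cvgMr; apply: lim_tint; first exact: plip_nonlin.
      exact: continuous_cosM.
    by move=> x; exact: cos_max.
  have g0 : grad p lam ell (dyad M.+2) k (A M) @[M --> U] --> 0.
    apply/cvgrPdist_le => e e0; move/cvgrPdist_le: d_cvg => /(_ e e0) de.
    have n1 : \forall M \near U, (k < dyad M.+2)%N.
      apply: oU; exists k => // M /= kM; apply: (leq_ltn_trans kM).
      by apply: leq_trans (leq_id_dyad _); rewrite ltnS leqnSn.
    apply: filterS (filterI de n1) => M [dMe kM].
    rewrite sub0r normrN (le_trans _ dMe)// sub0r normrN (gtr0_norm (d0 M)).
    have [_ gM _] := hb M.
    have -> : grad p lam ell (dyad M.+2) k (A M) = grad p lam ell (dyad M.+2) k (b M).
      by rewrite /grad AbE /A kM.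
    rewrite -(@ler_pXn2r _ 2) ?nnegrE// ?(ltW (d0 M))// (real_normK (num_real _)).
    apply: le_trans gM.
    rewrite [leRHS](bigD1_seq k) ?mem_index_iota ?iota_uniq//= lerDl.
    by apply: sumr_ge0 => i _; exact: sqr_ge0.
  by apply/eqP; rewrite -subr_eq0; apply/eqP; exact: (cvg_unique _ gA g0).
pose Pu := tint (fun x => `|cosine_series a x| `^ p * cosine_series a x * 1).
have lim_energy : energy p lam ell (dyad M.+2) (b M) @[M --> U] --> lam * gamma * Pu.
  rewrite (_ : (fun M => _) = (fun M =>
    2^-1 * \sum_(0 <= k < dyad M.+2) grad p lam ell (dyad M.+2) k (b M) * b M k +
    lam * gamma * tint (fun x => `|cospoly 0 (dyad M.+2) (A M) x| `^ p *
      cospoly 0 (dyad M.+2) (A M) x * 1))); last first.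
    by apply/funext => M; rewrite energy_sum_grad AbE.
  rewrite -[X in _ --> X]add0r; apply: cvgD; last first.
    apply: cvgMr; apply: (lim_tint (fun y => `|y| `^ p * y) (fun=> 1)).
    - exact: plip_odd_powR.
    - by move=> x; exact: cvg_cst.
    - by move=> x; rewrite normr1.
  rewrite -[X in _ --> X](mulr0 2^-1); apply: cvgMr.
  apply/cvgrPdist_le => e e0.
  have dZ : d M * (1 + Z) @[M --> U] --> 0.
    by rewrite -[X in _ --> X](mul0r (1 + Z)); apply: cvgMl.
  move/cvgrPdist_le: dZ => /(_ e e0); apply: filterS => M dMe.
  rewrite (le_trans _ dMe)// !sub0r !normrN.
  apply: le_trans (ler_norm _).
  apply: le_trans (ler_norm_sum _ _ _) _.
  have [_ gM bM] := hb M.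
  apply: (@le_trans _ _ (\sum_(0 <= k < dyad M.+2)
    ((d M)^-1 * grad p lam ell (dyad M.+2) k (b M) ^+ 2 + d M * (k.+1%:R * b M k ^+ 2)))).
    apply: ler_sum => k _; rewrite normrM.
    set g := `|grad _ _ _ _ _ _|; set c := `|b M k|.
    have s1 : 0 <= (d M)^-1 * (g - d M * c) ^+ 2 by rewrite mulr_ge0 ?sqr_ge0 ?invr_ge0 ?ltW.
    have e1 : (d M)^-1 * (g - d M * c) ^+ 2 = (d M)^-1 * g ^+ 2 - 2 * (g * c) + d M * c ^+ 2.
      by field; rewrite gt_eqF.
    have gc : 0 <= g * c by rewrite mulr_ge0 ?normr_ge0.
    have -> : grad p lam ell (dyad M.+2) k (b M) ^+ 2 = g ^+ 2.
      by rewrite (real_normK (num_real _)).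
    have c2 : d M * c ^+ 2 <= d M * (k.+1%:R * b M k ^+ 2).
      rewrite ler_wpM2l ?(ltW (d0 M))// (real_normK (num_real _)).
      by rewrite ler_peMl ?sqr_ge0// ler1n.
    rewrite e1 in s1; have : 0 <= (d M)^-1 * g ^+ 2 by rewrite mulr_ge0 ?sqr_ge0 ?invr_ge0 ?ltW.
    have : 0 <= d M * c ^+ 2 by rewrite mulr_ge0 ?sqr_ge0 ?ltW.
    lra.
  rewrite big_split/= -!mulr_sumr mulrDr mulr1 lerD//.
    by rewrite mulrC ler_pdivrMr// -expr2 gM.
  by rewrite ler_wpM2l ?(ltW (d0 M))//; exact: bM.
have Pge : alpha <= lam * gamma * Pu.
  by apply: (cvgr_to_ge lim_energy); apply: nearW => M; have [/andP[]] := hb M.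
have Ple : lam * gamma * Pu <= beta.
  by apply: (cvgr_to_le lim_energy); apply: nearW => M; have [/andP[]] := hb M.
exists a, Z; split => // -[t ut].
have mu_ := @measurable_cosine_series R a.
have cst_tint (f w : R -> R) : continuous f -> continuous w ->
    tint (fun x => f (cosine_series a x) * w x) = tint (fun x => f t * w x).
  move=> cf cw; rewrite /tint /Rintegral; congr fine.
  apply: ae_eq_integral; first exact: measurable_torus.
  - apply/measurable_EFinP; apply: measurable_funTS; apply: measurable_funM.
      exact: (measurableT_comp (continuous_measurable_fun cf)).
    exact: continuous_measurable_fun.
  - apply/measurable_EFinP; apply: measurable_funTS; apply: measurable_funM.
      exact: measurable_cst.
    exact: continuous_measurable_fun.
  - by apply: negligibleS ut => x /= h1 h2; apply: h1 => _; rewrite h2.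
have pi20 := @pi2_gt0 R.
have nt : nonlin p t = 0.
  have := eqn 0%N; rewrite ell0 mulr0 mul0r cst_tint.
  - rewrite tintZ; last by apply: continuous_tintegrable; exact: continuous_cosM.
    rewrite tint_cos/= => /esym/eqP; rewrite !mulf_eq0 (gt_eqF lam0) (gt_eqF pi20) orbF/=.
    by move/eqP.
  - exact: plip_continuous (plip_nonlin p1).
  - exact: continuous_cosM.
have PuE : Pu = `|t| `^ p * t * (pi *+ 2).
  rewrite /Pu (cst_tint (fun y => `|y| `^ p * y) (fun=> 1)) ?tint_cst ?mulr1//.
  - exact: plip_continuous (plip_odd_powR p1).
  - by move=> x; exact: cvg_cst.
have [t0|t1] := constant_solutions nt.
  move: Ple; rewrite PuE t0 mulr0 mul0r mulr0 => h.
  by have := lt_le_trans beta0 h; rewrite ltxx.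
move: Pge; rewrite PuE t1 normrN1 powR1 mul1r => h.
have := lt_le_trans ealpha h; rewrite /potential normrN1 powR1 /gamma.
rewrite (_ : lam * (2^-1 - (p + 1)^-1) * (- 1 * (pi *+ 2)) =
  - (lam * (((-1) ^+ 2 / 2 + 1 * -1 / (p + 1)) * (pi *+ 2)))); last by ring.
by rewrite ltxx.
Qed.

End WeakSolution.

(** * Mean-square convergence of cosine expansions *)

Section Bernstein.
Context {R : realType}.
Implicit Types (g h : nat -> R) (x c : R).

(** The expectation of [g] under the binomial law of parameters [n] and [x],
    that is the Bernstein polynomial, computed by conditioning on one trial. *)
Fixpoint bernstein (n : nat) g x : R :=
  if n is m.+1 then (1 - x) * bernstein m g x + x * bernstein m (g \o S) x
  else g 0%N.

Lemma bernstein_cst n c x : bernstein n (fun=> c) x = c.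
Proof.
elim: n => //= n IH; have -> : (fun=> c) \o S = (fun=> c : R) by [].
by rewrite IH; ring.
Qed.

Lemma bernsteinB n g h x :
  bernstein n g x - bernstein n h x = bernstein n (fun k => g k - h k) x.
Proof.
elim: n g h => //= n IH g h.
have -> : bernstein n ((fun k => g k - h k) \o S) x =
  bernstein n (g \o S) x - bernstein n (h \o S) x by rewrite IH.
by rewrite -IH; ring.
Qed.

Lemma ler_norm_bernstein n g h x : 0 <= x <= 1 -> (forall k, `|g k| <= h k) ->
  `|bernstein n g x| <= bernstein n h x.
Proof.
move=> /andP[x0 x1]; elim: n g h => //= n IH g h gh.
have y0 : 0 <= 1 - x by rewrite subr_ge0.
rewrite (le_trans (ler_normD _ _))// !normrM (ger0_norm x0) (ger0_norm y0).
by rewrite lerD// ler_wpM2l// IH// => k; exact: gh.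
Qed.

Lemma bernstein_variance n x c :
  bernstein n (fun k => (k%:R - c) ^+ 2) x = n%:R * x * (1 - x) + (n%:R * x - c) ^+ 2.
Proof.
elim: n c => [|n IH] c /=; first by ring.
have -> : (fun k => (k%:R - c) ^+ 2) \o S = (fun k => (k%:R - (c - 1)) ^+ 2).
  by apply/funext => k /=; rewrite -natr1; congr (_ ^+ 2); ring.
by rewrite !IH -natr1; ring.
Qed.

Lemma bernstein_affine n x (A B : R) :
  bernstein n (fun k => A + B * (k%:R - n%:R * x) ^+ 2) x = A + B * (n%:R * x * (1 - x)).
Proof.
have lin m g : bernstein m (fun k => A + B * g k) x = A + B * bernstein m g x.
  elim: m g => //= m IH g.
  have -> : bernstein m ((fun k => A + B * g k) \o S) x =
    A + B * bernstein m (g \o S) x by rewrite -IH.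
  by rewrite IH; ring.
by rewrite lin bernstein_variance subrr expr0n addr0.
Qed.

End Bernstein.

Section CosineExpansion.
Context {R : realType}.

Lemma cvg_sqr {T : Type} {F : set_system T} {FF : Filter F} (u : T -> R) (l : R) :
  u t @[t --> F] --> l -> u t ^+ 2 @[t --> F] --> l ^+ 2.
Proof.
move=> ul; rewrite expr2; under eq_fun do rewrite expr2.
by apply: cvgM.
Qed.

Implicit Types (a b c : nat -> R) (f g h : R -> R) (x : R).

Definition is_cospoly g : Prop := exists n c, g = cospoly 0 n c.

Lemma cospoly_widen n m c : (n <= m)%N -> exists c', cospoly 0 n c = cospoly 0 m c'.
Proof.
move=> nm; exists (fun k => if (k < n)%N then c k else 0).
apply/funext => x; rewrite (cospoly_split _ _ (leq0n n) nm).
rewrite [X in _ = _ + X](_ : _ = 0) ?addr0.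
  by apply: eq_big_nat => k /andP[_ ->].
rewrite /cospoly big_nat; apply: big1 => k /andP[nk _].
by rewrite ltnNge nk mul0r.
Qed.

Lemma is_cospolyD g h : is_cospoly g -> is_cospoly h -> is_cospoly (fun x => g x + h x).
Proof.
move=> [n [c ->]] [m [d ->]].
have [c' ->] := cospoly_widen c (leq_maxl n m).
have [d' ->] := cospoly_widen d (leq_maxr n m).
exists (maxn n m), (fun k => c' k + d' k); apply/funext => x.
by rewrite cospolyD.
Qed.

Lemma is_cospolyZ (k : R) g : is_cospoly g -> is_cospoly (fun x => k * g x).
Proof.
move=> [n [c ->]]; exists n, (fun i => k * c i); apply/funext => x.
by rewrite mulr_sumr; apply: eq_bigr => i _; rewrite mulrA.
Qed.

Lemma is_cospoly_cos (k : nat) : is_cospoly (fun x : R => cos (k%:R * x)).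
Proof.
exists k.+1, (fun i => (i == k)%:R); apply/funext => x.
rewrite /cospoly big_nat_recr//= eqxx mul1r big_nat big1 ?add0r// => i /andP[_ ik].
by rewrite (ltn_eqF ik) mul0r.
Qed.

Lemma is_cospoly_cst (r : R) : is_cospoly (fun=> r).
Proof.
rewrite (_ : (fun=> r) = (fun x => r * cos (0%:R * x))).
  exact/is_cospolyZ/is_cospoly_cos.
by apply/funext => x; rewrite mul0r cos0 mulr1.
Qed.

Lemma is_cospoly_sum n (F : nat -> R -> R) : (forall k, is_cospoly (F k)) ->
  is_cospoly (fun x => \sum_(0 <= k < n) F k x).
Proof.
move=> hF; elim: n => [|n IH].
  rewrite (_ : (fun x => _) = (fun=> 0)); first exact: is_cospoly_cst.
  by apply/funext => x; rewrite big_geq.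
rewrite (_ : (fun x => _) = (fun x => \sum_(0 <= k < n) F k x + F n x)).
  exact: is_cospolyD.
by apply/funext => x; rewrite big_nat_recr.
Qed.

Lemma is_cospolyM g h : is_cospoly g -> is_cospoly h -> is_cospoly (fun x => g x * h x).
Proof.
move=> [n [c ->]] [m [d ->]].
rewrite (_ : (fun x => _) = (fun x => \sum_(0 <= k < n) c k *
   (\sum_(0 <= l < m) d l * (2^-1 * (cos ((k + l)%:R * x) + cos ((k - l + (l - k))%N%:R * x)))))).
  apply: is_cospoly_sum => k; apply: is_cospolyZ; apply: is_cospoly_sum => l.
  by do 2 apply: is_cospolyZ; apply: is_cospolyD; exact: is_cospoly_cos.
apply/funext => x; rewrite mulr_suml; apply: eq_bigr => k _.
rewrite -mulrA; congr (_ * _); rewrite mulr_sumr; apply: eq_bigr => l _.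
by rewrite mulrCA cosM_cos.
Qed.

Lemma is_cospoly_bernstein n (g : nat -> R) h : is_cospoly h ->
  is_cospoly (fun x => bernstein n g (h x)).
Proof.
move=> hh; elim: n g => [|n IH] g /=; first exact: is_cospoly_cst.
apply: is_cospolyD; apply: is_cospolyM => //.
rewrite (_ : (fun x => 1 - h x) = (fun x => 1 + -1 * h x)).
  by apply: is_cospolyD; [exact: is_cospoly_cst|exact: is_cospolyZ].
by apply/funext => x; rewrite mulN1r.
Qed.

(** Composing with a Bernstein polynomial of [f] stays inside the algebra of
    cosine polynomials. *)
Lemma cospoly_comp_approx f h (L Lip eps : R) : is_cospoly h -> 0 < L -> 0 <= Lip ->
  (forall x, `|h x| <= L) ->
  (forall y z, `|y| <= L -> `|z| <= L -> `|f y - f z| <= Lip * `|y - z|) -> 0 < eps ->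
  exists2 T, is_cospoly T & forall x, `|f (h x) - T x| <= eps.
Proof.
move=> hh L0 Lip0 hL fL eps0.
pose D := 4 * L * (Lip + 1).
have D0 : 0 < D by rewrite !mulr_gt0//; lra.
pose eta := eps / D.
have eta0 : 0 < eta by rewrite divr_gt0.
have [n hn] : exists n : nat, (eta ^+ 2)^-1 <= n.+1%:R.
  by exists (Num.trunc (eta ^+ 2)^-1); rewrite ltW// truncnS_gt.
set N := n.+1 in hn.
have N0 : 0 < N%:R :> R by rewrite ltr0n.
pose t x := (h x / L + 1) / 2.
(* The minimum keeps the nodes in [-L, L] for the values k > N, which
   the expectation ignores but the pointwise bounds below do not. *)
pose node k := L * (2 * Num.min 1 (k%:R / N%:R) - 1).
exists (fun x => bernstein N (fun k => f (node k)) (t x)).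
  apply: is_cospoly_bernstein.
  rewrite (_ : t = (fun x => (2 * L)^-1 * h x + 2^-1)).
    by apply: is_cospolyD; [exact: is_cospolyZ|exact: is_cospoly_cst].
  by apply/funext => x; rewrite /t; field; rewrite gt_eqF.
move=> x.
have tx : 0 <= t x <= 1.
  have := hL x; rewrite ler_norml => /andP[h1 h2].
  have h3 : -1 <= h x / L by rewrite ler_pdivlMr// mulN1r.
  have h4 : h x / L <= 1 by rewrite ler_pdivrMr// mul1r.
  by rewrite /t; apply/andP; split; lra.
have hx : h x = L * (2 * t x - 1) by rewrite /t; field; rewrite gt_eqF.
rewrite -[f (h x)](bernstein_cst N _ (t x)) bernsteinB.
pose B := 2 * L * Lip * (eta^-1 * (N%:R ^+ 2)^-1).
pose A := 2 * L * Lip * eta.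
have AB : A + B * (N%:R * t x * (1 - t x)) <= eps.
  have q1 : N%:R * t x * (1 - t x) <= N%:R.
    rewrite -mulrA ler_piMr ?(ltW N0)//; case/andP: tx => t0 t1.
    by rewrite mulr_ile1//; lra.
  have B0 : 0 <= B by rewrite !mulr_ge0 ?invr_ge0 ?exprn_ge0 ?(ltW eta0) ?(ltW L0).
  have q2 : B * N%:R <= A.
    rewrite /B /A -!mulrA; do 2 rewrite ler_wpM2l//; first by rewrite ltW.
    rewrite ler_wpM2l// (_ : _ * (_ * _) = (eta * N%:R)^-1); last first.
      by field; rewrite !gt_eqF.
    rewrite -[leRHS]invrK lef_pV2 ?posrE ?mulr_gt0 ?invr_gt0//.
    rewrite -(ler_pM2l (_ : 0 < eta^-1)) ?invr_gt0// mulKf ?gt_eqF//.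
    by rewrite -invfM -expr2.
  have q3 : A <= eps / 2.
    rewrite /A (_ : eps = eta * D); last by rewrite /eta divfK// gt_eqF.
    have : 0 <= L * eta by rewrite mulr_ge0 ?ltW.
    rewrite /D; lra.
  have := ler_wpM2l B0 q1; lra.
apply: le_trans AB; rewrite -bernstein_affine; apply: ler_norm_bernstein => // k.
have nodeL : `|node k| <= L.
  rewrite /node normrM (gtr0_norm L0) ler_piMr ?(ltW L0)// ler_norml.
  have m0 : 0 <= Num.min 1 (k%:R / N%:R) :> R by rewrite le_min ler01 divr_ge0// ltW.
  have m1 : Num.min 1 (k%:R / N%:R) <= 1 :> R by rewrite ge_min lexx.
  by apply/andP; split; lra.
apply: le_trans (fL _ _ (hL x) nodeL) _.
have d1 : `|h x - node k| <= 2 * L * `|t x - k%:R / N%:R|.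
  rewrite hx /node (_ : _ - _ = 2 * L * (t x - Num.min 1 (k%:R / N%:R))); last by ring.
  rewrite normrM (ger0_norm (_ : 0 <= 2 * L)) ?mulr_ge0 ?(ltW L0)//.
  rewrite ler_wpM2l ?mulr_ge0 ?(ltW L0)//.
  have [k1|k1] := leP 1 (k%:R / N%:R); last by [].
  case/andP: tx => t0 t1; rewrite !ler0_norm; lra.
have d2 : `|t x - k%:R / N%:R| <= eta + eta^-1 * (t x - k%:R / N%:R) ^+ 2.
  set s := t x - _; have s0 := normr_ge0 s.
  rewrite -(real_normK (num_real s)); set w := `|s| in s0 *.
  have : 0 <= eta^-1 * (eta - w) ^+ 2 by rewrite mulr_ge0 ?sqr_ge0 ?invr_ge0 ?ltW.
  rewrite (_ : eta^-1 * (eta - w) ^+ 2 = eta - 2 * w + eta^-1 * w ^+ 2); last first.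
    by field; rewrite gt_eqF.
  lra.
have e1 : (t x - k%:R / N%:R) ^+ 2 = (N%:R ^+ 2)^-1 * (k%:R - N%:R * t x) ^+ 2.
  by field; rewrite gt_eqF.
rewrite e1 in d2.
have L20 : 0 <= 2 * L by rewrite mulr_ge0 ?ltW.
have := ler_wpM2l Lip0 (le_trans d1 (ler_wpM2l L20 d2)).
by rewrite /A /B; lra.
Qed.

(** The cosine coefficients of [v], normalized as in [cospoly]. *)
Definition cos_coef (v : R -> R) (k : nat) : R :=
  (cos_weight k)^-1 * tint (fun x => v x * cos (k%:R * x)).

Section BestApproximation.
Variable v : R -> R.
Hypotheses (mv : measurable_fun setT v) (iv2 : tintegrable (fun x => v x ^+ 2)).

Lemma tintegrable_mul_bounded (w : R -> R) (B : R) : continuous w ->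
  (forall x, `|w x| <= B) -> tintegrable (fun x => v x * w x).
Proof.
move=> cw wB; have B0 : 0 <= B := le_trans (normr_ge0 _) (wB 0).
apply: (@tintegrable_le _ _ (fun x => B * (1 + v x ^+ 2))).
- by apply: measurable_funM => //; exact: continuous_measurable_fun.
- by apply/tintegrableZ/tintegrableD => //; exact: tintegrable_cst.
move=> x; rewrite normrM mulrC; apply: ler_pM => //.
rewrite -(real_normK (num_real (v x))) -[leLHS]expr1.
by rewrite pow_le_1D.
Qed.

Let ivw n c : tintegrable (fun x => v x * cospoly 0 n c x).
Proof.
apply: (tintegrable_mul_bounded (B := l1norm n c)); first exact: continuous_cospoly.
by move=> x; exact: norm_cospoly_le.
Qed.

Lemma tint_mul_cospoly n c : tint (fun x => v x * cospoly 0 n c x) =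
  \sum_(0 <= k < n) cos_weight k * (c k * cos_coef v k).
Proof.
have ic k : tintegrable (fun x => v x * cos (k%:R * x)).
  apply: (tintegrable_mul_bounded (B := 1)); first exact: continuous_cosM.
  by move=> x; exact: cos_max.
transitivity (tint (fun x => \sum_(0 <= k < n) c k * (v x * cos (k%:R * x)))).
  by apply: eq_tint => x; rewrite mulr_sumr; apply: eq_bigr => k _; rewrite mulrCA.
rewrite tint_sum => [|k]; last exact: tintegrableZ.
apply: eq_bigr => k _; rewrite tintZ// /cos_coef mulrCA mulVKf//.
by rewrite gt_eqF// cos_weight_gt0.
Qed.

Lemma tintegrable_sqrB n c : tintegrable (fun x => (v x - cospoly 0 n c x) ^+ 2).
Proof.
rewrite (_ : (fun x => _) = (fun x => v x ^+ 2 - 2 * (v x * cospoly 0 n c x) +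
  cospoly 0 n c x ^+ 2)); last by apply/funext => x; ring.
apply: tintegrableD; first by apply: tintegrableB => //; exact: tintegrableZ.
by apply/continuous_tintegrable/continuous_exprn/continuous_cospoly.
Qed.

Lemma tint_sqrB_cospoly n c : tint (fun x => (v x - cospoly 0 n c x) ^+ 2) =
  tint (fun x => v x ^+ 2) - \sum_(0 <= k < n) cos_weight k * cos_coef v k ^+ 2 +
  \sum_(0 <= k < n) cos_weight k * (c k - cos_coef v k) ^+ 2.
Proof.
have i1 : tintegrable (fun x => cospoly 0 n c x ^+ 2).
  by apply/continuous_tintegrable/continuous_exprn/continuous_cospoly.
have i2 : tintegrable (fun x => 2 * (v x * cospoly 0 n c x)) by exact: tintegrableZ.
transitivity (tint (fun x => v x ^+ 2 - 2 * (v x * cospoly 0 n c x) + cospoly 0 n c x ^+ 2)).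
  by apply: eq_tint => x; ring.
rewrite tintD//; last exact: tintegrableB.
rewrite tintB// tintZ// tint_mul_cospoly tint_sqr_cospoly -!addrA; congr (_ + _).
rewrite mulr_sumr -!sumrN -!big_split/=; apply: eq_bigr => k _; ring.
Qed.

Lemma bessel n : \sum_(0 <= k < n) cos_weight k * cos_coef v k ^+ 2 <=
  tint (fun x => v x ^+ 2).
Proof.
have : 0 <= tint (fun x => (v x - cospoly 0 n (cos_coef v) x) ^+ 2).
  by apply: tint_ge0 => x; exact: sqr_ge0.
rewrite tint_sqrB_cospoly [X in _ + X]big1 ?addr0 ?subr_ge0// => k _.
by rewrite subrr expr0n mulr0.
Qed.

Lemma best_approximation n N c : (n <= N)%N ->
  tint (fun x => (v x - cospoly 0 N (cos_coef v) x) ^+ 2) <=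
  tint (fun x => (v x - cospoly 0 n c x) ^+ 2).
Proof.
move=> nN; have [c' ->] := cospoly_widen c nN.
rewrite !tint_sqrB_cospoly lerD2l big1 => [|k _]; last by rewrite subrr expr0n mulr0.
by apply: sumr_ge0 => k _; rewrite mulr_ge0 ?sqr_ge0// ltW// cos_weight_gt0.
Qed.

End BestApproximation.

Variables (f : R -> R) (a : nat -> R) (Z : R).
Hypotheses (hf : plip f) (hZ : forall n, half_norm 0 n a <= Z).

Let cf := plip_continuous hf.
Let v x := f (cosine_series a x).

Lemma measurable_plip_series : measurable_fun setT v.
Proof.
apply: (measurableT_comp (continuous_measurable_fun cf)).
exact: measurable_cosine_series.
Qed.

Let series_le x B : (forall N, block_sum 0 N a x <= B) -> `|cosine_series a x| <= B.
Proof.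
move=> hB; have := cospoly_cvg hB => /cvg_norm h.
apply: (cvgr_to_le h); apply: nearW => J; apply: le_trans (hB J).
exact: (@norm_cospoly_block_sum _ 0 J).
Qed.

Lemma plip_series_dct : [/\ tintegrable (fun x => v x ^+ 2),
  forall J, tintegrable (fun x => (v x - f (cospoly 0 (dyad J) a x)) ^+ 2) &
  tint (fun x => (v x - f (cospoly 0 (dyad J) a x)) ^+ 2) @[J --> \oo] --> 0].
Proof.
have [C [r [C0 r0 bf]]] := plip_le hf.
have mS J : measurable_fun setT (fun x => f (cospoly 0 (dyad J) a x)).
  by apply: continuous_measurable_fun; exact: continuous_comp_cospoly.
have mv := measurable_plip_series.
have sqb B : 0 <= B -> (C * (1 + B ^+ (2 * r))) ^+ 2 <= 2 * C ^+ 2 * (1 + B ^+ (2 * (2 * r))).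
  move=> B0; set T := B ^+ (2 * r).
  have -> : B ^+ (2 * (2 * r)) = T ^+ 2 by rewrite /T -exprM mulnC.
  have : 0 <= C ^+ 2 * (1 - T) ^+ 2 by rewrite mulr_ge0 ?sqr_ge0.
  by rewrite exprMn; lra.
have r2 : (0 < 2 * r)%N by rewrite muln_gt0.
have C2 : 0 <= 2 * C ^+ 2 by rewrite mulr_ge0 ?sqr_ge0.
have C8 : 0 <= 8 * C ^+ 2 by rewrite mulr_ge0 ?sqr_ge0.
have m2 (g : R -> R) : measurable_fun setT g -> measurable_fun setT (fun x => g x ^+ 2).
  by move=> mg; exact: measurable_funX.
have i1 : tintegrable (fun x => v x ^+ 2).
  have [||||//] := @cosine_series_dct _ a Z hZ (2 * r) r2 (2 * C ^+ 2)
    (fun J x => f (cospoly 0 (dyad J) a x) ^+ 2) (fun x => v x ^+ 2) C2.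
  - by move=> J; exact: m2.
  - exact: m2.
  - move=> x cx; have cfx : f (cospoly 0 (dyad J) a x) @[J --> \oo] --> v x.
      exact: (@continuous_cvg _ _ _ _ _ _ f _ (@cf _) cx).
    by apply: cvg_sqr.
  - move=> x B B0 hB J; rewrite normrX; apply: le_trans (sqb B B0).
    rewrite lerXn2r ?nnegrE// ?mulr_ge0 ?addr_ge0 ?exprn_ge0//.
    apply: bf; apply: le_trans (hB J); exact: (@norm_cospoly_block_sum _ 0 J).
have mD J : measurable_fun setT (fun x => (v x - f (cospoly 0 (dyad J) a x)) ^+ 2).
  by apply: m2; apply: measurable_funB.
have bD x B : 0 <= B -> (forall N, block_sum 0 N a x <= B) ->
    forall J, `|(v x - f (cospoly 0 (dyad J) a x)) ^+ 2| <= 8 * C ^+ 2 * (1 + B ^+ (2 * (2 * r))).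
  move=> B0 hB J; rewrite normrX.
  have b1 : `|v x| <= C * (1 + B ^+ (2 * r)) by apply/bf/series_le.
  have b2 : `|f (cospoly 0 (dyad J) a x)| <= C * (1 + B ^+ (2 * r)).
    by apply: bf; apply: le_trans (hB J); exact: (@norm_cospoly_block_sum _ 0 J).
  have b3 : `|v x - f (cospoly 0 (dyad J) a x)| <= 2 * (C * (1 + B ^+ (2 * r))).
    by apply: le_trans (ler_normB _ _) _; lra.
  apply: (@le_trans _ _ ((2 * (C * (1 + B ^+ (2 * r)))) ^+ 2)).
    by rewrite lerXn2r ?nnegrE// ?mulr_ge0 ?addr_ge0 ?exprn_ge0.
  by rewrite exprMn; have := sqb B B0; lra.
split=> // [J|].
  rewrite (_ : (fun x => _) = (fun x => v x ^+ 2 + -2 * (v x * f (cospoly 0 (dyad J) a x)) +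
    f (cospoly 0 (dyad J) a x) ^+ 2)); last by apply/funext => x; ring.
  have cc : continuous (fun x => f (cospoly 0 (dyad J) a x)) by exact: continuous_comp_cospoly.
  apply: tintegrableD; last by apply/continuous_tintegrable/continuous_exprn.
  apply: tintegrableD => //; apply: tintegrableZ.
  apply: (tintegrable_mul_bounded mv i1 (B := C * (1 + l1norm (dyad J) a ^+ (2 * r)))) => // x.
  by apply: bf; exact: norm_cospoly_le.
have -> : 0 = tint (fun=> 0 : R) by rewrite tint_cst mul0r.
have [//|//||//|//] := @cosine_series_dct _ a Z hZ (2 * r) r2 (8 * C ^+ 2)
  (fun J x => (v x - f (cospoly 0 (dyad J) a x)) ^+ 2) (fun=> 0) C8.
move=> x cx; have cfx : f (cospoly 0 (dyad J) a x) @[J --> \oo] --> v x.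
  exact: (@continuous_cvg _ _ _ _ _ _ f _ (@cf _) cx).
rewrite (_ : 0 = (v x - f (cosine_series a x)) ^+ 2); last by rewrite subrr expr0n.
apply: cvg_sqr.
by apply: cvgB => //; exact: cvg_cst.
Qed.

(** The cosine expansion is the best mean-square approximation, so it is enough
    to find some cosine polynomial near [v]: replace the series by a partial sum
    by dominated convergence, then [f] by a Bernstein polynomial. *)
Lemma cosine_expansion_cvg :
  tint (fun x => (v x - cospoly 0 N (cos_coef v) x) ^+ 2) @[N --> \oo] --> 0.
Proof.
have [iv iD cD] := plip_series_dct.
have mv := measurable_plip_series.
apply/cvgrPdist_le => e e0.
have pi20 := @pi2_gt0 R.
have e4 : 0 < e / 4 by rewrite divr_gt0.
have [J hJ] : exists J, tint (fun x => (v x - f (cospoly 0 (dyad J) a x)) ^+ 2) < e / 4.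
  have n1 : \forall J \near \oo, tint (fun x => (v x - f (cospoly 0 (dyad J) a x)) ^+ 2) < e / 4.
    exact: (cvgr_lt _ cD).
  by have [J] := @filter_ex _ _ _ _ n1; exists J.
pose h := cospoly 0 (dyad J) a; pose L := l1norm (dyad J) a + 1.
have L0 : 0 < L by rewrite ltr_wpDl// l1norm_ge0.
have hL x : `|h x| <= L.
  by rewrite (le_trans (norm_cospoly_le _ _ _ _))// lerDl.
have [C [P [C0 hlip]]] := hf.
pose Lip := C * (1 + (2 * L) ^+ P).
have Lip0 : 0 <= Lip by rewrite mulr_ge0// addr_ge0// exprn_ge0// mulr_ge0// ltW.
have fL y z : `|y| <= L -> `|z| <= L -> `|f y - f z| <= Lip * `|y - z|.
  move=> yL zL; apply: le_trans (hlip y z) _; rewrite ler_wpM2r// ler_wpM2l// lerD2l.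
  by rewrite lerXn2r ?nnegrE ?addr_ge0 ?mulr_ge0 ?(ltW L0)//; lra.
pose eps := Num.min 1 (e / (4 * (pi *+ 2))).
have eps0 : 0 < eps by rewrite lt_min ltr01 divr_gt0// mulr_gt0.
have eps1 : eps <= 1 by rewrite ge_min lexx.
have eps2 : eps * (pi *+ 2) <= e / 4.
  have : eps * (4 * (pi *+ 2)) <= e.
    by rewrite -ler_pdivlMr ?mulr_gt0// ge_min lexx orbT.
  lra.
have hcp : is_cospoly h by exists (dyad J), a.
have [T [n [c Tc]] hT] := cospoly_comp_approx hcp L0 Lip0 hL fL eps0.
exists n => // N /= nN.
have t0 : 0 <= tint (fun x => (v x - cospoly 0 N (cos_coef v) x) ^+ 2).
  by apply: tint_ge0 => x; exact: sqr_ge0.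
rewrite sub0r normrN ger0_norm//.
apply: le_trans (best_approximation mv iv c nN) _.
apply: (@le_trans _ _ (tint (fun x =>
    2 * (v x - f (cospoly 0 (dyad J) a x)) ^+ 2 + 2 * eps))).
  apply: le_tint; first exact: tintegrable_sqrB.
    by apply: tintegrableD; [exact: tintegrableZ|exact: tintegrable_cst].
  move=> x; have := hT x; rewrite Tc -/(h x).
  set A := f (h x); set B := cospoly 0 n c x => AB.
  have AB2 : (A - B) ^+ 2 <= eps.
    rewrite -(real_normK (num_real _)); apply: (@le_trans _ _ (eps ^+ 2)).
      by rewrite lerXn2r ?nnegrE// ltW.
    by rewrite expr2 ler_piMr// ltW.
  have s : 0 <= ((v x - A) - (A - B)) ^+ 2 by exact: sqr_ge0.
  lra.
rewrite tintD; [|exact: tintegrableZ|exact: tintegrable_cst].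
by rewrite tintZ// tint_cst; lra.
Qed.

End CosineExpansion.

(** * From weak solutions to even solutions *)

Section Conclusion.
Context {R : realType}.
Notation mu := (@lebesgue_measure R).
Local Open Scope complex_scope.
Local Open Scope ring_scope.

Lemma esum_int_lty (F : int -> R) (B : R) : (forall n, 0 <= F n) ->
  (forall N, \sum_(0 <= k < N) F k%:Z <= B) ->
  (forall N, \sum_(0 <= k < N) F (- k.+1%:Z) <= B) ->
  (\esum_(n in [set: int]) (F n)%:E < +oo)%E.
Proof.
move=> F0 hp hn.
have ser (G : nat -> R) : (forall k, 0 <= G k) ->
    (forall N, \sum_(0 <= k < N) G k <= B) -> (\esum_(k in [set: nat]) (G k)%:E < +oo)%E.
  move=> G0 hG; rewrite -nneseries_esumT; last by move=> k; rewrite lee_fin.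
  apply: (@le_lt_trans _ _ B%:E); last exact: ltry.
  apply: lime_le; first by apply: is_cvg_nneseries => k _ _; rewrite lee_fin.
  by apply: nearW => N; rewrite sumEFin lee_fin.
rewrite (esumID (range Posz)); last by move=> n _; rewrite lee_fin.
rewrite !setTI.
have -> : ~` range Posz = range Negz.
  apply/seteqP; split => [[k|k] //= h|_ [k _ <-] [l _ //]]; last by exists k.
  by exfalso; apply: h; exists k.
rewrite !esum_image; [|by move=> k l _ _ []..].
by apply: lte_add_pinfty; apply: ser.
Qed.

Lemma sum_symmetric (V : zmodType) (F : int -> V) N :
  \sum_(0 <= k < N.*2.+1) F (k%:Z - N%:Z) =
  F 0 + \sum_(0 <= k < N) (F k.+1%:Z + F (- k.+1%:Z)).
Proof.
elim: N => [|N IH]; first by rewrite big_nat1 subr0 big_geq// addr0.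
rewrite doubleS big_nat_recl// big_nat_recr//= [in RHS]big_nat_recr//= [RHS]addrA -IH.
rewrite (eq_big_nat _ _ (F2 := fun k => F (k%:Z - N%:Z))); last first.
  by move=> k _; congr F; lia.
rewrite sub0r [LHS]addrC -[LHS]addrA; congr (_ + (F _ + _)); lia.
Qed.

Lemma normr_int (n : int) : `|n%:~R| = (absz n)%:R :> R.
Proof. by rewrite natr_absz intr_norm. Qed.

Lemma cos_int (n : int) (x : R) : cos (n%:~R * x) = cos ((absz n)%:R * x).
Proof. by case: n => k //; rewrite NegzE abszN/= mulrNz mulNr cosN. Qed.

Lemma normc_real (x : R) : Normc.normc x%:C = `|x|.
Proof. by rewrite /Normc.normc /= expr0n addr0 sqrtr_sqr. Qed.

(** Orthogonality to the sines removes the imaginary part. *)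
Lemma fourier_coef_cos (u : R -> R) (n : int) :
  (forall l, tint (fun x => u x * sin (l * x)) = 0) ->
  fourier_coef u n = ((pi *+ 2)^-1 * tint (fun x => u x * cos ((absz n)%:R * x)))%:C.
Proof.
move=> usin; rewrite /fourier_coef /torus_cintegral.
have -> : Rintegral mu `[- pi, pi] (fun x => complex.Re ((u x)%:C * cis (- (n%:~R * x)))) =
    tint (fun x => u x * cos ((absz n)%:R * x)).
  by apply: eq_tint => x /=; rewrite mul0r subr0 cosN cos_int.
have -> : Rintegral mu `[- pi, pi] (fun x => complex.Im ((u x)%:C * cis (- (n%:~R * x)))) = 0.
  rewrite -[RHS](usin (- n%:~R)); apply: eq_tint => x /=.
  by rewrite mul0r addr0 mulNr.
by apply/eqP; rewrite eq_complex/= !mul0r mulr0 subr0 addr0 !eqxx.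
Qed.

Lemma fourier_partial_sum_cos (r : int -> R) (c : int -> R[i]) N (x : R) :
  (forall n, c n = (r n)%:C) -> (forall n, r (- n) = r n) ->
  fourier_partial_sum c N x =
  (cospoly 0 N.+1 (fun k => if k == 0%N then r 0 else 2 * r k%:Z) x)%:C.
Proof.
move=> cr rN; rewrite /fourier_partial_sum.
rewrite (sum_symmetric (fun n => c n * cis (n%:~R * x))).
rewrite /cospoly big_nat_recl//= rmorphD/= rmorph_sum/=; congr (_ + _).
  rewrite cr !mul0r /cis cos0 sin0.
  by apply/eqP; rewrite eq_complex/=; apply/andP; split; apply/eqP; ring.
apply: eq_bigr => k _; rewrite !cr rN mulrNz mulNr /cis cosN sinN.
by apply/eqP; rewrite eq_complex/=; apply/andP; split; apply/eqP; ring.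
Qed.

Variables (p lam m0 s : R) (m : int -> R).
Hypotheses (p2 : 2 <= p) (lam0 : 0 < lam) (m00 : 0 < m0) (hs : 2^-1 <= s).
Hypotheses (mN : forall n, m (- n) = m n) (m_gt : forall n, n != 0 -> m0 < m n).

Let ell (k : nat) : R := k%:R `^ (2 * s) * m k%:Z.

Let s1 : 1 <= 2 * s. Proof. by move: hs; lra. Qed.

Let ell0 : ell 0 = 0.
Proof.
rewrite /ell powR0 ?mul0r// gt_eqF//; apply: lt_le_trans s1; exact: ltr01.
Qed.

Let ell_ge k : m0 * k%:R <= ell k.
Proof.
case: k => [|k]; first by rewrite mulr0 ell0.
rewrite /ell mulrC; apply: ler_pM => //; first exact: ltW.
  by rewrite le1r_powR// ler1n.
by apply/ltW/m_gt.
Qed.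

(** The affine substitution [u = kappa w + d] turns the normalized equation
    [L w = lam (w + |w|^p)] into the given one; constants are annihilated by
    [L]. *)
Lemma even_solution_of_normalized (lambda kappa d : R) : ell 1 < lam -> kappa != 0 ->
  (forall t, kappa * (lam * nonlin p t) =
    lambda * (kappa * t + d) + `|kappa * t + d| `^ p) ->
  exists2 u : R -> R, even_solution s p m lambda u & nonconstant u.
Proof.
move=> ell1 kappa0 heq.
have p1 : 1 < p by apply: lt_le_trans p2; rewrite ltr1n.
have [a [Z [hZ eqn ncst]]] := weak_solution p2 lam0 m00 ell0 ell_ge ell1.
pose w := cosine_series a; pose f := nonlin p; pose V := cos_coef (fun x => f (w x)).
have hf : plip f by exact: plip_nonlin.
have mw : measurable_fun setT w by exact: measurable_cosine_series.
have [iw2 _ _] := plip_series_dct plip_id hZ.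
have [if2 _ _] := plip_series_dct hf hZ.
have mf := measurable_plip_series a hf.
have iw g B : continuous g -> (forall x, `|g x| <= B) -> tintegrable (fun x => w x * g x).
  by move=> cg gB; exact: (tintegrable_mul_bounded mw iw2 cg gB).
have iw1 : tintegrable w.
  have h : tintegrable (fun x => w x * 1).
    by apply: (iw (fun=> 1) 1) => x; [exact: cvg_cst|rewrite normr1].
  have -> : w = (fun x => w x * 1) by apply/funext => x; rewrite mulr1.
  exact: h.
pose u x := kappa * w x + d.
have mu_ : measurable_fun setT u.
  by apply: measurable_funD => //; exact: measurable_funM.
have elV k : ell k * a k = lam * V k.
  have cw := @cos_weight_gt0 R k.
  apply: (mulfI (lt0r_neq0 cw)); rewrite mulrA eqn mulrCA /V /cos_coef mulVKf//.
  exact: lt0r_neq0.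
have L2 (g : R -> R) : periodic g (pi *+ 2) -> measurable_fun setT g ->
    tintegrable (fun x => g x ^+ 2) -> L2_torus g.
  by move=> pg mg ig; split => //; exact: (integrable_lty measurable_torus ig).
have wcos (k : nat) : tint (fun x => w x * cos (k%:R * x)) = cos_weight k * a k.
  have [_ lim] := cosine_series_plip_dct plip_id (@continuous_cosM R k%:R) (fun x => cos_max _) hZ.
  apply: (cvg_unique _ lim) => //.
  apply: cvg_near_cst; exists k.+1 => // J /= kJ.
  rewrite tint_cospolyM_cos (_ : k < dyad J)%N//.
  exact: leq_trans kJ (leq_id_dyad J).
have wsin (l : R) : tint (fun x => w x * sin (l * x)) = 0.
  have [_ lim] := cosine_series_plip_dct plip_id (@continuous_sinM R l) (fun x => sin_max _) hZ.
  apply: (cvg_unique _ lim) => //.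
  apply: cvg_near_cst; apply: nearW => J.
  rewrite [LHS](_ : _ = tint (fun x => \sum_(0 <= k < dyad J) a k * (cos (k%:R * x) * sin (l * x)))).
    have cc (k : nat) : tintegrable (fun x : R => cos (k%:R * x) * sin (l * x)).
      by apply: continuous_tintegrable => x; apply: cvgM; [exact: continuous_cosM|exact: continuous_sinM].
    rewrite tint_sum => [|k]; last exact: tintegrableZ.
    by apply: big1 => k _; rewrite tintZ// tint_cosM_sin mulr0.
  by apply: eq_tint => x; rewrite mulr_suml; apply: eq_bigr => k _; rewrite mulrA.
have uM (g : R -> R) : continuous g -> (forall x, `|g x| <= 1) ->
    tint (fun x => u x * g x) = kappa * tint (fun x => w x * g x) + d * tint g.
  move=> cg g1; rewrite -!tintZ; [|exact: continuous_tintegrable|exact: (iw _ 1)].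
  rewrite -tintD; [|by apply: tintegrableZ; exact: (iw _ 1)|].
    by apply: eq_tint => x; rewrite /u; ring.
  by apply: tintegrableZ; exact: continuous_tintegrable.
have usin l : tint (fun x => u x * sin (l * x)) = 0.
  rewrite uM; [|exact: continuous_sinM|by move=> x; exact: sin_max].
  by rewrite wsin tint_sin !mulr0 addr0.
have fu (n : int) : n != 0 -> fourier_coef u n = (kappa * a (absz n) / 2)%:C.
  move=> n0; rewrite fourier_coef_cos//; congr (_%:C).
  rewrite uM; [|exact: continuous_cosM|by move=> x; exact: cos_max].
  rewrite wcos tint_cos /cos_weight absz_eq0 (negbTE n0) mulr0 addr0.
  by move: (@pi R) (lt0r_neq0 (@pi_gt0 R)) => P P0; field.
have z0 : `|(0 : int)%:~R| `^ (2 * s) = 0 :> R.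
  by rewrite normr0 powR0// gt_eqF//; apply: lt_le_trans s1; exact: ltr01.
(* By the equation the symbol times the coefficients of w are the coefficients
   of lam * f (w), a square integrable function. *)
have sob : sobolev (2 * s) u.
  split.
    apply: L2 => //; first by move=> x; rewrite /u /w cosine_series_periodic.
    rewrite (_ : (fun x => _) = (fun x => kappa ^+ 2 * w x ^+ 2 + 2 * kappa * d * w x + d ^+ 2)).
      apply: tintegrableD; last exact: tintegrable_cst.
      by apply: tintegrableD; exact: tintegrableZ.
    by apply/funext => x; rewrite /u; ring.
  pose D := kappa ^+ 2 * (lam / m0) ^+ 2 / (4 * pi).
  have pi0 := @pi_gt0 R.
  have D0 : 0 <= D.
    by apply: divr_ge0; apply: mulr_ge0; rewrite ?sqr_ge0 ?(ltW pi0).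
  pose T (n : int) := `|n%:~R| `^ (2 * (2 * s)) * Normc.normc (fourier_coef u n) ^+ 2.
  have T0 n : 0 <= T n by rewrite mulr_ge0 ?powR_ge0 ?sqr_ge0.
  have TD n : T n <= D * (cos_weight (absz n) * V (absz n) ^+ 2).
    have rhs0 : 0 <= D * (cos_weight (absz n) * V (absz n) ^+ 2).
      by rewrite mulr_ge0// mulr_ge0 ?sqr_ge0// ltW// cos_weight_gt0.
    have [n0|n0] := eqVneq n 0.
      rewrite /T n0 normr0 powR0 ?mul0r; first by rewrite -n0.
      by rewrite gt_eqF// mulr_gt0//; apply: lt_le_trans s1; exact: ltr01.
    rewrite /T fu// normc_real (real_normK (num_real _)) normr_int mulrC (mulrC 2) powRrM.
    rewrite powR_mulrn ?powR_ge0//; set k := absz n.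
    have mk : m0 < m k%:Z by apply: m_gt; rewrite eqz_nat absz_eq0.
    have mk0 : 0 < m k%:Z by apply: lt_trans mk.
    have h1 : (k%:R `^ (2 * s) * a k) ^+ 2 <= (lam / m0 * V k) ^+ 2.
      have e : k%:R `^ (2 * s) * a k = lam / m k%:Z * V k.
        by have := elV k; rewrite /ell => h; apply: (mulIf (lt0r_neq0 mk0)); rewrite mulrAC h; field; rewrite gt_eqF.
      rewrite e [leLHS]exprMn [leRHS]exprMn ler_wpM2r ?sqr_ge0// lerXn2r ?nnegrE ?divr_ge0 ?(ltW lam0) ?(ltW mk0) ?(ltW m00)//.
      by rewrite ler_wpM2l ?(ltW lam0)// lef_pV2 ?posrE// ltW.
    have cwk := @cos_weight_ge R k.
    apply: (@le_trans _ _ (kappa ^+ 2 / 4 * (lam / m0 * V k) ^+ 2)).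
      rewrite (_ : (kappa * a k / 2) ^+ 2 * _ = kappa ^+ 2 / 4 * (k%:R `^ (2 * s) * a k) ^+ 2); last by field.
      by rewrite ler_wpM2l// divr_ge0 ?sqr_ge0.
    rewrite (_ : _ * _ = D * (pi * V k ^+ 2)); last by rewrite /D; move: (@pi R) pi0 => P P0; field; rewrite !gt_eqF.
    by rewrite ler_wpM2l// ler_wpM2r ?sqr_ge0.
  have bes N : \sum_(0 <= k < N) cos_weight k * V k ^+ 2 <= tint (fun x => f (w x) ^+ 2).
    exact: bessel.
  apply: (@esum_int_lty T (D * tint (fun x => f (w x) ^+ 2)) T0) => N.
    apply: (@le_trans _ _ (D * \sum_(0 <= k < N) cos_weight k * V k ^+ 2)).
      by rewrite mulr_sumr; apply: ler_sum => k _; exact: TD.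
    by rewrite ler_wpM2l.
  apply: (@le_trans _ _ (D * \sum_(0 <= k < N.+1) cos_weight k * V k ^+ 2)); last first.
    by rewrite ler_wpM2l.
  rewrite big_nat_recl// mulrDr mulr_sumr.
  apply: (@le_trans _ _ (\sum_(0 <= k < N) D * (cos_weight k.+1 * V k.+1 ^+ 2))).
    by apply: ler_sum => k _; have := TD (- k.+1%:Z); rewrite abszN.
  by rewrite lerDr mulr_ge0// mulr_ge0 ?sqr_ge0// ltW// cos_weight_gt0.
exists u; last first.
  move=> [k uk]; apply: ncst; exists ((k - d) / kappa).
  apply: negligibleS uk => x /= h1 h2; apply: h1; rewrite -h2 /u addrK.
  by rewrite mulrAC divff// mul1r.
split; first by split => // x; rewrite /u /w cosine_series_even.
pose v x := kappa * (lam * f (w x)).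
exists v; last by apply/aeW => x; rewrite /v /f heq.
have iv2 : tintegrable (fun x => v x ^+ 2).
  rewrite (_ : (fun x => _) = (fun x => (kappa * lam) ^+ 2 * f (w x) ^+ 2)).
    exact: tintegrableZ.
  by apply/funext => x; rewrite /v; ring.
split.
  apply: L2; last exact: iv2.
    by move=> x; rewrite /v /w cosine_series_periodic.
  apply: measurable_funM; first exact: measurable_cst.
  by apply: measurable_funM; [exact: measurable_cst|exact: mf].
pose c (n : int) := (`|n%:~R| `^ (2 * s) * m n)%:C * fourier_coef u n.
pose r (n : int) := kappa * (`|n%:~R| `^ (2 * s) * m n) * a (absz n) / 2.
have cr n : c n = (r n)%:C.
  rewrite /c /r; have [->|n0] := eqVneq n 0; first by rewrite z0 !mul0r mulr0 !mul0r.
  by rewrite fu// -rmorphM/=; congr (_%:C); ring.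
have rN n : r (- n) = r n by rewrite /r mulrNz normrN mN abszN.
have coefE (k : nat) : (if k == 0%N then r 0 else 2 * r k%:Z) = kappa * lam * V k.
  rewrite -mulrA -elV; have [->|k0] := eqVneq k 0%N.
    by rewrite /r z0 ell0 !(mul0r, mulr0).
  by rewrite /r /ell normr_nat; field.
have diff N x : Normc.normc ((v x)%:C - fourier_partial_sum c N x) ^+ 2 =
    (kappa * lam) ^+ 2 * (f (w x) - cospoly 0 N.+1 V x) ^+ 2.
  rewrite (fourier_partial_sum_cos _ _ cr rN) -rmorphB normc_real (real_normK (num_real _)).
  rewrite -exprMn; congr (_ ^+ 2); rewrite mulrBr /v mulrA; congr (_ - _).
  rewrite /cospoly mulr_sumr; apply: eq_bigr => i _.
  by rewrite coefE -[LHS]mulrA.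
have iN N : tintegrable (fun x => (f (w x) - cospoly 0 N.+1 V x) ^+ 2).
  exact: tintegrable_sqrB.
have lim : (kappa * lam) ^+ 2 * tint (fun x => (f (w x) - cospoly 0 N.+1 V x) ^+ 2) @[N --> \oo] --> 0.
  rewrite -(mulr0 ((kappa * lam) ^+ 2)); apply: cvgMr.
  have h := cosine_expansion_cvg hf hZ.
  by rewrite -(cvg_shiftS (fun N => tint (fun x => (f (w x) - cospoly 0 N V x) ^+ 2))) in h.
have eI N : (\int[mu]_(x in `[(- pi)%R, pi])
     (Normc.normc ((v x)%:C - fourier_partial_sum c N x) ^+ 2)%:E)%E =
    ((kappa * lam) ^+ 2 * tint (fun x => (f (w x) - cospoly 0 N.+1 V x) ^+ 2))%:E.
  rewrite -tintZ// /tint /Rintegral fineK.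
    by apply: eq_integral => x _; rewrite diff.
  exact: (integrable_fin_num measurable_torus (tintegrableZ _ (iN N))).
rewrite (_ : (fun N : nat => _) = (fun N =>
    ((kappa * lam) ^+ 2 * tint (fun x => (f (w x) - cospoly 0 N.+1 V x) ^+ 2))%:E)).
  by apply: cvg_EFin => //; exact: nearW.
by apply/funext => N; rewrite eI.
Qed.

End Conclusion.

(** * Existence of non-constant even solutions *)

(** For positive [lambda] the right-hand side is homogenized by a dilation of
    the unknown. *)
Lemma even_solution_pos (R : realType) (s p m0 lambda : R) (m : int -> R) :
  2 <= p -> 0 < m0 -> 2^-1 <= s -> (forall n, m (- n) = m n) ->
  (forall n, n != 0 -> m0 < m n) -> m 1 < lambda ->
  exists2 u : R -> R, even_solution s p m lambda u & nonconstant u.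
Proof.
move=> p2 m00 hs mN m_gt m1.
have l0 : 0 < lambda by apply: lt_trans m1; apply: (lt_trans m00); exact: m_gt.
pose kappa := lambda `^ (p - 1)^-1.
have k0 : 0 < kappa by exact: powR_gt0.
have p1 : 0 < p - 1 by move: p2; lra.
have kp : kappa `^ p = kappa * lambda.
  rewrite -mulr_powRB1 ?(ltW k0)//; last by move: p2; lra.
  by rewrite /kappa -powRrM mulVf ?gt_eqF// powRr1// ltW.
apply: (@even_solution_of_normalized R p lambda m0 s m p2 l0 m00 hs mN m_gt lambda kappa 0).
- by rewrite powR1 mul1r.
- exact: lt0r_neq0.
- move=> t; rewrite /nonlin !addr0 normrM (gtr0_norm k0) powRM ?(ltW k0)// kp.
  by ring.
Qed.

(** For negative [lambda] and the quadratic nonlinearity, translating by the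
    constant solution [- lambda] changes the sign of the linear term. *)
Lemma even_solution_neg (R : realType) (s m0 lambda : R) (m : int -> R) :
  0 < m0 -> 2^-1 <= s -> (forall n, m (- n) = m n) ->
  (forall n, n != 0 -> m0 < m n) -> lambda < - m 1 ->
  exists2 u : R -> R, even_solution s 2 m lambda u & nonconstant u.
Proof.
move=> m00 hs mN m_gt m1.
have l0 : 0 < - lambda.
  by rewrite -[X in X < _]oppr0 ltrN2 (lt_trans m1)// oppr_lt0 (lt_trans m00)// m_gt.
apply: (@even_solution_of_normalized R 2 (- lambda) m0 s m (lexx _) l0 m00 hs mN m_gt
  lambda (- lambda) (- lambda)).
- by rewrite powR1 mul1r ltrNr.
- exact: lt0r_neq0.
- move=> t; rewrite /nonlin !powR_mulrn ?normr_ge0// !real_normK ?num_real//.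
  by ring.
Qed.

Theorem theorem1p1 (R : realType) (s p : R) (m : int -> R)
  (m_ge0 : forall n : int, 0 <= m n)
  (M1 : forall n : int, m (- n) = m n)
  (M2 : forall j k : nat, (1 <= j)%N -> (j <= k)%N -> m j%:Z <= m k%:Z)
  (M3 : exists m0 m1 : R, [/\ 0 < m0, 0 < m1 &
          forall n : int, n != 0 -> m0 < m n < m1])
  (hs : 2^-1 <= s) (hp : 2 <= p < 4 * s + 1) :
  (forall lambda : R,
     m 1 < lambda < 2 `^ (2 * s) * m 2 ->
     exists2 u : R -> R, even_solution s p m lambda u & nonconstant u) /\
  (p = 2 -> forall lambda : R,
     - (2 `^ (2 * s) * m 2) < lambda < - m 1 \/
     m 1 < lambda < 2 `^ (2 * s) * m 2 ->
     exists2 u : R -> R, even_solution s p m lambda u & nonconstant u).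
Proof.
have [m0 [m1 [m00 _ mb]]] := M3.
have m_gt n : n != 0 -> m0 < m n by move=> /mb/andP[].
have /andP[p2 _] := hp.
split => [lambda /andP[l1 _]|-> lambda [/andP[_ l1]|/andP[l1 _]]].
- exact: (even_solution_pos p2 m00 hs M1 m_gt l1).
- exact: (even_solution_neg m00 hs M1 m_gt l1).
- exact: (even_solution_pos (lexx 2) m00 hs M1 m_gt l1).
Qed.
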